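(* Let $v>0$, $r\ge 0$ and let $\rho\in(0,1/(2r)]$ (with $\rho\in(0,\infty)$ if $r=0$). Then there is a family of probability measures $(\mu_\rho^p)_{0<p\le 1}$ on the space of admissible configurations of indistinguishable particles such that for each $p\in(0,1]$ the measure $\mu_\rho^p$ is a nontrivial (i.e. non-atomic) invariant measure of the process $\pi(p,v,r,\mathbb{R})$ supported by the set of configurations of density $\rho$, and $\mu_\rho^p\to\mu_\rho^1$ weakly as $p\to1$.
   Context: Configurations. For $r\ge0$ an admissible configuration is a bi-infinite sequence $x=(x_i)_{i\in\mathbb{Z}}$ of real numbers (centers of balls of radius $r$, called particles) with $x_i+r\le x_{i+1}-r$ for all $i$. The set of admissible configurations is $X(r,\mathbb{R})$; it carries the topology generated by the finite cylinders $\{x: x_i\in C_i\ \forall i\in I\}$, with $I\subset\mathbb{Z}$ finite and $C_i\subset\mathbb{R}$ open intervals, and the $\sigma$-algebra generated by these cylinders. Process. $\pi(p,v,r,\mathbb{R})$ is the discrete time Markov process on $X(r,\mathbb{R})$ in which, independently for every particle $i$ and every time $t\in\{0,1,2,\dots\}$, $x_i^{t+1}=\min\{x_i^t+v,\ x_{i+1}^t-2r\}$ with probability $p$ and $x_i^{t+1}=x_i^t$ with probability $1-p$ (all particles are updated simultaneously; for $p=1$ the process is deterministic). Indistinguishable particles. Invariant measures always refer to the modification of the process in which particles are indistinguishable: two configurations are identified if they differ only by a shift of the index, $x_i'=x_{i+k}$ for some $k\in\mathbb{Z}$ and all $i$; the dynamics is compatible with this identification, and the space of configurations of indistinguishable particles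 is given the quotient topology and quotient $\sigma$-algebra. A probability measure on this space is invariant if it is preserved by the one-step transition kernel of the process. Density. $\rho(x):=\lim_{n\to\infty} n/(x_{n-1}-x_0)$ if the limit exists (this does not depend on the labelling). A measure is supported by the set of configurations of density $\rho$ if this set has full measure. ''Non-atomic'' means that no single configuration has positive measure. *)

(* Defs.v *)
From HB Require Import structures.
From mathcomp Require Import all_boot all_order all_algebra finmap.
From mathcomp Require Import all_classical all_reals all_analysis.
From mathcomp Require Import lra.

Set Implicit Arguments.
Unset Strict Implicit.
Unset Printing Implicit Defensive.

Import Order.TTheory GRing.Theory Num.Theory.
Import numFieldNormedType.Exports.

Local Open Scope classical_set_scope.
Local Open Scope ring_scope.
Local Open Scope quotient_scope.

Section Configurations.
Context {R : realType}.
Implicit Types r : {nonneg R}.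

Definition admissible r (x : int -> R) : Prop :=
  forall i : int, x i + r%:num <= x (i + 1) - r%:num.

Record config r := Config {
  center :> int -> R;
  centerP : admissible r center
}.

Lemma config_inj r (x y : config r) : center x = center y -> x = y.
Proof.
case: x y => [x xP] [y yP] /= xy; rewrite -{y}xy in yP *.
by congr Config; exact: Prop_irrelevance.
Qed.

Lemma packed_admissible r : admissible r (fun i => i%:~R * (r%:num *+ 2)).
Proof.
by move=> i; rewrite rmorphD /= mulrDl mul1r [X in _ + X - _]mulr2n addrA addrK.
Qed.

HB.instance Definition _ r := gen_eqMixin (config r).
HB.instance Definition _ r := gen_choiceMixin (config r).
HB.instance Definition _ r :=
  isPointed.Build (config r) (Config (packed_admissible r)).

Definition cylinders (r : {nonneg R}) : set_system (config r) :=
  [set A | exists (I : {fset int}) (C : int -> set R),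
     (forall i, open (C i) /\ is_interval (C i)) /\
     A = [set x : config r | forall i, i \in I -> C i (x i)]].

HB.instance Definition _ r :=
  isSubBaseTopological.Build (config r) (@cylinders r) id.

HB.instance Definition _ r :=
  @isMeasurable.Build (sigma_display (@cylinders r)) (config r)
    <<s @cylinders r >> (@sigma_algebra0 _ setT _)
    (@sigma_algebraC _ _) (@sigma_algebra_bigcup _ setT _).

Definition relabel r (x y : config r) : bool :=
  `[< exists k : int, forall i, y i = x (i + k) >].

Lemma relabel_refl r : reflexive (@relabel r).
Proof. by move=> x; apply/asboolP; exists 0 => i; rewrite addr0. Qed.

Lemma relabel_sym r : symmetric (@relabel r).
Proof.
suff h x y : relabel x y -> @relabel r y x by move=> x y; apply/idP/idP; exact: h.
by move=> /asboolP[k yx]; apply/asboolP; exists (- k) => i; rewrite yx subrK.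
Qed.

Lemma relabel_trans r : transitive (@relabel r).
Proof.
move=> y x z /asboolP[k yx] /asboolP[l zy]; apply/asboolP; exists (l + k) => i.
by rewrite zy yx addrA.
Qed.

Canonical relabel_equiv r :=
  EquivRel (@relabel r) (@relabel_refl r) (@relabel_sym r) (@relabel_trans r).

(* Configurations of indistinguishable particles. *)
Definition uconfig r : Type := quotient_topology {eq_quot (relabel_equiv r)}.

HB.instance Definition _ r := Quotient.on (uconfig r).
HB.instance Definition _ r := Topological.on (uconfig r).
HB.instance Definition _ r := isPointed.Build (uconfig r) (\pi_(uconfig r) point).

Definition quotient_measurable r : set_system (uconfig r) :=
  image_set_system [set: config r] (\pi_(uconfig r)) measurable.

Lemma quotient_sigma_algebra r : sigma_algebra setT (@quotient_measurable r).
Proof. exact/sigma_algebra_image/sigma_algebra_measurable. Qed.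

Fact quotient_measurableC r (A : set (uconfig r)) :
  quotient_measurable A -> quotient_measurable (~` A).
Proof. by case: (quotient_sigma_algebra r) => _ h _ /h; rewrite setTD. Qed.

HB.instance Definition _ r :=
  @isMeasurable.Build (sigma_display (@quotient_measurable r)) (uconfig r)
    (@quotient_measurable r)
    (let: And3 h _ _ := quotient_sigma_algebra r in h)
    (@quotient_measurableC r)
    (let: And3 _ _ h := quotient_sigma_algebra r in h).


(* For [r = 0] the denominator may vanish, and the quotient is then [0]; this
   has no effect on the convergence to some [rho > 0]. *)
Definition has_density r (x : config r) (rho : R) : Prop :=
  (fun n : nat => n%:R / (x (n%:Z - 1) - x 0)) @ \oo --> rho.

(* A density [rho > 0] does not depend on the labelling. *)
Definition density_set r (rho : R) : set (uconfig r) :=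
  [set \pi_(uconfig r) x | x in [set x : config r | has_density x rho]].

End Configurations.

Arguments density_set {R} r rho.

Section Process.
Context {R : realType}.
Variables (v : {posnum R}) (r : {nonneg R}).

(* [A] is the set of the particles that attempt to jump. *)
Definition step_fun (x : int -> R) (A : set int) (i : int) : R :=
  if i \in A then Num.min (x i + v%:num) (x (i + 1) - 2 * r%:num) else x i.

Lemma step_admissible (x : int -> R) (A : set int) :
  admissible r x -> admissible r (step_fun x A).
Proof.
move=> xP i; rewrite /step_fun.
have v0 : 0 < v%:num by [].
move: (xP i) (xP (i + 1)); set a := x i; set b := x (i + 1).
set c := x (i + 1 + 1) => ab bc.
by case: (i \in A); case: (i + 1 \in A);
  rewrite ?minEle; do ?case: ifPn => ?; lra.
Qed.

Definition step (x : config r) (A : set int) : config r :=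
  Config (step_admissible A (centerP x)).

Definition mutually_independent d (T : measurableType d)
    (P : probability T R) (J : int -> set T) : Prop :=
  forall I : {fset int},
    fine (P (\bigcap_(i in [set` I]) J i)) = \prod_(i <- I) fine (P (J i)).

(* [J i] is the event that particle [i] attempts to jump. The conditions
   determine the law of the random set of jumping particles, hence [K]. *)
Definition transition_kernel (p : R) (K : R.-pker config r ~> config r) : Prop :=
  exists (d : measure_display) (T : measurableType d) (P : probability T R)
         (J : int -> set T),
    [/\ forall i, measurable (J i),
        forall i, P (J i) = p%:E,
        mutually_independent P J &
        forall (x : config r) (B : set (config r)), measurable B ->
          K x B = P [set w | B (step x [set i | J i w])]].

Definition quotient_kernel (K : R.-pker config r ~> config r)
    (Q : R.-pker uconfig r ~> uconfig r) : Prop :=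
  forall (x : config r) (B : set (uconfig r)), measurable B ->
    Q (\pi_(uconfig r) x) B = K x (\pi_(uconfig r) @^-1` B).

(* For [0 <= p <= 1], [transition_kernel] and [quotient_kernel] determine [K]
   and [Q] on measurable sets: the existential quantifiers only name the
   one-step transition kernel of the process. *)
Definition invariant_measure (p : R) (mu : probability (uconfig r) R) : Prop :=
  exists (K : R.-pker config r ~> config r)
         (Q : R.-pker uconfig r ~> uconfig r),
    [/\ transition_kernel p K, quotient_kernel K Q &
        forall B, measurable B -> (\int[mu]_q Q q B)%E = mu B].

Definition nonatomic (mu : probability (uconfig r) R) : Prop :=
  forall q : uconfig r, mu [set q] = 0%E.

Definition weakly_cvg {I : Type} (F : set_system I)
    (mu : I -> probability (uconfig r) R) (nu : probability (uconfig r) R) :=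
  forall f : uconfig r -> R, continuous f -> bounded_fun f ->
    (\int[mu i]_q (f q)%:E)%E @[i --> F] --> (\int[nu]_q (f q)%:E)%E.

End Process.

(* Main.v *)
Require Import Defs.
From HB Require Import structures.
From mathcomp Require Import all_boot all_order all_algebra finmap.
From mathcomp Require Import all_classical all_reals all_analysis.
From mathcomp Require Import measurable_realfun.
From mathcomp Require Import ring lra zify.

Set Implicit Arguments.
Unset Strict Implicit.
Unset Printing Implicit Defensive.

Import Order.TTheory GRing.Theory Num.Theory.
Import numFieldNormedType.Exports.

Local Open Scope classical_set_scope.
Local Open Scope ring_scope.
Local Open Scope quotient_scope.

(** Look at the free gaps, the distances of consecutive centres minus [2 r]. If all
    of them are multiples of [v], they remain so, a ball that jumps moves by
    exactly [v], and the free gap in front of ball [i], in units of [v], is the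
    number [n i] of customers of a zero range process: a customer leaves a
    nonempty site [i] with probability [p] and goes to the site [i - 1]. This
    process has product stationary laws. Write [n i = G i + B i] with independent [G i], geometric
    of ratio [q], and [B i], Bernoulli of parameter [a]. If
    [p (1 - a) q = (1 - p) a], the number of customers who stay at a site and
    the indicator of a departure from it are again distributed as the pair
    [(G i, B i)] ([site_step_pmf], a discrete form of Burke's theorem). Since
    the departures from the site [i + 1] are the arrivals at the site [i], the
    new pairs are obtained from the pairs produced site by site by moving the
    second components one step, which preserves the law ([iid_stagger],
    [gap_law_stationary]).

    The gaps and the position of ball 0 determine the configuration. Take the
    product [M] of the gap law and Lebesgue measure. It is infinite and counts a
    configuration of indistinguishable particles once for every choice of
    ball 0. To count it once, keep the part where the origin lies between the
    balls 0 and 1. The mass of this part is the mean distance [c] of two balls,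
    and [1 / c] times its image is the measure [stationary].

    It is invariant because a step preserves [M], up to a translation that
    depends on the gaps and that Lebesgue measure absorbs ([skew_preserves]).
    The step may carry a ball across the origin, but the condition that the
    origin lies between the balls 0 and 1 selects one label per configuration
    both before and after the step, and two such selections give the same mass
    to every set that does not depend on the labels
    ([fundamental_domain_exchange]). For this the balls must be unbounded on
    both sides, which follows, like the density [1 / c], from the strong law of
    large numbers for the gaps ([strong_law], [gap_law_typical]). An atom is
    impossible because the law of the position of ball 0 is absolutely
    continuous, while one class offers only countably many choices of ball 0
    ([stationary_nonatomic]).

    For a mean gap [m = (1 / rho - 2 r) / v] the balance equation and
    [q / (1 - q) + a = m] lead to a quadratic equation, whose solution
    ([jumped], [geo_ratio]) depends continuously on [p]. Realize all the gap laws
    on one space of coin tosses, by quantiles. When [p] tends to 1, almost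
    surely every single gap is eventually equal to its limit, so that weak
    convergence is dominated convergence ([integral_coupling_cvg]).

    All the random variables are functions of fair coin tosses, that is, of the
    binary digits of a uniform variable. The even and the odd digits are
    independent copies of the whole sequence, so that independent variables are
    obtained by splitting the digits repeatedly. *)

(** * Laws determined by pi-systems *)

Lemma probability_unique d (T : measurableType d) (R : realType)
    (G : set_system T) (P1 P2 : probability T R) :
  measurable = <<s G >> -> setI_closed G -> G setT ->
  (forall A, G A -> P1 A = P2 A) ->
  forall A, measurable A -> P1 A = P2 A.
Proof.
move=> mG GI GT P12 A mA.
apply: (measure_unique G (fun=> setT)) => //.
- by rewrite bigcup_const//; exists 0%N.
- by move=> _; rewrite -ge0_fin_numE// fin_num_measure.
Qed.

Section product_law.
Context d d1 d2 (T : measurableType d) (T1 : measurableType d1)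
  (T2 : measurableType d2) (R : realType).
Variables (P : probability T R) (P1 : probability T1 R) (P2 : probability T2 R).
Variables (X : {mfun T >-> T1}) (Y : {mfun T >-> T2}).

(** Uniqueness of measures, one factor at a time: for a fixed event on one side
    both members are finite measures of the event on the other side. *)
Lemma independent_pi_system (G1 : set_system T1) (G2 : set_system T2) :
  measurable = <<s G1 >> -> setI_closed G1 -> G1 setT ->
  measurable = <<s G2 >> -> setI_closed G2 -> G2 setT ->
  (forall A B, G1 A -> G2 B ->
    P (X @^-1` A `&` Y @^-1` B) = (P1 A * P2 B)%E) ->
  forall A B, measurable A -> measurable B ->
    P (X @^-1` A `&` Y @^-1` B) = (P1 A * P2 B)%E.
Proof.
move=> mG1 GI1 GT1 mG2 GI2 GT2 XY.
have X1 A : G1 A -> measurable A by rewrite mG1; exact: sub_sigma_algebra.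
have X2 A : G2 A -> measurable A by rewrite mG2; exact: sub_sigma_algebra.
have fst_step A B : measurable A -> G2 B ->
    P (X @^-1` A `&` Y @^-1` B) = (P1 A * P2 B)%E.
  move=> mA GB.
  have mYB : measurable (Y @^-1` B) by apply: measurable_funPTI; exact: X2.
  have P2B : P2 B \is a fin_num by apply: fin_num_measure; exact: X2.
  have c0 : 0 <= fine (P2 B) by exact: fine_ge0.
  pose m1 := pushforward (mrestr P mYB) X.
  pose m2 := mscale (NngNum c0) P1.
  suff : m1 A = m2 A by rewrite /m1 /m2 /mscale/= fineK// muleC.
  apply: (measure_unique G1 (fun=> setT)) => //.
  - by rewrite bigcup_const//; exists 0%N.
  - by move=> C GC; rewrite /= /mscale/= fineK// muleC -XY.
  - move=> k; rewrite /= /pushforward/= /mrestr.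
    by rewrite preimage_setT setTI -ge0_fin_numE// fin_num_measure.
move=> A B mA mB.
have mXA : measurable (X @^-1` A) by exact: measurable_funPTI.
have P1A : P1 A \is a fin_num by exact: fin_num_measure.
have c0 : 0 <= fine (P1 A) by exact: fine_ge0.
pose m1 := pushforward (mrestr P mXA) Y.
pose m2 := mscale (NngNum c0) P2.
suff : m1 B = m2 B by rewrite /m1 /m2 /mscale/= fineK// setIC.
apply: (measure_unique G2 (fun=> setT)) => //.
- by rewrite bigcup_const//; exists 0%N.
- by move=> C GC; rewrite /= /mscale/= fineK// -fst_step// setIC.
- move=> k; rewrite /= /pushforward/= /mrestr.
  by rewrite preimage_setT setTI -ge0_fin_numE// fin_num_measure.
Qed.

Lemma product_law :
  (forall A B, measurable A -> measurable B ->
    P (X @^-1` A `&` Y @^-1` B) = (P1 A * P2 B)%E) ->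
  forall C, measurable C -> P [set w | C (X w, Y w)] = (P1 \x P2)%E C.
Proof.
move=> XY C mC.
have mXY : measurable_fun setT (fun w => (X w, Y w)).
  by apply: measurable_fun_pair.
pose W : {mfun T >-> (T1 * T2)%type} := mfun_Sub (mem_set mXY).
apply/esym.
rewrite (@product_measure_unique _ _ _ _ _ P1 P2 (distribution P W))//.
Qed.

End product_law.

(** * Sequence spaces *)

(** A copy of the function type, which carries the sigma-algebra generated by
    the values at the single indices. *)
Definition seqs (I S : Type) : Type := I -> S.

Section seqs_measurable.
Variables (I : Type) (S : pointedType).

Definition coordinate_events : set_system (seqs I S) :=
  [set A | exists i s, A = [set f | f i = s]].

HB.instance Definition _ := gen_eqMixin (seqs I S).
HB.instance Definition _ := gen_choiceMixin (seqs I S).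
HB.instance Definition _ := isPointed.Build (seqs I S) (fun=> point).
HB.instance Definition _ :=
  @isMeasurable.Build (sigma_display coordinate_events) (seqs I S)
    <<s coordinate_events >> (@sigma_algebra0 _ setT _)
    (@sigma_algebraC _ _) (@sigma_algebra_bigcup _ setT _).

End seqs_measurable.

(** For countable targets, where every subset is an event; no sigma-algebra on
    [S] has to be chosen. *)
Definition discrete_rv d (T : measurableType d) (S : Type) (X : T -> S) :=
  forall A : set S, measurable (X @^-1` A).

Section discrete_rv.
Context d (T : measurableType d).

Lemma discrete_rv_countable (S : Type) (X : T -> S) : countable [set: S] ->
  (forall s, measurable [set w | X w = s]) -> discrete_rv X.
Proof.
move=> cS mX A.
have -> : X @^-1` A = \bigcup_(s in A) [set w | X w = s].
  by apply/seteqP; split=> [w Aw|w [s As/= ->]//]; exists (X w).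
have -> : \bigcup_(s in A) [set w | X w = s] =
    \bigcup_s (if s \in A then [set w | X w = s] else set0).
  exact: bigcup_mkcond.
apply: countable_bigcupT_measurable => // s.
by case: ifP.
Qed.

Lemma discrete_rv_comp (S S' : Type) (X : T -> S) (h : S -> S') :
  discrete_rv X -> discrete_rv (h \o X).
Proof. by move=> mX A; exact: (mX (h @^-1` A)). Qed.

Lemma discrete_rv_measurable (S : Type) d' (T' : measurableType d')
  (X : T -> S) (h : S -> T') :
  discrete_rv X -> measurable_fun setT (h \o X).
Proof. by move=> mX _ A mA; rewrite setTI; exact: (mX (h @^-1` A)). Qed.

Lemma discrete_rv_mfun (S : Type) d' (T' : measurableType d') (Y : T -> T')
  (X : T' -> S) : measurable_fun setT Y -> discrete_rv X ->
  discrete_rv (X \o Y).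
Proof.
by move=> mY mX A; rewrite comp_preimage -[X in measurable X]setTI; exact: mY.
Qed.

Lemma discrete_rv_pair (S S' : Type) (X : T -> S) (Y : T -> S') :
  countable [set: S] -> countable [set: S'] ->
  discrete_rv X -> discrete_rv Y -> discrete_rv (fun w => (X w, Y w)).
Proof.
move=> cS cS' mX mY; apply: discrete_rv_countable.
  by rewrite -setXTT; exact: countableX.
move=> [s s'].
have -> : [set w | (X w, Y w) = (s, s')] =
    X @^-1` [set s] `&` Y @^-1` [set s'].
  by apply/seteqP; split=> w /=; case=> -> ->.
exact: measurableI.
Qed.

Lemma measurable_seqs (I : Type) (S : pointedType) (X : T -> seqs I S) :
  (forall i s, measurable [set w | X w i = s]) -> measurable_fun setT X.
Proof.
move=> mX; apply: (measurability (@coordinate_events I S)) => //.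
by move=> _ [_ [i [s ->]] <-]; rewrite setTI; exact: mX.
Qed.

End discrete_rv.

Lemma discrete_rv_coord (I : Type) (S : pointedType) (i : I) :
  countable [set: S] -> discrete_rv (fun f : seqs I S => f i).
Proof.
move=> cS; apply: discrete_rv_countable => // s.
by apply: sub_sigma_algebra; exists i, s.
Qed.

(** * Independent identically distributed sequences *)

Section iid.
Variables (R : realType) (I : countType) (S : pointedType).
Implicit Types (Q : S -> \bar R) (J : {fset I}) (s : I -> S).

(** [Q] is the common point mass function; finitely many coordinates suffice to
    describe the law. *)
Definition is_iid Q (m : set (seqs I S) -> \bar R) : Prop :=
  forall J s, m [set f | forall i, i \in J -> f i = s i] =
    (\prod_(i <- J) Q (s i))%E.

Lemma eq_is_iid Q Q' m : Q =1 Q' -> is_iid Q m -> is_iid Q' m.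
Proof. by move=> QQ' mQ J s; rewrite mQ; apply: eq_bigr => i _; rewrite QQ'. Qed.

(** The empty set is included for closure under intersection: two cylinders may
    prescribe different values at one index. *)
Definition point_cylinders : set_system (seqs I S) :=
  [set A | A = set0 \/ exists J s, A = [set f | forall i, i \in J -> f i = s i]].

Lemma measurable_point_cylinder J s :
  measurable [set f : seqs I S | forall i, i \in J -> f i = s i].
Proof.
have -> : [set f : seqs I S | forall i, i \in J -> f i = s i] =
    \bigcap_i (if i \in J then [set f : seqs I S | f i = s i] else setT).
  apply/seteqP; split=> f /= fs i => [_|iJ].
    by case: ifPn => // iJ; exact: fs.
  by have := fs i Logic.I; rewrite iJ.
rewrite -[X in measurable X]setCK setC_bigcap; apply: measurableC.
apply: countable_bigcupT_measurable; [exact: countableP|move=> i].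
apply: measurableC.
by case: ifP => // _; apply: sub_sigma_algebra; exists i, (s i).
Qed.

Lemma point_cylinders_generate :
  @measurable _ (seqs I S) = <<s point_cylinders >>.
Proof.
apply/seteqP; split; apply: smallest_sub; try exact: smallest_sigma_algebra.
  move=> _ [i [s ->]]; apply: sub_sigma_algebra; right.
  exists [fset i]%fset, (fun=> s); apply/seteqP; split=> f /=.
    by move=> fs j; rewrite inE => /eqP ->.
  by move=> ->//; rewrite inE.
move=> _ [->|[J [s ->]]]; first exact: measurable0.
exact: measurable_point_cylinder.
Qed.

Lemma point_cylindersI : setI_closed point_cylinders.
Proof.
move=> A B [->|[J [s ->]]]; first by rewrite set0I; left.
move=> [->|[J' [s' ->]]]; first by rewrite setI0; left.
have [ss'|ss'] := pselect (forall i, i \in J -> i \in J' -> s i = s' i).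
  right; exists (J `|` J')%fset, (fun i => if i \in J then s i else s' i).
  apply/seteqP; split=> f /=.
    move=> [fs fs'] i; rewrite inE; case: ifP => iJ /= H; first exact: fs.
    exact: fs'.
  move=> fs; split=> i iJ.
    by have := fs i; rewrite inE iJ/=; exact.
  have := fs i; rewrite inE iJ orbT => ->//.
  by case: ifP => // iJ'; exact: ss'.
left; apply/seteqP; split=> // f /= [fs fs']; apply: ss' => i iJ iJ'.
by rewrite -fs// fs'.
Qed.

(** The cylinders form a pi-system that generates the sigma-algebra. *)
Lemma iid_unique Q (m1 m2 : probability (seqs I S) R) :
  is_iid Q m1 -> is_iid Q m2 -> forall A, measurable A -> m1 A = m2 A.
Proof.
move=> mQ1 mQ2; apply: probability_unique.
- exact: point_cylinders_generate.
- exact: point_cylindersI.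
- right; exists fset0, (fun=> point).
  by apply/seteqP; split=> // f _ i; rewrite inE.
- by move=> A [->|[J [s ->]]]; rewrite ?measure0// mQ1 mQ2.
Qed.

End iid.

Section shift.
Variables (R : realType) (S : pointedType).

Definition shift_seq (k : int) (f : seqs int S) : seqs int S := fun i => f (i + k).

Lemma measurable_shift k : measurable_fun setT (shift_seq k).
Proof.
apply: measurable_seqs => i s.
by apply: sub_sigma_algebra; exists (i + k), s.
Qed.

HB.instance Definition _ k :=
  isMeasurableFun.Build _ _ _ _ (shift_seq k) (measurable_shift k).

Lemma is_iid_shift k (Q : S -> \bar R) (m : probability (seqs int S) R) :
  is_iid Q m -> forall A, measurable A -> m (shift_seq k @^-1` A) = m A.
Proof.
move=> mQ A mA; apply: (@iid_unique _ _ _ Q (distribution m (shift_seq k)) m) => //.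
move=> J s.
transitivity (m [set f | forall i, i \in [fset (j + k)%R | j in J]%fset ->
    f i = s (i - k)]).
  congr (m _); apply/seteqP; split=> f /= fs i.
    by move=> /imfsetP[j /= jJ ->]; rewrite addrK; exact: fs.
  move=> iJ; rewrite /shift_seq fs ?addrK//.
  by apply/imfsetP; exists i.
rewrite mQ big_imfset/=; last by move=> i j _ _ /addIr.
by apply: eq_bigr => i _; rewrite addrK.
Qed.

End shift.

Section zip.
Variables (R : realType) (S S' : pointedType).

Definition zips (fg : seqs int S * seqs int S') : seqs int (S * S')%type :=
  fun i => (fg.1 i, fg.2 i).

Lemma measurable_zips : measurable_fun setT zips.
Proof.
apply: measurable_seqs => i [s s'].
have -> : [set w | zips w i = (s, s')] =
    [set f | f i = s] `*` [set g | g i = s'].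
  by apply/seteqP; split=> -[f g]; rewrite /zips/=; case=> -> ->.
by apply: measurableX; apply: sub_sigma_algebra; do 2 eexists.
Qed.

HB.instance Definition _ :=
  isMeasurableFun.Build _ _ _ _ zips measurable_zips.

Lemma is_iid_zips (Q : S -> \bar R) (Q' : S' -> \bar R)
    (m : probability (seqs int S) R) (m' : probability (seqs int S') R) :
  is_iid Q m -> is_iid Q' m' ->
  is_iid (fun s => (Q s.1 * Q' s.2)%E) (pushforward (m \x m')%E zips).
Proof.
move=> mQ mQ' J s; rewrite /pushforward.
have -> : zips @^-1` [set f | forall i, i \in J -> f i = s i] =
    [set f | forall i, i \in J -> f i = (s i).1] `*`
    [set f | forall i, i \in J -> f i = (s i).2].
  apply/seteqP; split=> -[f g]/=.
    by move=> fs; split=> i iJ; rewrite -fs.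
  by move=> [fs gs] i iJ; rewrite /zips/= fs// gs//; case: (s i).
rewrite product_measure1E ?big_split/= ?mQ ?mQ'//;
  exact: measurable_point_cylinder.
Qed.

End zip.

Section splitting_space.
Context d (U : measurableType d) (R : realType).
Variables (P : probability U R) (T1 T2 : {mfun U >-> U}).

(** From one point of [U] the maps extract two points, which are independent and
    both distributed as the given point. *)
Definition splits : Prop := forall A B, measurable A -> measurable B ->
  P (T1 @^-1` A `&` T2 @^-1` B) = (P A * P B)%E.

(** Split off [T1], and go on splitting what [T2] leaves. *)
Definition component (k : nat) (w : U) : U := T1 (iter k T2 w).

Lemma measurable_iter_mfun k : measurable_fun setT (iter k T2).
Proof.
elim: k => [|k IH]/=; first exact: measurable_id.
exact: measurableT_comp.
Qed.

Lemma measurable_component k : measurable_fun setT (component k).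
Proof. by apply: measurableT_comp => //; exact: measurable_iter_mfun. Qed.

Hypothesis P_splits : splits.

Lemma split_fst A : measurable A -> P (T1 @^-1` A) = P A.
Proof.
move=> mA; rewrite -[T1 @^-1` A]setIT -(preimage_setT T2) P_splits//.
by rewrite probability_setT mule1.
Qed.

Lemma split_snd A : measurable A -> P (T2 @^-1` A) = P A.
Proof.
move=> mA; rewrite -[T2 @^-1` A]setTI -(preimage_setT T1) P_splits//.
by rewrite probability_setT mul1e.
Qed.

Lemma component_chain n (A : nat -> set U) : (forall k, measurable (A k)) ->
  P [set w | forall k, (k < n)%N -> A k (component k w)] =
  (\prod_(k < n) P (A k))%E.
Proof.
elim: n A => [|n IH] A mA.
  rewrite big_ord0 -(probability_setT P); congr (P _).
  by apply/seteqP; split.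
rewrite big_ord_recl; under eq_bigr do rewrite lift0.
rewrite -(IH (fun k => A k.+1))//= -P_splits//.
  congr (P _); apply/seteqP; split=> w /=.
    move=> Aw; split; first exact: (Aw 0%N).
    by move=> k kn; have := Aw k.+1 kn; rewrite /component iterSr.
  by move=> [A0 Aw] [|k]// kn; have := Aw k kn; rewrite /component -iterSr.
have -> : [set w | forall k, (k < n)%N -> A k.+1 (component k w)] =
    \bigcap_(k in `I_n) (component k @^-1` (A k.+1)).
  by apply/seteqP; split=> w /= Aw k; exact: Aw.
apply: bigcap_measurableType => k _; rewrite -[X in measurable X]setTI.
exact: measurable_component.
Qed.

(** Enumerates the integers as 0, -1, 1, -2, 2 and so on. *)
Definition int_rank (i : int) : nat :=
  match i with Posz n => n.*2 | Negz n => n.*2.+1 end.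

Definition int_unrank (k : nat) : int := if odd k then Negz k./2 else Posz k./2.

Lemma int_rankK : cancel int_rank int_unrank.
Proof.
by case=> n; rewrite /int_unrank/= ?odd_double ?uphalf_double ?doubleK.
Qed.

Lemma int_unrankK : cancel int_unrank int_rank.
Proof.
move=> k; rewrite /int_unrank -[in RHS](odd_double_half k).
by case: ifP => _ /=.
Qed.

Lemma components_independent (J : {fset int}) (A : int -> set U) :
  (forall i, measurable (A i)) ->
  P [set w | forall i, i \in J -> A i (component (int_rank i) w)] =
  (\prod_(i <- J) P (A i))%E.
Proof.
move=> mA.
pose n := (\max_(i <- J) int_rank i).+1.
have Jn i : i \in J -> (int_rank i < n)%N.
  by move=> iJ; rewrite ltnS; apply: leq_bigmax_seq.
pose A' k := if int_unrank k \in J then A (int_unrank k) else setT.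
have -> : [set w | forall i, i \in J -> A i (component (int_rank i) w)] =
    [set w | forall k, (k < n)%N -> A' k (component k w)].
  apply/seteqP; split=> w /= Aw i.
    rewrite /A' => _; case: ifP => // iJ.
    by have := Aw _ iJ; rewrite int_unrankK.
  by move=> iJ; have := Aw _ (Jn i iJ); rewrite /A' int_rankK iJ.
rewrite component_chain; last by move=> k; rewrite /A'; case: ifP.
rewrite -(big_mkord xpredT (fun k => P (A' k))).
have -> : (\prod_(0 <= k < n) P (A' k) =
    \prod_(k <- iota 0 n | int_unrank k \in J) P (A (int_unrank k)))%E.
  rewrite /index_iota subn0 [RHS]big_mkcond/=; apply: eq_bigr => k _.
  by rewrite /A'; case: ifP; rewrite ?probability_setT.
rewrite -big_filter -(big_map int_unrank xpredT (fun i => P (A i))).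
apply: perm_big; apply: uniq_perm; last 1 first.
- move=> i; apply/mapP/idP => [[k]|iJ].
    by rewrite mem_filter => /andP[kJ _] ->.
  exists (int_rank i); last by rewrite int_rankK.
  by rewrite mem_filter int_rankK iJ mem_iota/= Jn.
- rewrite map_inj_uniq; last exact: can_inj int_unrankK.
  by rewrite filter_uniq// iota_uniq.
- exact: fset_uniq.
Qed.

Section iid_law.
Context (S : pointedType) (phi : U -> S) (mphi : discrete_rv phi).

Definition iid_seq (w : U) : seqs int S := fun i => phi (component (int_rank i) w).

Lemma measurable_iid_seq : measurable_fun setT iid_seq.
Proof.
apply: measurable_seqs => i s.
exact: (discrete_rv_mfun (@measurable_component (int_rank i)) mphi [set s]).
Qed.

Definition iid_law : probability (seqs int S) R :=
  distribution P (mfun_Sub (mem_set measurable_iid_seq)).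

Lemma iid_lawE A : iid_law A = P (iid_seq @^-1` A).
Proof. by []. Qed.

Lemma is_iid_law : is_iid (fun s => P [set w | phi w = s]) iid_law.
Proof.
move=> J s; rewrite iid_lawE.
apply: (@components_independent J (fun i => [set w | phi w = s i])) => i.
exact: (mphi [set s i]).
Qed.

End iid_law.

End splitting_space.

(** * A probability space isomorphic to its own square *)

Section bits.
Variable R : realType.

(** The binary digit of weight [2 ^- n.+1]. *)
Definition bit (n : nat) (x : R) : bool := odd (Num.truncn (2 ^+ n.+1 * x)).

Lemma truncn_double (y : R) : 0 <= y -> (Num.truncn (2 * y))./2 = Num.truncn y.
Proof.
move=> y0; apply/esym/truncn_def.
have /truncn_itv : 0 <= 2 * y by rewrite mulr_ge0.
set j := Num.truncn (2 * y) => /andP[jy yj].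
have := odd_double_half j; rewrite -mul2n => jE.
rewrite -{}jE natrD natrM in jy yj.
have b01 : (0 <= (odd j)%:R :> R) && ((odd j)%:R <= 1 :> R).
  by case: (odd j); rewrite ?lexx ?ler01.
have : (odd j + 2 * j./2).+1%:R = (odd j)%:R + 2 * j./2%:R + 1 :> R.
  by rewrite -addn1 natrD natrD natrM.
move=> jS; rewrite jS in yj.
have -> : j./2.+1%:R = j./2%:R + 1 :> R by rewrite -addn1 natrD.
by move/andP: b01 => [? ?]; apply/andP; split; lra.
Qed.

(** The integer with the binary digits [s 0], ..., [s n.-1], the last one being
    the lowest. *)
Fixpoint code (s : nat -> bool) (n : nat) : nat :=
  if n is k.+1 then s k + (code s k).*2 else 0.

Lemma code_lt s n : (code s n < 2 ^ n)%N.
Proof.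
elim: n => //= n IH; rewrite expnS mul2n.
by case: (s n); move: IH; lia.
Qed.

Lemma bits_code s n (x : R) : 0 <= x < 1 ->
  (forall k, (k < n)%N -> bit k x = s k) <->
  Num.truncn (2 ^+ n * x) = code s n.
Proof.
move=> /andP[x0 x1]; elim: n => [|n IH].
  split=> // _; rewrite expr0 mul1r/=.
  by apply: truncn_def; rewrite x0 x1.
have half : (Num.truncn (2 ^+ n.+1 * x))./2 = Num.truncn (2 ^+ n * x).
  by rewrite exprS -mulrA truncn_double// mulr_ge0// exprn_ge0.
have double := odd_double_half (Num.truncn (2 ^+ n.+1 * x)).
split=> [sx|/= xE].
  rewrite -double -/(bit n x) sx// half; congr (_ + _.*2)%N.
  by apply/IH => k kn; apply: sx; rewrite ltnS ltnW.
have xn : Num.truncn (2 ^+ n * x) = code s n.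
  by rewrite -half xE halfD/= doubleK; case: (s n); rewrite ?odd_double ?add0n.
move=> k; rewrite ltnS leq_eqVlt => /orP[/eqP ->|kn].
  by rewrite /bit xE oddD odd_double addbF; case: (s n).
by move/IH : xn; exact.
Qed.

Lemma uniformE (A : set (measurableTypeR R)) : measurable A ->
  uniform_prob (@ltr01 R) A = lebesgue_measure (A `&` `[0, 1[%classic).
Proof.
move=> mA.
rewrite -[X in uniform_prob _ X]setIT -(integral_indic (uniform_prob (@ltr01 R)))//.
rewrite integral_uniform//=; last first.
  exact/measurable_EFinP.
rewrite subr0 invr1 mul1e -integral_itv_bndo_bndc; last first.
  by apply/measurable_EFinP/measurable_funTS.
by rewrite integral_indic.
Qed.

Lemma measurable_truncn (c : R) (j : nat) :
  measurable [set x : measurableTypeR R | Num.truncn (c * x) = j].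
Proof.
have mle k : measurable [set x : measurableTypeR R | (Num.truncn (c * x) <= k)%N].
  have -> : [set x : measurableTypeR R | (Num.truncn (c * x) <= k)%N] =
      ( *%R c : measurableTypeR R -> R) @^-1` `]-oo, k.+1%:R[%classic.
    by apply/seteqP; split=> x /=; rewrite in_itv/= truncn_le_nat.
  by rewrite -[X in measurable X]setTI; exact: mulrl_measurable.
case: j => [|j].
  have -> : [set x : measurableTypeR R | Num.truncn (c * x) = 0%N] =
      [set x : measurableTypeR R | (Num.truncn (c * x) <= 0)%N].
    by apply/seteqP; split=> x /=; [move=> ->|rewrite leqn0 => /eqP].
  exact: mle.
have -> : [set x : measurableTypeR R | Num.truncn (c * x) = j.+1] =
    [set x : measurableTypeR R | (Num.truncn (c * x) <= j.+1)%N] `\`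
    [set x : measurableTypeR R | (Num.truncn (c * x) <= j)%N].
  apply/seteqP; split=> x /=; first by move=> ->; split=> //; rewrite ltnn.
  by move=> [a /negP]; rewrite -ltnNge => b; apply/eqP; rewrite eqn_leq a b.
exact: measurableD.
Qed.

Definition bits (x : measurableTypeR R) : seqs nat bool := bit^~ x.

Lemma measurable_bits : measurable_fun setT bits.
Proof.
apply: measurable_seqs => n b.
suff mt : discrete_rv (fun x : measurableTypeR R =>
    Num.truncn (2 ^+ n.+1 * x)) by exact: (discrete_rv_comp odd mt [set b]).
by apply: discrete_rv_countable => // j; exact: measurable_truncn.
Qed.

HB.instance Definition _ := isMeasurableFun.Build _ _ _ _ bits measurable_bits.

(** Fair coin tosses, realized as the digits of a uniform variable. *)
Definition coin : probability (seqs nat bool) R :=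
  distribution (uniform_prob (@ltr01 R)) bits.

Lemma coin_prefix n (s : nat -> bool) :
  coin [set f | forall k, (k < n)%N -> f k = s k] = (2^-1 ^+ n)%:E.
Proof.
have n0 : 0 < 2 ^+ n :> R by rewrite exprn_gt0.
have mA : measurable [set f : seqs nat bool | forall k, (k < n)%N -> f k = s k].
  have -> : [set f : seqs nat bool | forall k, (k < n)%N -> f k = s k] =
      \bigcap_(k in `I_n) [set f | f k = s k].
    by apply/seteqP; split=> f /= fs k; exact: fs.
  apply: bigcap_measurableType => k _.
  by apply: sub_sigma_algebra; exists k, (s k).
rewrite [LHS]uniformE; last exact: measurable_funPTI.
have -> : bits @^-1` [set f | forall k, (k < n)%N -> f k = s k] `&`
    `[0, 1[%classic =
    `[(code s n)%:R / 2 ^+ n, (code s n).+1%:R / 2 ^+ n[%classic.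
  apply/seteqP; split=> x /=; rewrite !in_itv/=.
    move=> [/= sx x01]; have /bits_code - /(_ s n)[/(_ sx) xE _] := x01.
    have /andP[x0 _] := x01.
    have /truncn_itv : 0 <= 2 ^+ n * x by rewrite mulr_ge0// ltW.
    by rewrite xE ler_pdivrMr// ltr_pdivlMr// mulrC.
  rewrite ler_pdivrMr// ltr_pdivlMr// [x * _]mulrC => xn.
  have x01 : 0 <= x < 1.
    case/andP: xn => x0 x1; apply/andP; split.
      by rewrite -(pmulr_rge0 _ n0) (le_trans _ x0).
    rewrite -(ltr_pM2l n0) mulr1 (lt_le_trans x1)//.
    by rewrite -natrX ler_nat code_lt.
  by split=> //; apply/(bits_code s n x01); exact: truncn_def.
rewrite lebesgue_measure_itv/= lte_fin ltr_pM2r ?invr_gt0// ltr_nat ltnS leqnn.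
by rewrite -EFinB -mulrBl -natrB// subSnn mul1r exprVn.
Qed.

(** Prefixes are dyadic intervals ([coin_prefix]). For other finite sets of
    indices, fill the missing indices one by one, averaging over the two values
    of the new bit. *)
Lemma is_iid_coin : is_iid (fun _ : bool => (2^-1)%:E) coin.
Proof.
move=> J s.
have [n Jn] : exists n, forall k, k \in J -> (k < n)%N.
  exists (\max_(k <- J) k).+1 => k kJ; rewrite ltnS.
  exact: (@leq_bigmax_seq _ _ xpredT id).
suff H m (t : nat -> bool) (K : {fset nat}) :
    (forall k, k \in K -> (k < n)%N) -> (#|` K| + m = n)%N ->
    coin [set f | forall k, k \in K -> f k = t k] = (2^-1 ^+ #|` K|)%:E.
  have JJ : (#|` J| <= n)%N.
    rewrite -[X in (_ <= X)%N](size_iota 0 n) uniq_leq_size// => k /Jn.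
    by rewrite mem_iota.
  rewrite (H (n - #|` J|)%N s)// ?subnKC// prodEFin; congr EFin.
  by rewrite big_const_seq count_predT iter_mulr_1.
pose N := [fset k in iota 0 n]%fset.
have NE k : (k \in N) = (k < n)%N by rewrite !inE mem_iota.
have Nc : #|` N| = n by rewrite card_fseq undup_id ?iota_uniq// size_iota.
elim: m t K => [|m IH] {}s K Kn; rewrite ?addn0 => Kc.
  have KN : K = N.
    apply/eqP; rewrite eqEfcard Nc Kc leqnn andbT.
    by apply/fsubsetP => k /Kn; rewrite NE.
  rewrite Kc -(coin_prefix _ s); congr (coin _).
  by apply/seteqP; split=> f /= fs k; have := fs k; rewrite KN NE.
have [k0 k0n k0K] : exists2 k, (k < n)%N & k \notin K.
  apply: contrapT => none; have : (N `<=` K)%fset.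
    apply/fsubsetP => k; rewrite NE => kn; apply: contrapT => /negP kK.
    by apply: none; exists k.
  by move/fsubset_leq_card; rewrite Nc -Kc addnS ltnNge leq_addr.
have step b : coin [set f | f k0 = b /\ forall k, k \in K -> f k = s k] =
    (2^-1 ^+ #|` K|.+1)%:E.
  have K'c : #|` k0 |` K|%fset = #|` K|.+1 by rewrite cardfsU1 k0K.
  rewrite -K'c -(IH (fun k => if k == k0 then b else s k)); last 2 first.
    by move=> k; rewrite !inE => /orP[/eqP ->//|]; exact: Kn.
    by rewrite K'c addSnnS.
  congr (coin _); apply/seteqP; split=> f /=.
    move=> [f0 fs] k; rewrite !inE; case: eqP => [->//|_ /=]; exact: fs.
  move=> fs; split=> [|k kK].
    by have := fs k0; rewrite !inE eqxx; exact.
  have := fs k; rewrite !inE kK orbT => ->//.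
  by case: eqP => // kk; rewrite -kk kK in k0K.
have mstep b : measurable
    [set f : seqs nat bool | f k0 = b /\ forall k, k \in K -> f k = s k].
  apply: measurableI; last exact: measurable_point_cylinder.
  by apply: sub_sigma_algebra; exists k0, b.
rewrite (_ : [set f | _] =
    [set f | f k0 = true /\ forall k, k \in K -> f k = s k] `|`
    [set f | f k0 = false /\ forall k, k \in K -> f k = s k]); last first.
  apply/seteqP; split=> f /=; first by case: (f k0); [left|right].
  by case=> -[].
rewrite measureU//; last by apply/seteqP; split=> f //= -[[-> _] []].
transitivity ((2^-1 ^+ #|` K|.+1)%:E + (2^-1 ^+ #|` K|.+1)%:E : \bar R)%E.
  by congr (_ + _)%E; exact: step.
rewrite -EFinD; congr EFin; rewrite exprS -mulrDl.
by rewrite (_ : 2^-1 + 2^-1 = 1 :> R) ?mul1r//; lra.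
Qed.

Definition binval_partial (n : nat) (f : seqs nat bool) : R :=
  \sum_(k < n) (f k)%:R * 2^-1 ^+ k.+1.

Definition binval (f : seqs nat bool) : R := limn (binval_partial ^~ f).

Lemma binval_partial_le1 n f : binval_partial n f <= 1 - 2^-1 ^+ n.
Proof.
elim: n => [|n IH]; first by rewrite /binval_partial big_ord0 expr0 subrr.
rewrite /binval_partial big_ord_recr/= -/(binval_partial n f).
have : (f n)%:R * 2^-1 ^+ n.+1 <= 2^-1 ^+ n.+1 :> R.
  by case: (f n); rewrite ?mul1r// mul0r exprn_ge0// invr_ge0.
have : 2^-1 ^+ n = 2^-1 ^+ n.+1 + 2^-1 ^+ n.+1 :> R.
  by rewrite exprS -mulrDl (_ : 2^-1 + 2^-1 = 1 :> R) ?mul1r//; lra.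
by move: IH; lra.
Qed.

Lemma cvg_binval f : binval_partial n f @[n --> \oo] --> binval f.
Proof.
apply: nondecreasing_is_cvgn.
  apply/nondecreasing_seqP => n.
  by rewrite /binval_partial big_ord_recr/= lerDl mulr_ge0.
exists 1 => _ [n _ <-]; apply: (le_trans (binval_partial_le1 n f)).
by rewrite gerBl exprn_ge0// invr_ge0.
Qed.

Lemma measurable_binval : measurable_fun setT binval.
Proof.
apply: (@measurable_fun_cvg _ _ _ _ (fun n f => binval_partial n f)); last first.
  by move=> f _; exact: cvg_binval.
move=> n; apply: measurable_sum => k.
have mk : discrete_rv (fun f : seqs nat bool => f k).
  by apply: discrete_rv_coord; exact: countableP.
exact: (discrete_rv_measurable (fun b : bool => b%:R * 2^-1 ^+ k.+1 : R) mk).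
Qed.

Lemma binvalK (x : R) : 0 <= x < 1 -> binval (bits x) = x.
Proof.
move=> x01; apply/esym/eqP; have /andP[x0 x1] := x01.
have xE n : binval_partial n (bits x) = (Num.truncn (2 ^+ n * x))%:R / 2 ^+ n.
  elim: n => [|n IH].
    rewrite /binval_partial big_ord0 expr0 mul1r divr1.
    by rewrite (@truncn_def _ _ 0)// x0 x1.
  rewrite /binval_partial big_ord_recr/= -/(binval_partial n _) IH.
  have half : (Num.truncn (2 ^+ n.+1 * x))./2 = Num.truncn (2 ^+ n * x).
    by rewrite exprS -mulrA truncn_double// mulr_ge0// exprn_ge0.
  rewrite -{1}(odd_double_half (Num.truncn (2 ^+ n.+1 * x))) half.
  rewrite -/(bit n x) natrD -mul2n natrM mulrDl addrC exprVn; congr (_ + _).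
  rewrite exprS invfM mulrACA divff ?mul1r//.
have xb n : x - 2^-1 ^+ n <= binval_partial n (bits x) <= x.
  have n0 : 0 < 2 ^+ n :> R by rewrite exprn_gt0.
  have /truncn_itv : 0 <= 2 ^+ n * x by rewrite mulr_ge0// ltW.
  rewrite xE ler_pdivlMr// ler_pdivrMr// mulrBl exprVn mulVf ?gt_eqF//.
  by rewrite -addn1 natrD mulrC => /andP[? ?]; apply/andP; split; lra.
have h0 : x - 2^-1 ^+ n @[n --> \oo] --> x.
  rewrite -[X in _ --> X]subr0; apply: cvgB; first exact: cvg_cst.
  by apply: cvg_expr; rewrite ger0_norm ?invr_ge0//; lra.
apply/eqP/esym/cvg_lim => //.
apply: (squeeze_cvgr _ h0 (cvg_cst x)).
by near=> n; exact: xb.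
Unshelve. all: by end_near.
Qed.

(** The binary expansion is inverted off the sequences that are not expansions,
    which do not occur. *)
Lemma coin_binval (A : set R) : measurable A ->
  coin (binval @^-1` A) =
  lebesgue_measure ((A : set (measurableTypeR R)) `&` `[0, 1[%classic).
Proof.
move=> mA; rewrite [LHS]uniformE; last first.
  apply: measurable_funPTI; rewrite -[X in measurable X]setTI.
  exact: measurable_binval.
congr (lebesgue_measure _); apply/seteqP; split=> x /=; rewrite in_itv/=.
  by move=> [Ax x01]; rewrite -[x]binvalK//; split=> //; rewrite binvalK.
by move=> [Ax x01]; rewrite /= binvalK.
Qed.

Definition even_bits (f : seqs nat bool) : seqs nat bool := fun n => f n.*2.
Definition odd_bits (f : seqs nat bool) : seqs nat bool := fun n => f n.*2.+1.

Lemma measurable_even_bits : measurable_fun setT even_bits.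
Proof.
apply: measurable_seqs => n b; apply: sub_sigma_algebra.
by exists n.*2, b.
Qed.

Lemma measurable_odd_bits : measurable_fun setT odd_bits.
Proof.
apply: measurable_seqs => n b; apply: sub_sigma_algebra.
by exists n.*2.+1, b.
Qed.

HB.instance Definition _ :=
  isMeasurableFun.Build _ _ _ _ even_bits measurable_even_bits.
HB.instance Definition _ :=
  isMeasurableFun.Build _ _ _ _ odd_bits measurable_odd_bits.

(** A cylinder in the even digits and a cylinder in the odd digits involve
    disjoint sets of digits. *)
Lemma coin_splits : splits coin even_bits odd_bits.
Proof.
have pcT : @point_cylinders nat bool setT.
  right; exists fset0, (fun=> point).
  by apply/seteqP; split=> // f _ i; rewrite inE.
apply: (@independent_pi_system _ _ _ _ _ _ _ coin coin coin even_bits odd_bits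
  (@point_cylinders nat bool) (@point_cylinders nat bool)) => //;
  try exact: point_cylinders_generate; try exact: point_cylindersI.
move=> A B [->|[J [s ->]]].
  by rewrite preimage_set0 set0I measure0 mul0e.
move=> [->|[J' [s' ->]]].
  by rewrite preimage_set0 setI0 measure0 mule0.
pose K := ([fset n.*2 | n in J] `|` [fset n.*2.+1 | n in J'])%fset.
transitivity (coin [set f | forall k, k \in K ->
    f k = if odd k then s' k./2 else s k./2]).
  congr (coin _); apply/seteqP; split=> f /=.
    move=> [fs fs'] k; rewrite inE => /orP[|] /imfsetP[n /= nJ ->].
      by rewrite odd_double doubleK; exact: fs.
    by rewrite /= odd_double/= uphalf_double; exact: fs'.
  move=> fs; split=> n nJ.
    rewrite /even_bits fs ?odd_double ?doubleK//.
    by rewrite inE; apply/orP; left; apply/imfsetP; exists n.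
  rewrite /odd_bits fs/= ?odd_double/= ?uphalf_double//.
  by rewrite inE; apply/orP; right; apply/imfsetP; exists n.
rewrite !is_iid_coin !prodEFin !big_const_seq !count_predT !iter_mulr_1.
rewrite -EFinM -exprD; congr (EFin (_ ^+ _)).
rewrite cardfsU (_ : _ `&` _ = fset0)%fset ?cardfs0 ?subn0.
  by rewrite !card_imfset//=; [move=> m n []|]; exact: double_inj.
apply/fsetP => k; rewrite !inE; apply/negbTE/negP.
by move=> /andP[/imfsetP[m /= _ ->] /imfsetP[n /= _]]; lia.
Qed.

End bits.

(** * A strong law of large numbers *)

Section expectation_of_product.
Context d (U : measurableType d) (R : realType).
Variables (P : probability U R) (T1 T2 : {mfun U >-> U}).
Hypothesis P_splits : splits P T1 T2.

Let W (w : U) : U * U := (T1 w, T2 w).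

Let mW : measurable_fun setT W.
Proof. exact: measurable_fun_pair. Qed.

HB.instance Definition _ := isMeasurableFun.Build _ _ _ _ W mW.

Lemma split_law (C : set (U * U)) : measurable C ->
  distribution P W C = (P \x P)%E C.
Proof. by move=> mC; exact: (product_law P_splits). Qed.

Lemma ge0_integral_split (f : U * U -> \bar R) : measurable_fun setT f ->
  (forall x, 0 <= f x)%E ->
  (\int[P]_w f (T1 w, T2 w) = \int[P]_x \int[P]_y f (x, y))%E.
Proof.
move=> mf f0; rewrite -[RHS]fubini_tonelli1//.
transitivity (\int[distribution P W]_z f z)%E.
  by rewrite ge0_integral_distribution.
apply: eq_measure_integral => A mA _; exact: split_law.
Qed.

Variables (f g : U -> R).
Hypothesis int_f : P.-integrable setT (EFin \o f).
Hypothesis int_g : P.-integrable setT (EFin \o g).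

Let mf : measurable_fun setT f.
Proof. by apply/measurable_EFinP; exact: measurable_int int_f. Qed.
Let mg : measurable_fun setT g.
Proof. by apply/measurable_EFinP; exact: measurable_int int_g. Qed.

Let h (z : U * U) : \bar R := (f z.1 * g z.2)%:E.

Let mh : measurable_fun setT h.
Proof.
by apply/measurable_EFinP/measurable_funM; exact: measurableT_comp.
Qed.

Let int_absh : (\int[P]_x \int[P]_y `|h (x, y)| < +oo)%E.
Proof.
have /integrableP[_ f_fin] := int_f; have /integrableP[_ g_fin] := int_g.
have mag : measurable_fun setT (fun y => `|(g y)%:E|)%E.
  exact/measurable_EFinP/measurableT_comp.
rewrite (_ : (\int[P]_x _)%E =
    (\int[P]_x (`|(f x)%:E| * \int[P]_y `|(g y)%:E|))%E); last first.
  apply: eq_integral => x _; rewrite -ge0_integralZl//.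
  by apply: eq_integral => y _; rewrite /h/= normrM EFinM.
rewrite ge0_integralZr//; last 2 first.
- exact/measurable_EFinP/measurableT_comp.
- exact: integral_ge0.
by rewrite lte_mul_pinfty// ?integral_ge0// ge0_fin_numE// integral_ge0.
Qed.

Lemma integrable_split_product :
  P.-integrable setT (fun w => (f (T1 w) * g (T2 w))%:E).
Proof.
apply/integrableP; split.
  exact: (measurableT_comp mh mW).
rewrite (ge0_integral_split (f := fun z => `|h z|)%E)//.
exact: measurableT_comp.
Qed.

(** Under [splits] the pair [(T1, T2)] has the product law, and Fubini applies. *)
Lemma integral_split_product :
  (\int[P]_w (f (T1 w) * g (T2 w))%:E =
   (\int[P]_w (f w)%:E) * (\int[P]_w (g w)%:E))%E.
Proof.
transitivity (\int[distribution P W]_z h z)%E.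
  by rewrite integral_distribution//; exact: integrable_split_product.
transitivity (\int[P \x P]_z h z)%E.
  by apply: eq_measure_integral => A mA _; exact: split_law.
have ih : (P \x P)%E.-integrable setT h by apply/integrable12ltyP.
rewrite -(integral12_prod_meas1 ih) /fubini_F.
have g_fin : (\int[P]_w (g w)%:E)%E \is a fin_num.
  exact: integrable_fin_num int_g.
rewrite -[X in (_ * X)%E](fineK g_fin) -integralZr//.
by apply: eq_integral => x _; rewrite (fineK g_fin) -integralZl.
Qed.

End expectation_of_product.

Section fourth_moment.
Context d (U : measurableType d) (R : realType).
Variables (P : probability U R) (T1 T2 : {mfun U >-> U}).
Hypothesis P_splits : splits P T1 T2.

(** The value is meaningful for integrable powers. *)
Definition moment (Y : U -> R) (i : nat) : R :=
  fine (\int[P]_w (Y w ^+ i)%:E)%E.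

Variable X : U -> R.
Hypothesis int_X : forall i, (i <= 4)%N ->
  P.-integrable setT (fun w => (X w ^+ i)%:E).
Hypothesis mean_X : (\int[P]_w (X w)%:E)%E = 0%E.

(** A sum of [n] independent copies of [X], written so that the new copy and the
    former sum are functions of the two components of [w]: the binomial formula
    then gives a recursion for the moments. *)
Fixpoint walk (n : nat) (w : U) : R :=
  if n is k.+1 then X (T1 w) + walk k (T2 w) else 0.

Let term n i (j : 'I_i.+1) (w : U) : \bar R :=
  (('C(i, j)%:R)%:E * (X (T1 w) ^+ (i - j) * walk n (T2 w) ^+ j)%:E)%E.

Let walkSE n i w : (walk n.+1 w ^+ i)%:E = (\sum_(j < i.+1) term n j w)%E.
Proof.
rewrite /= exprDn -sumEFin; apply: eq_bigr => j _.
by rewrite /term -EFinM mulr_natl.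
Qed.

Lemma integrable_walk n i : (i <= 4)%N ->
  P.-integrable setT (fun w => (walk n w ^+ i)%:E).
Proof.
elim: n i => [|n IH] i i4.
  exact: (@finite_measure_integrable_cst _ _ _ P setT (0 ^+ i)).
rewrite (_ : (fun w => _) = fun w => (\sum_(j < i.+1) term n j w)%E); last first.
  by apply/funext => w; exact: walkSE.
apply: integrable_sum => // j _; apply: integrableZl => //.
apply: (integrable_split_product P_splits (f := fun w => X w ^+ (i - j))
  (g := fun w => walk n w ^+ j)).
  by apply: int_X; rewrite (leq_trans _ i4)// leq_subr.
by apply: IH; rewrite (leq_trans _ i4)// -ltnS.
Qed.

Lemma moment_walkS n i : (i <= 4)%N -> moment (walk n.+1) i =
  \sum_(j < i.+1) 'C(i, j)%:R * (moment X (i - j) * moment (walk n) j).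
Proof.
move=> i4; rewrite /moment.
rewrite (_ : (\int[P]_w _)%E = (\int[P]_w (\sum_(j < i.+1) term n j w))%E);
  last by apply: eq_integral => w _; exact: walkSE.
have Xij (j : 'I_i.+1) : P.-integrable setT (fun w => (X w ^+ (i - j))%:E).
  by apply: int_X; rewrite (leq_trans _ i4)// leq_subr.
have Sj (j : 'I_i.+1) : P.-integrable setT (fun w => (walk n w ^+ j)%:E).
  by apply: integrable_walk; rewrite (leq_trans _ i4)// -ltnS.
have prod_int (j : 'I_i.+1) := integrable_split_product P_splits (Xij j) (Sj j).
rewrite integral_sum//; last by move=> j; apply: integrableZl.
rewrite -[RHS]/(fine (_%:E)) -sumEFin; congr fine; apply: eq_bigr => j _.
rewrite /term integralZl// (integral_split_product P_splits (Xij j) (Sj j)).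
by rewrite !EFinM !fineK//; exact: integrable_fin_num.
Qed.

Let moment0 Y : moment Y 0 = 1.
Proof.
rewrite /moment (_ : (\int[P]_w _)%E = (\int[P]_w (cst 1 w))%E) //.
by rewrite integral_cst//= probability_setT mule1.
Qed.

Let moment_X1 : moment X 1 = 0.
Proof. by rewrite /moment (_ : (\int[P]_w _)%E = 0%E). Qed.

Lemma moment_walk1 n : moment (walk n) 1 = 0.
Proof.
elim: n => [|n IH].
  rewrite /moment (_ : (\int[P]_w _)%E = (\int[P]_w (cst 0 w))%E) //.
  by rewrite integral_cst// mul0e.
rewrite moment_walkS// !big_ord_recr big_ord0/= IH moment_X1.
by rewrite mul0r !mulr0 !addr0.
Qed.

Lemma moment_walk2 n : moment (walk n) 2 = n%:R * moment X 2.
Proof.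
elim: n => [|n IH].
  rewrite /moment (_ : (\int[P]_w _)%E = (\int[P]_w (cst 0 w))%E).
    by rewrite integral_cst// mul0e mul0r.
  by apply: eq_integral => w _; rewrite /= expr0n.
rewrite moment_walkS// !big_ord_recr big_ord0/= IH moment_walk1 moment0.
by rewrite moment0 bin0 binn -addn1 natrD; ring.
Qed.

(** In the recursion the terms that contain the mean of [X] vanish; what is left
    grows by a multiple of [n]. *)
Lemma moment_walk4 n :
  moment (walk n) 4 <= (3 * moment X 2 ^+ 2 + moment X 4) * n%:R ^+ 2.
Proof.
have X4 : 0 <= moment X 4.
  rewrite fine_ge0// integral_ge0// => w _.
  by rewrite lee_fin (exprM _ 2 2) sqr_ge0.
elim: n => [|n IH].
  rewrite /moment (_ : (\int[P]_w _)%E = (\int[P]_w (cst 0 w))%E).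
    by rewrite integral_cst// mul0e expr0n/= mulr0.
  by apply: eq_integral => w _; rewrite /= expr0n.
rewrite moment_walkS// !big_ord_recr big_ord0/= moment_walk1 moment_walk2.
rewrite moment_X1 moment0 moment0 bin0 binn.
have -> : 'C(4, 2)%:R = 6 :> R by [].
rewrite -[n.+1%:R]natr1.
move: IH; set s4 := moment (walk n) 4; set x4 := moment X 4; set x2 := moment X 2.
move=> IH.
have n0 : 0 <= n%:R :> R by [].
have nx4 : 0 <= n%:R * x4 by rewrite mulr_ge0.
have x22 : 0 <= x2 ^+ 2 by exact: sqr_ge0.
have -> : (3 * x2 ^+ 2 + x4) * (n%:R + 1) ^+ 2 =
  (3 * x2 ^+ 2 + x4) * n%:R ^+ 2 + 6 * (x2 * (n%:R * x2)) + 3 * x2 ^+ 2 +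
  2 * (n%:R * x4) + x4 by ring.
by lra.
Qed.

Lemma sum_inv_sqr_le2 N : \sum_(0 <= n < N) n.+1%:R^-1 ^+ 2 <= 2 :> R.
Proof.
case: N => [|N]; first by rewrite big_geq.
suff : \sum_(0 <= n < N.+1) n.+1%:R^-1 ^+ 2 <= 2 - N.+1%:R^-1 :> R.
  by move/le_trans; apply; rewrite gerBl invr_ge0.
elim: N => [|N IH]; first by rewrite big_nat1 invr1 expr1n; lra.
rewrite big_nat_recr//=; apply: (le_trans (lerD IH (lexx _))).
rewrite -[N.+2%:R]natr1; set a := N.+1%:R.
have a0 : 0 < a :> R by rewrite ltr0n.
have a10 : 0 < a + 1 by rewrite addr_gt0.
rewrite -subr_ge0 (_ : _ - _ = (a * (a + 1) ^+ 2)^-1).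
  by rewrite invr_ge0 mulr_ge0 ?exprn_ge0// ltW.
by field; rewrite !gt_eqF.
Qed.

Lemma measurable_walk n : measurable_fun setT (walk n).
Proof.
have := measurable_int _ (integrable_walk n (isT : 1 <= 4)%N).
by move/measurable_EFinP.
Qed.

(** The fourth moments of the averages are at most of order [n ^- 2], hence
    summable: the series of the fourth powers of the averages is almost surely
    finite. *)
Theorem strong_law :
  {ae P, forall w, walk n w / n%:R @[n --> \oo] --> 0}.
Proof.
pose C := 3 * moment X 2 ^+ 2 + moment X 4.
have C0 : 0 <= C.
  have := moment_walk4 1; rewrite expr1n mulr1; apply: le_trans.
  rewrite fine_ge0// integral_ge0// => w _.
  by rewrite lee_fin (exprM _ 2 2) sqr_ge0.
pose f n w := ((walk n.+1 w / n.+1%:R) ^+ 4)%:E.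
have f0 n w : (0 <= f n w)%E by rewrite lee_fin (exprM _ 2 2) sqr_ge0.
have mf n : measurable_fun setT (f n).
  by apply/measurable_EFinP/measurable_funX/measurable_funM => //;
    exact: measurable_walk.
have intf n : (\int[P]_w f n w <= (C * n.+1%:R^-1 ^+ 2)%:E)%E.
  have -> : (\int[P]_w f n w =
      ((n.+1%:R^-1 ^+ 4)%:E * \int[P]_w (walk n.+1 w ^+ 4)%:E))%E.
    rewrite -integralZl//; last exact: integrable_walk.
    by apply: eq_integral => w _; rewrite /f exprMn mulrC EFinM.
  rewrite -[X in (_ * X)%E]fineK; last first.
    by apply: integrable_fin_num => //; exact: integrable_walk.
  rewrite -EFinM lee_fin -/(moment (walk n.+1) 4).
  have n0 : n.+1%:R != 0 :> R by rewrite pnatr_eq0.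
  have -> : C * n.+1%:R^-1 ^+ 2 = n.+1%:R^-1 ^+ 4 * (C * n.+1%:R ^+ 2) by field.
  by rewrite ler_wpM2l ?exprn_ge0 ?invr_ge0//; exact: moment_walk4.
have F_fin : P.-integrable setT (fun w => \sum_(n <oo) f n w)%E.
  apply/integrableP; split.
    exact: ge0_emeasurable_sum.
  under eq_integral do rewrite gee0_abs ?nneseries_ge0//.
  rewrite integral_nneseries//.
  apply: (@le_lt_trans _ _ (C * 2)%:E); last exact: ltry.
  apply: lime_le.
    by apply: is_cvg_nneseries => n _ _; exact: integral_ge0.
  apply: nearW => N.
  apply: (@le_trans _ _ (\sum_(0 <= n < N) (C * n.+1%:R^-1 ^+ 2)%:E)%E).
    by apply: lee_sum => n _; exact: intf.
  by rewrite sumEFin lee_fin -mulr_sumr ler_wpM2l// sum_inv_sqr_le2.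
have := integrable_ae measurableT F_fin.
apply: filterS => w /(_ I) Fw.
have f_cvg : (walk n.+1 w / n.+1%:R) ^+ 4 @[n --> \oo] --> (0 : R).
  apply: cvg_series_cvg_0; apply: nondecreasing_is_cvgn.
    apply/nondecreasing_seqP => n; rewrite /series/= big_nat_recr//= lerDl.
    by have := f0 n w; rewrite lee_fin.
  exists (fine (\sum_(n <oo) f n w)%E) => _ [n _ <-].
  rewrite -lee_fin fineK// /series/= -sumEFin.
  by apply: nneseries_lim_ge => k _ _; exact: f0.
rewrite -(cvg_shiftS (fun n => walk n w / n%:R)).
apply/cvgrPdist_lt => e e0.
have e4 : 0 < e ^+ 4 by rewrite exprn_gt0.
move/cvgrPdist_lt : f_cvg => /(_ _ e4); apply: filterS => n.
rewrite !sub0r !normrN normrX ltr_pXn2r// nnegrE//; exact: ltW.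
Qed.

End fourth_moment.

(** * Translations and fundamental domains *)

Section translation.
Variable R : realType.
Local Notation mu := (@lebesgue_measure R).

Let shiftr (c : R) (x : measurableTypeR R) : measurableTypeR R := x + c.

Let measurable_shiftr c : measurable_fun setT (shiftr c).
Proof.
have : measurable_fun setT (fun x : measurableTypeR R => x + c : R).
  by apply: measurable_funD => //; exact: measurable_id.
by [].
Qed.

Lemma lebesgue_measure_translation (c : R) (A : set (measurableTypeR R)) :
  measurable A -> mu ((fun x => x + c) @^-1` A) = mu A.
Proof.
move=> mA; apply/esym.
have := @lebesgue_measure_unique R (pushforward mu (shiftr c)); apply => //.
move=> _ [[a b] _ <-]; rewrite /= /pushforward.
have -> : shiftr c @^-1` `]a, b]%classic = `]a - c, b - c]%classic.
  by apply/seteqP; split=> x /=; rewrite !in_itv/= ltrBlDr lerBrDr.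
rewrite !lebesgue_measure_itv/= !lte_fin ltrD2r; case: ifP => // _.
by rewrite -!EFinB; congr EFin; lra.
Qed.

End translation.

Section skew_product.
Context d d' (Y : measurableType d) (Y' : measurableType d') (R : realType).
Variables (m : probability Y R) (m' : probability Y' R).
Variables (tau : Y -> Y') (c : Y -> R).
Hypothesis mtau : measurable_fun setT tau.
Hypothesis mc : measurable_fun setT c.
Hypothesis tau_law : forall A, measurable A -> m (tau @^-1` A) = m' A.
Local Notation leb := (@lebesgue_measure R).

(** A map of the base together with a translation of the line that depends on the
    base point. *)
Definition skew_map (yx : Y * measurableTypeR R) : Y' * measurableTypeR R :=
  (tau yx.1, yx.2 + c yx.1).

Lemma measurable_skew : measurable_fun setT skew_map.
Proof.
apply: measurable_fun_pair; first exact: measurableT_comp.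
have : measurable_fun setT
    (fun yx : Y * measurableTypeR R => (yx.2 : R) + c yx.1).
  apply: measurable_funD; last exact: measurableT_comp.
  exact: (@measurable_snd _ _ Y (measurableTypeR R)).
by [].
Qed.

(** On every fibre Lebesgue measure is invariant by translation, so that only the
    law on the base matters. *)
Lemma skew_preserves A : measurable A ->
  (m \x leb)%E (skew_map @^-1` A) = (m' \x leb)%E A.
Proof.
move=> mA.
have mH : measurable_fun setT (fun y => leb (xsection A y)).
  exact: measurable_fun_xsection.
rewrite /product_measure1 /=.
transitivity (\int[m]_y leb (xsection A (tau y)))%E.
  apply: eq_integral => y _ /=.
  rewrite -(@lebesgue_measure_translation R (c y) (xsection A (tau y)));
    last exact: measurable_xsection.
  congr (leb _); apply/seteqP; split=> x /=; rewrite /xsection/= !inE//.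
transitivity (\int[pushforward m tau]_y leb (xsection A y))%E.
  by rewrite ge0_integral_pushforward.
by apply: eq_measure_integral => B mB _; exact: tau_law.
Qed.

End skew_product.

Section fundamental_domains.
Context d (X : measurableType d) (R : realType) (M : {measure set X -> \bar R}).
Implicit Type tau : int -> X -> X.

(** For an action [tau] of the integers, the orbit of [x] has exactly one point in
    [G]. *)
Definition meets_once tau (G : set X) (x : X) : Prop :=
  exists k, forall j, G (tau j x) <-> j = k.

(** The inverse translates of [G] partition the space, up to the null set [N]. *)
Lemma meets_once_partition tau (N G C : set X) :
  (forall k, measurable_fun setT (tau k)) ->
  measurable N -> measurable G ->
  measurable C -> M N = 0%E -> (forall x, ~ N x -> meets_once tau G x) ->
  M C = (\sum_(k <oo) M (C `&` tau (int_unrank k) @^-1` G))%E.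
Proof.
move=> mtau mN mG mC N0 once.
have mtG k : measurable (tau k @^-1` G).
  by rewrite -[X in measurable X]setTI; exact: mtau.
have dropN (D : set X) : measurable D -> M D = M (D `\` N).
  move=> mD; rewrite (measureDI M mD mN).
  rewrite [X in (_ + X)%E](_ : _ = 0%E) ?adde0//.
  apply/eqP; rewrite eq_le measure_ge0 andbT -N0.
  by apply: le_measure; rewrite ?inE//; exact: measurableI.
pose D k := (C `&` tau (int_unrank k) @^-1` G) `\` N.
have mD k : measurable (D k).
  by apply: measurableD => //; exact: measurableI.
rewrite dropN// (_ : C `\` N = \bigcup_k D k); last first.
  apply/seteqP; split=> x /=; last by move=> [k _ [[? _] ?]].
  move=> [Cx Nx]; have [k /(_ k)[_ /(_ erefl) Gx]] := once _ Nx.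
  by exists (int_rank k) => //; rewrite /D/= int_rankK.
rewrite measure_semi_bigcup//; last 2 first.
- apply/trivIsetP => j k _ _ jk; apply/seteqP; split=> // x [].
  move=> [[_ Gj] Nx] [[_ Gk] _]; have [i Gi] := once _ Nx.
  move/eqP : jk; apply; apply: (can_inj int_unrankK).
  by rewrite ((Gi _).1 Gj) ((Gi _).1 Gk).
- exact: bigcup_measurable.
apply: eq_eseriesr => k _; rewrite /D -dropN//; exact: measurableI.
Qed.

(** Cut [G1] according to the unique [k] for which [tau k x] lies in [G2]. The map
    [tau k] carries the pieces to a partition of [G2] and preserves [M]. *)
Lemma fundamental_domain_exchange tau (N G1 G2 B : set X) :
  (forall k, measurable_fun setT (tau k)) ->
  (forall k x, tau k (tau (- k) x) = x) ->
  (forall k A, measurable A -> M (tau k @^-1` A) = M A) ->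
  measurable N -> measurable G1 -> measurable G2 -> measurable B ->
  M N = 0%E -> (forall x, ~ N x -> meets_once tau G1 x /\ meets_once tau G2 x) ->
  (forall k, tau k @^-1` B = B) ->
  M (G1 `&` B) = M (G2 `&` B).
Proof.
move=> mtau tauN tau_preserves mN mG1 mG2 mB N0 once invB.
have mtG k G : measurable G -> measurable (tau k @^-1` G).
  by move=> mG; rewrite -[X in measurable X]setTI; exact: mtau.
rewrite (@meets_once_partition tau N G2)//; last 2 first.
- exact: measurableI.
- by move=> x /once[].
transitivity
    (\sum_(k <oo) M ((G2 `&` B) `&` tau (- int_unrank k)%R @^-1` G1))%E.
  apply: eq_eseriesr => k _.
  rewrite -(@tau_preserves (- int_unrank k) (_ `&` _)); last first.
    by apply: measurableI; [exact: measurableI|exact: mtG].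
  congr (M _); rewrite !preimage_setI invB.
  have -> : tau (- int_unrank k) @^-1` (tau (int_unrank k) @^-1` G2) = G2.
    by apply/seteqP; split=> x /=; rewrite tauN.
  by apply/seteqP; split=> x /= [[? ?] ?].
apply/esym.
apply: (@meets_once_partition (fun k => tau (- k)) N G1) => //.
- exact: measurableI.
- move=> x /once[[k Gk] _]; exists (- k) => j.
  by rewrite Gk; split=> [<-|->]; rewrite opprK.
Qed.

End fundamental_domains.

(** * Configurations as a topological and measurable space *)

Lemma measurable_real d (T : measurableType d) (R : realType) (f : T -> R) :
  (forall a, measurable [set w | a < f w]) -> measurable_fun setT f.
Proof.
move=> mf; apply: (@measurability _ _ _ R setT f (@RGenOInfty.G R)).
  exact: RGenOInfty.measurableE.
move=> _ [_ [a ->] <-]; rewrite setTI (_ : _ @^-1` _ = [set w | a < f w])//.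
by apply/seteqP; split=> w /=; rewrite in_itv/= andbT.
Qed.

Section config_space.
Context {R : realType} (r : {nonneg R}).
Implicit Types x y : config r.

(** Rational end points make these sets countable in number; they form a base of
    the topology, so that open sets are events. *)
Definition box (s : seq (int * (rat * rat))) : set (config r) :=
  [set y | forall c, c \in s -> ratr c.2.1 < y c.1 < ratr c.2.2].

Definition box_nbhs x : set_system (config r) :=
  [set A | exists2 s, box s x & box s `<=` A].

#[global] Instance box_nbhs_filter x : Filter (box_nbhs x).
Proof.
split.
- by exists [::] => // c; rewrite in_nil.
- move=> A B [s sx sA] [t tx tB]; exists (s ++ t).
    by move=> c; rewrite mem_cat => /orP[/sx|/tx].
  move=> y sty; split; [apply: sA|apply: tB] => c cs; apply: sty;
    by rewrite mem_cat cs ?orbT.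
- by move=> A B AB [s sx sA]; exists s => //; exact: subset_trans AB.
Qed.

Lemma open_box_nbhs (A : set (config r)) x : open A -> A x -> box_nbhs x A.
Proof.
move=> [D' D'fin <-] [B D'B Bx].
have [E Ecyl BE] := D'fin _ D'B; rewrite -BE in Bx *.
suff : box_nbhs x (\bigcap_(i in [set` E]) i).
  by apply: filterS => y Ey; exists B => //; rewrite -BE.
apply: filter_bigI => C CE; have /set_mem[I [J [oJ CJ]]] := Ecyl _ CE.
have : C x by exact: Bx.
rewrite /= CJ => Jx.
have -> : [set y : config r | forall i, i \in I -> J i (y i)] =
    \bigcap_(i in [set` I]) [set y : config r | J i (y i)].
  by apply/seteqP; split=> y /= Jy i; exact: Jy.
apply: filter_bigI => i iI; have [oi _] := oJ i.
move: oi; rewrite openE => /(_ _ (Jx i iI)) /nbhs_ballP[e /= e0 eJ].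
have [a /[!in_itv]/= /andP[ea ax]] := @rat_in_itvoo R (x i - e) (x i) ltac:(lra).
have [b /[!in_itv]/= /andP[xb be]] := @rat_in_itvoo R (x i) (x i + e) ltac:(lra).
exists [:: (i, (a, b))].
  by move=> c; rewrite inE => /eqP ->/=; rewrite ax xb.
move=> y /(_ (i, (a, b))); rewrite inE eqxx => /(_ isT)/= /andP[ay yb].
apply: eJ; rewrite /ball/= ltr_distl; apply/andP; split; lra.
Qed.

(** A neighbourhood restricts finitely many coordinates. *)
Lemma cvg_config (u : nat -> config r) x :
  (forall i, u n i @[n --> \oo] --> x i) -> u n @[n --> \oo] --> x.
Proof.
move=> ux A; rewrite nbhsE => -[B [oB Bx] BA].
have [s sx sB] := open_box_nbhs oB Bx.
suff : \forall n \near \oo, forall c, c \in s -> ratr c.2.1 < u n c.1 < ratr c.2.2.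
  by apply: filterS => n un; apply: BA; apply: sB => c /un.
elim: s sx {sB} => [|c s IH] sx; first by near=> n.
have {}IH : \forall n \near \oo, forall c, c \in s ->
    ratr c.2.1 < u n c.1 < ratr c.2.2.
  by apply: IH => c' c's; apply: sx; rewrite inE c's orbT.
have /andP[cx xc] := sx c (mem_head _ _).
near=> n => c'; rewrite inE => /orP[/eqP ->|]; last by move: c'; near: n.
apply/andP; split; near: n.
- exact: (cvgr_gt _ (ux c.1)).
- exact: (cvgr_lt _ (ux c.1)).
Unshelve. all: by end_near.
Qed.

Lemma measurable_center i : measurable_fun setT (fun x : config r => x i : R).
Proof.
apply: measurable_real => a; apply: sub_sigma_algebra.
exists [fset i]%fset, (fun=> `]a, +oo[%classic); split.
  by move=> _; split; [exact: interval_open|exact: interval_is_interval].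
apply/seteqP; split=> x /=.
  by move=> ax j; rewrite inE => /eqP ->; rewrite in_itv/= andbT.
by move=> /(_ i); rewrite inE eqxx in_itv/= andbT; exact.
Qed.

Lemma measurable_into_config d (T : measurableType d) (X : T -> config r) :
  (forall i, measurable_fun setT (fun w => X w i : R)) -> measurable_fun setT X.
Proof.
move=> mX; apply: (@measurability _ _ _ _ _ _ (@cylinders R r)) => //.
move=> _ [_ [I [C [oC ->]]] <-]; rewrite setTI.
have -> : X @^-1` [set x | forall i, i \in I -> C i (x i)] =
    \bigcap_i (if i \in I then [set w | C i (X w i)] else setT).
  apply/seteqP; split=> w /= Cw i => [_|iI].
    by case: ifP => // /Cw.
  by have := Cw i Logic.I; rewrite iI.
rewrite -[X in measurable X]setCK setC_bigcap; apply: measurableC.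
apply: countable_bigcupT_measurable; first exact: countableP.
move=> i; apply: measurableC; case: ifP => // _.
rewrite -[X in measurable X]setTI; apply: (mX i) => //.
by apply: open_measurable; case: (oC i).
Qed.

Lemma measurable_box s : measurable (box s).
Proof.
have -> : box s = \bigcap_c (if c \in s then
    [set y : config r | ratr c.2.1 < y c.1 < ratr c.2.2] else setT).
  apply/seteqP; split=> y /= sy c => [_|cs].
    by case: ifP => // /sy.
  by have := sy c Logic.I; rewrite cs.
rewrite -[X in measurable X]setCK setC_bigcap; apply: measurableC.
apply: countable_bigcupT_measurable; first exact: countableP.
move=> c; apply: measurableC; case: ifP => // _.
have -> : [set y : config r | ratr c.2.1 < y c.1 < ratr c.2.2] =
    (fun y : config r => y c.1) @^-1` `]ratr c.2.1, ratr c.2.2[%classic.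
  by apply/seteqP; split=> y /=; rewrite in_itv.
by rewrite -[X in measurable X]setTI; exact: measurable_center.
Qed.

Lemma open_measurable_config (A : set (config r)) : open A -> measurable A.
Proof.
move=> oA.
have -> : A = \bigcup_s (if `[< box s `<=` A >] then box s else set0).
  apply/seteqP; split=> [x Ax|x [s _]].
    have [s sx sA] := open_box_nbhs oA Ax.
    by exists s => //; rewrite asboolT.
  by case: ifPn => // /asboolP sA /sA.
apply: countable_bigcupT_measurable; first exact: countableP.
by move=> s; case: ifP => // _; exact: measurable_box.
Qed.

Lemma measurable_pi :
  measurable_fun setT (\pi_(uconfig r) : config r -> uconfig r).
Proof. by move=> _ A; rewrite /measurable/=/quotient_measurable. Qed.

Lemma measurable_preimage_pi (A : set (uconfig r)) :
  measurable (\pi_(uconfig r) @^-1` A : set (config r)) <-> measurable A.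
Proof.
by rewrite [measurable A]/measurable/=/quotient_measurable/image_set_system/=
  setTI.
Qed.

(** The quotient map pulls an open set back to an open set of configurations. *)
Lemma continuous_measurable_uconfig (f : uconfig r -> R) :
  continuous f -> measurable_fun setT f.
Proof.
move=> /continuousP cf.
apply: measurable_real => a.
apply/measurable_preimage_pi; apply: open_measurable_config.
have /continuousP pi_cont :=
  @pi_continuous (config r) {eq_quot (relabel_equiv r)}.
exact: (pi_cont _ (cf [set x | a < x] (@open_gt _ a))).
Qed.

(** * Relabelling *)

Definition relabelled (k : int) x : config r.
Proof.
refine (@Config _ _ (fun i => x (i + k)) _).
by move=> i; have := centerP x (i + k); rewrite addrAC.
Defined.

Lemma measurable_relabelled k : measurable_fun setT (relabelled k).
Proof. by apply: measurable_into_config => i; exact: measurable_center. Qed.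

Lemma pi_eqP x y :
  \pi_(uconfig r) x = \pi_(uconfig r) y <-> exists k, y = relabelled k x.
Proof.
split=> [/eqmodP /= /asboolP[k yx]|[k ->]].
  by exists k; apply: config_inj; apply/funext.
by apply/eqmodP => /=; apply/asboolP; exists k.
Qed.

Lemma pi_relabelled k x :
  \pi_(uconfig r) (relabelled k x) = \pi_(uconfig r) x.
Proof. by apply/esym/pi_eqP; exists k. Qed.

End config_space.

(** * Transition kernels *)

Section random_map_kernel.
Context d1 d2 d3 (X : measurableType d1) (T : measurableType d2)
  (Y : measurableType d3) (R : realType) (m : probability T R).
Variable phi : X * T -> Y.
Hypothesis mphi : measurable_fun setT phi.

(** The law of the image of [x] under a random map. *)
Definition random_map (x : X) : {measure set Y -> \bar R} :=
  distribution m (mfun_Sub (mem_set (measurable_fun_pair2 x mphi))).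

Let random_map_measurable U : measurable U ->
  measurable_fun [set: X] (random_map ^~ U).
Proof.
move=> mU.
have mphiU : measurable (phi @^-1` U).
  by rewrite -[X in measurable X]setTI; exact: mphi.
have := measurable_fun_xsection m mphiU.
rewrite (_ : m \o xsection _ = random_map ^~ U)//.
apply/funext => x /=; rewrite /random_map /distribution /pushforward/=.
by congr (m _); apply/seteqP; split=> t; rewrite /xsection/= inE.
Qed.

HB.instance Definition _ := isKernel.Build _ _ _ _ _ random_map
  random_map_measurable.

Let random_map_prob x : random_map x [set: Y] = 1%E.
Proof. exact: probability_setT. Qed.

HB.instance Definition _ := Kernel_isProbability.Build _ _ _ _ _
  random_map random_map_prob.

End random_map_kernel.

Section quotient_kernel.
Context {R : realType} (r : {nonneg R}) (K : R.-pker config r ~> config r).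
Hypothesis K_relabelled : forall k x (B : set (uconfig r)), measurable B ->
  K (relabelled k x) (\pi_(uconfig r) @^-1` B) = K x (\pi_(uconfig r) @^-1` B).

(** The choice of a representative is harmless by [K_relabelled]. *)
Definition descended (q : uconfig r) : {measure set (uconfig r) -> \bar R}.
Proof.
refine [the {measure set _ -> \bar R} of
  pushforward (K (repr q)) (\pi_(uconfig r) : config r -> uconfig r)].
exact: measurable_pi.
Defined.

Let descendedE x B : measurable B ->
  descended (\pi_(uconfig r) x) B = K x (\pi_(uconfig r) @^-1` B).
Proof.
move=> mB; rewrite /descended/= /pushforward/=.
have [k ->] : exists k, repr (\pi_(uconfig r) x) = relabelled k x.
  by apply/pi_eqP; rewrite reprK.
exact: K_relabelled.
Qed.

Let descended_measurable U : measurable U ->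
  measurable_fun [set: uconfig r] (descended ^~ U).
Proof.
move=> mU _ Y mY; rewrite setTI; apply/measurable_preimage_pi.
have mKU := measurable_kernel K _ ((measurable_preimage_pi U).2 mU).
rewrite -[X in measurable X]setTI.
rewrite (_ : _ @^-1` _ = (K ^~ (\pi_(uconfig r) @^-1` U)) @^-1` Y).
  by apply: mKU => //; apply/measurable_preimage_pi.
by apply/seteqP; split=> x /=; rewrite descendedE.
Qed.

HB.instance Definition _ := isKernel.Build _ _ _ _ _ descended
  descended_measurable.

Let descended_prob q : descended q setT = 1%E.
Proof. by rewrite /descended/= /pushforward/= preimage_setT prob_kernel. Qed.

HB.instance Definition _ := Kernel_isProbability.Build _ _ _ _ _
  descended descended_prob.

Lemma exists_quotient_kernel :
  exists Q : R.-pker uconfig r ~> uconfig r, quotient_kernel K Q.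
Proof. by exists descended => x B mB; exact: descendedE. Qed.

End quotient_kernel.

Section process_kernel.
Context {R : realType} (v : {posnum R}) (r : {nonneg R}).
Implicit Type w : seqs int bool.

Definition jumpers w : set int := [set i | w i].

Definition random_step (xw : config r * seqs int bool) : config r :=
  step v xw.1 (jumpers xw.2).

Lemma measurable_random_step : measurable_fun setT random_step.
Proof.
have mc i : measurable_fun setT (fun xw : config r * seqs int bool => xw.1 i : R).
  exact: (measurableT_comp (@measurable_center R r i)).
apply: measurable_into_config => i; rewrite /random_step/= /step_fun.
rewrite (_ : (fun _ => _) = fun xw : config r * seqs int bool =>
    if xw.2 i then Num.min (xw.1 i + v%:num) (xw.1 (i + 1) - 2 * r%:num)
    else xw.1 i); last first.
  apply/funext => xw; rewrite /jumpers.
  by rewrite (_ : (i \in _) = xw.2 i)//; apply/idP/idP => /[!inE].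
apply: measurable_fun_ifT => //.
  have := @measurable_snd _ _ (config r) (seqs int bool).
  move/(discrete_rv_mfun) => /(_ bool (fun w => w i)) mw.
  by apply: (discrete_rv_measurable id); apply: mw;
    apply: discrete_rv_coord; exact: countableP.
by apply: measurable_minr; [apply: measurable_funD|apply: measurable_funB].
Qed.

Variable m : probability (seqs int bool) R.

Definition step_kernel := random_map m measurable_random_step.

Lemma step_kernelE x B : step_kernel x B = m [set w | B (step v x (jumpers w))].
Proof. by []. Qed.

Variable p : R.
Definition bernoulli_mass (b : bool) : \bar R := (if b then p else 1 - p)%:E.
Hypothesis m_iid : is_iid bernoulli_mass m.

Lemma step_kernel_transition : transition_kernel v p step_kernel.
Proof.
have mJ i : measurable [set w : seqs int bool | w i].
  by apply: (discrete_rv_coord i) [set true]; exact: countableP.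
have mJE i : m [set w : seqs int bool | w i] = p%:E.
  have := m_iid [fset i]%fset (fun=> true).
  rewrite big_seq_fset1 /bernoulli_mass => <-; congr (m _).
  apply/seteqP; split=> w /= => [wi j|->//]; rewrite inE => // /eqP ->.
  exact: wi.
exists _, (seqs int bool), m, (fun i => [set w : seqs int bool | w i]); split=> //.
move=> I; rewrite (_ : \bigcap_(i in _) _ =
    [set w | forall i, i \in I -> w i = true]).
  rewrite m_iid /bernoulli_mass prodEFin/=; apply: eq_bigr => i _.
  by rewrite mJE.
by apply/seteqP; split=> w /= wi i /wi.
Qed.

Lemma step_relabelled k (x : config r) w :
  step v (relabelled k x) (jumpers (shift_seq k w)) =
  relabelled k (step v x (jumpers w)).
Proof.
apply: config_inj; apply/funext => i /=; rewrite /step_fun/=.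
by rewrite addrAC (_ : (i \in jumpers (shift_seq k w)) = (i + k \in jumpers w)).
Qed.

(** Relabel the decisions of the balls too; this preserves their law. *)
Lemma step_kernel_relabelled k x (B : set (uconfig r)) : measurable B ->
  step_kernel (relabelled k x) (\pi_(uconfig r) @^-1` B) =
  step_kernel x (\pi_(uconfig r) @^-1` B).
Proof.
move=> mB; rewrite !step_kernelE.
set A := [set w | _].
have mA : measurable A.
  have := measurable_fun_pair2 (relabelled k x) measurable_random_step.
  move=> /(_ measurableT (\pi_(uconfig r) @^-1` B)); rewrite setTI; apply.
  exact/measurable_preimage_pi.
rewrite -(is_iid_shift k m_iid mA); congr (m _).
by apply/seteqP; split=> w; rewrite /A/= step_relabelled pi_relabelled.
Qed.

End process_kernel.

(** * Configurations with prescribed spacings *)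

Lemma int_step_ind (Q : int -> Prop) : Q 0 ->
  (forall i : int, Q i -> Q (i + 1)) -> (forall i : int, Q (i + 1) -> Q i) ->
  forall i : int, Q i.
Proof.
move=> Q0 Qup Qdown; case; elim=> [|n IH].
- by [].
- by rewrite -addn1 PoszD; exact: Qup.
- by apply: Qdown; rewrite NegzE addNr.
- by apply: Qdown; rewrite (_ : Negz n.+1 + 1 = Negz n)//; lia.
Qed.

Section positions.
Variable R : realType.
Implicit Type l : int -> R.

(** The sum of [l] from 0 to [i], with the usual convention for negative [i]: the
    position of point [i] if point 0 is at the origin and [l j] is the distance
    from point [j] to point [j + 1]. *)
Definition pos l (i : int) : R :=
  match i with
  | Posz n => \sum_(0 <= j < n) l (Posz j)
  | Negz n => - \sum_(0 <= j < n.+1) l (Negz j)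
  end.

Lemma pos0 l : pos l 0 = 0.
Proof. by rewrite -[0 in LHS]/(Posz 0) /pos big_geq. Qed.

Lemma posS l (i : int) : pos l (i + 1) = pos l i + l i.
Proof.
case: i => [n|[|n]].
- by rewrite -PoszD addn1 /pos big_nat_recr.
- rewrite (_ : Negz 0 + 1 = 0)// pos0 /pos big_nat1.
  by rewrite addNr.
- rewrite (_ : Negz n.+1 + 1 = Negz n); last by lia.
  by rewrite /pos [in RHS]big_nat_recr//= opprD addrNK.
Qed.

Lemma pos_shift l (k i : int) : pos (fun j : int => l (j + k)) i = pos l (i + k) - pos l k.
Proof.
elim/int_step_ind: i => [|i IH|i IH]; first by rewrite pos0 add0r subrr.
  by rewrite posS IH (addrAC i 1 k) posS addrAC.
apply: (addIr (l (i + k))); rewrite -[LHS]posS IH (addrAC i 1 k) posS.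
by rewrite addrAC.
Qed.

Lemma pos_nd l : (forall i, 0 <= l i) -> {homo pos l : i j / i <= j}.
Proof.
move=> l0 i j; rewrite -subr_ge0 => /gez0_abs ji.
have -> : j = i + `|j - i|%:Z by rewrite ji addrC subrK.
elim: `|j - i|%N => [|n IH]; first by rewrite addr0.
by rewrite -addn1 PoszD addrA posS (le_trans IH)// lerDl.
Qed.

Definition unbounded l : Prop :=
  (forall M, exists k, M < pos l k) /\ (forall M, exists k, pos l k < M).

(** Some point is below the origin and some point is above; between them there is
    a crossing, and by monotonicity there is no other one. *)
Lemma crosses_once l x : (forall i, 0 <= l i) -> unbounded l ->
  exists k, forall j, (x + pos l j < 0 <= x + pos l (j + 1)) <-> j = k.
Proof.
move=> l0 [up down].
have [b xb] := up (- x); have [a xa] := down (- x).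
have ab : a < b.
  rewrite ltNge; apply/negP => /(pos_nd l0); rewrite leNgt.
  by rewrite (lt_trans xa xb).
have [n bE] : exists n : nat, b = a + n%:Z.
  by exists `|b - a|%N; lia.
have {xb ab} : exists2 k, x + pos l k < 0 & 0 <= x + pos l (k + 1).
  have {xb} : 0 <= x + pos l (a + n%:Z) by rewrite -bE -lerBlDl sub0r ltW.
  elim: n {bE} => [|n IH].
    by rewrite addr0 -lerBlDl sub0r leNgt xa.
  have [xn b0|xn _] := ltP (x + pos l (a + n%:Z)) 0; last exact: IH.
  by exists (a + n%:Z); rewrite // -addrA -PoszD addn1.
move=> [k k0 k1]; exists k => j; split=> [/andP[j0 j1]|->]; last by rewrite k0.
apply/eqP; rewrite eq_le !leNgt; apply/andP; split; apply/negP => jk.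
  have : pos l (k + 1) <= pos l j by apply: pos_nd => //; lia.
  by move=> kj; have := le_lt_trans kj (_ : pos l j < - x); lra.
have : pos l (j + 1) <= pos l k by apply: pos_nd => //; lia.
by lra.
Qed.

End positions.

Section renewal.
Context {R : realType} (v : {posnum R}) (r : {nonneg R}).

(** A site [(k, b)] carries the geometric part [k] and the Bernoulli part [b] of a
    gap: consecutive centres differ by [2 r] plus [v] times their sum. *)
Definition occupancy (s : nat * bool) : nat := (s.1 + s.2)%N.

Definition spacing (z : seqs int (nat * bool)%type) (i : int) : R :=
  2 * r%:num + v%:num * (occupancy (z i))%:R.

Lemma spacing_ge z i : 2 * r%:num <= spacing z i.
Proof. by rewrite lerDl mulr_ge0. Qed.

Lemma spacing_ge0 z i : 0 <= spacing z i.
Proof. by rewrite (le_trans _ (spacing_ge _ _))// mulr_ge0. Qed.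

Lemma renewal_admissible z (x : R) :
  admissible r (fun i => x + pos (spacing z) i).
Proof. by move=> i; rewrite posS; have := spacing_ge z i; lra. Qed.

(** The configuration with ball 0 at [zx.2]. *)
Definition renewal (zx : seqs int (nat * bool)%type * measurableTypeR R) :
  config r := Config (@renewal_admissible zx.1 zx.2).

Lemma measurable_spacing i : measurable_fun setT (spacing ^~ i).
Proof.
have mi : discrete_rv (fun z : seqs int (nat * bool)%type => z i).
  by apply: discrete_rv_coord; exact: countableP.
exact: (discrete_rv_measurable
  (fun s => 2 * r%:num + v%:num * (occupancy s)%:R : R) mi).
Qed.

Lemma measurable_pos i : measurable_fun setT (fun z => pos (spacing z) i).
Proof.
case: i => n /=.
  by apply: measurable_sum => j; exact: measurable_spacing.
apply: measurableT_comp => //.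
by apply: measurable_sum => j; exact: measurable_spacing.
Qed.

Lemma measurable_renewal : measurable_fun setT renewal.
Proof.
apply: measurable_into_config => i /=.
apply: measurable_funD; last first.
  exact: (measurableT_comp (measurable_pos i)).
exact: (@measurable_snd _ _ (seqs int (nat * bool)%type) (measurableTypeR R)).
Qed.

Lemma renewal_shift k z x :
  renewal (shift_seq k z, x + pos (spacing z) k) = relabelled k (renewal (z, x)).
Proof.
apply: config_inj; apply/funext => i /=.
rewrite (_ : pos (spacing _) i = pos (fun j => spacing z (j + k)) i)//.
by rewrite pos_shift; ring.
Qed.

(** A ball that attempts to jump moves, and by exactly [v], if the free gap in
    front of it is positive: free gaps are multiples of [v]. *)
Definition departs (zw : seqs int (nat * bool)%type * seqs int bool) (i : int) : bool :=
  zw.2 i && (0 < occupancy (zw.1 i))%N.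

(** What is left of the old gap is the new geometric part; the new Bernoulli part
    is 1 if the ball in front has just moved away. *)
Definition evolve (zw : seqs int (nat * bool)%type * seqs int bool) :
    seqs int (nat * bool)%type :=
  fun i => ((occupancy (zw.1 i) - departs zw i)%N, departs zw (i + 1)).

(** Ball [i] moves by [v] if it departs; the positions are relative to ball 0,
    which moves too. *)
Lemma pos_evolve zw i : pos (spacing (evolve zw)) i =
  pos (spacing zw.1) i + v%:num * (departs zw i)%:R
  - v%:num * (departs zw 0)%:R.
Proof.
have one j : spacing (evolve zw) j = spacing zw.1 j
    - v%:num * (departs zw j)%:R + v%:num * (departs zw (j + 1))%:R.
  rewrite /spacing {1}/occupancy/= natrD natrB.
    by rewrite mulrDr mulrBr; lra.
  by rewrite /departs; case: (zw.2 j); case: (occupancy _).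
elim/int_step_ind: i => [|i IH|i IH]; first by rewrite !pos0 add0r subrr.
  by rewrite !posS IH one; lra.
by move: IH; rewrite !posS one; lra.
Qed.

Lemma step_renewal z w x : step v (renewal (z, x)) (jumpers w) =
  renewal (evolve (z, w), x + v%:num * (departs (z, w) 0)%:R).
Proof.
apply: config_inj; apply/funext => i /=; rewrite pos_evolve/= /step_fun.
rewrite (_ : (i \in jumpers w) = w i); last by apply/idP/idP => /[!inE].
rewrite posS /departs/=; case: (w i) => /=; last by lra.
have v0 : 0 < v%:num by [].
rewrite /spacing; case: (occupancy (z i)) => [|n] /=.
  by rewrite min_r; lra.
have : 0 <= v%:num * n%:R by rewrite mulr_ge0.
by rewrite -natr1 => vn; rewrite min_l; lra.
Qed.

(** Relative positions change by at most [v]. *)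
Lemma unbounded_evolve zw : unbounded (spacing zw.1) -> unbounded (spacing (evolve zw)).
Proof.
have bounds (b : bool) : 0 <= v%:num * b%:R <= v%:num.
  by case: b; rewrite ?mulr1 ?mulr0 lexx ltW.
move=> [up down]; split=> M.
  have [k Mk] := up (M + v%:num); exists k; rewrite pos_evolve.
  by have /andP[? ?] := bounds (departs zw k);
    have /andP[? ?] := bounds (departs zw 0); lra.
have [k Mk] := down (M - v%:num); exists k; rewrite pos_evolve.
by have /andP[? ?] := bounds (departs zw k);
  have /andP[? ?] := bounds (departs zw 0); lra.
Qed.

Lemma discrete_rv_departs i : discrete_rv (departs ^~ i).
Proof.
have z_rv : discrete_rv
    (fun zw : seqs int (nat * bool)%type * seqs int bool => zw.1 i).
  apply: (@discrete_rv_mfun _ _ (nat * bool)%type _ _ fst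
    (fun z : seqs int (nat * bool)%type => z i)); first exact: measurable_fst.
  by apply: discrete_rv_coord; exact: countableP.
have w_rv : discrete_rv
    (fun zw : seqs int (nat * bool)%type * seqs int bool => zw.2 i).
  apply: (@discrete_rv_mfun _ _ bool _ _ snd (fun w : seqs int bool => w i));
    first exact: measurable_snd.
  by apply: discrete_rv_coord; exact: countableP.
have := discrete_rv_comp (fun zw => zw.2 && (0 < occupancy zw.1)%N)
  (discrete_rv_pair (countableP _) (countableP _) z_rv w_rv).
by [].
Qed.

Lemma measurable_evolve : measurable_fun setT evolve.
Proof.
apply: measurable_seqs => i s.
have z_rv : discrete_rv
    (fun zw : seqs int (nat * bool)%type * seqs int bool => zw.1 i).
  apply: (@discrete_rv_mfun _ _ (nat * bool)%type _ _ fst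
    (fun z : seqs int (nat * bool)%type => z i)); first exact: measurable_fst.
  by apply: discrete_rv_coord; exact: countableP.
have := discrete_rv_comp
  (fun t : (nat * bool) * (bool * bool) =>
    ((occupancy t.1 - t.2.1)%N, t.2.2))
  (discrete_rv_pair (countableP _) (countableP _) z_rv
    (discrete_rv_pair (countableP _) (countableP _)
      (discrete_rv_departs i) (discrete_rv_departs (i + 1)))).
by move=> /(_ [set s]).
Qed.

End renewal.

(** * Geometric and Bernoulli variables *)

Section geometric_quantile.
Variable R : realType.
Implicit Types q x : R.

(** For a uniform [x] this has the law [P(G >= k) = q ^ k]: it is the least [k] with
    [q ^ k.+1 <= x]. It is 0 if there is none, which for [0 <= q < 1] only
    happens for [x <= 0]. *)
Definition geo q x : nat :=
  if pselect (exists k, q ^+ k.+1 <= x) is left ex then ex_minn ex else 0%N.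

Lemma exprn_small q x : 0 <= q < 1 -> 0 < x -> exists k, q ^+ k.+1 <= x.
Proof.
move=> /andP[q0 q1] x0.
have : q ^+ k @[k --> \oo] --> (0 : R) by apply: cvg_expr; rewrite ger0_norm.
move=> /cvgrPdist_le/(_ _ x0)[k _ /(_ k.+1 (leqnSn k))] /=.
by rewrite sub0r normrN ger0_norm ?exprn_ge0//; exists k.
Qed.

Lemma geo_gt q x k : 0 <= q < 1 -> (k < geo q x)%N = (0 < x < q ^+ k.+1).
Proof.
move=> q01; have /andP[q0 q1] := q01; rewrite /geo; case: pselect => ex; last first.
  rewrite ltn0; apply/esym/negbTE/negP => /andP[x0 _].
  by apply: ex; exact: exprn_small.
case: ex_minnP => j jx jmin.
have [x0|x0] /= := ltP 0 x.
  apply/idP/idP => [kj|xk].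
    by rewrite ltNge; apply: contraTN kj => /jmin; rewrite -leqNgt.
  by rewrite ltnNge; apply: contraTN xk => jk; rewrite -leNgt
    (le_trans _ jx)// ler_wiXn2l// ltW.
apply/negbTE; rewrite -leqNgt; apply: (leq_trans (jmin 0%N _)) => //.
have := exprn_ge0 j.+1 q0; rewrite expr1 => jq.
have : q ^+ j.+1 = 0 by apply/eqP; rewrite eq_le jq andbT (le_trans jx).
move/eqP; rewrite expf_eq0 => /andP[_ /eqP ->].
by rewrite (le_trans jq).
Qed.

Lemma geo_mono q q' x : 0 <= q <= q' -> q' < 1 -> (geo q x <= geo q' x)%N.
Proof.
move=> /andP[q0 qq'] q'1; rewrite leqNgt; apply/negP.
have q01 : 0 <= q < 1 by rewrite q0 (le_lt_trans qq').
have q'01 : 0 <= q' < 1 by rewrite (le_trans q0 qq').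
rewrite geo_gt// => /andP[x0 xq].
suff : (geo q' x < geo q' x)%N by rewrite ltnn.
by rewrite [X in _ X]geo_gt// x0 (lt_le_trans xq)// lerXn2r// nnegrE (le_trans q0).
Qed.

(** By [geo_gt] the values are determined by strict comparisons of [x] with powers
    of the parameter, which persist for nearby parameters. *)
Lemma geo_cvg (q_ : nat -> R) q x : (forall n, 0 <= q_ n < 1) -> 0 <= q < 1 ->
  q_ n @[n --> \oo] --> q -> (forall k, x <> q ^+ k.+1) ->
  \forall n \near \oo, geo (q_ n) x = geo q x.
Proof.
move=> q_01 q01 q_q xq.
have q_X k : q_ n ^+ k @[n --> \oo] --> q ^+ k.
  by apply: (continuous_cvg _ (@exprn_continuous R k q)).
have [x0|x0] := leP x 0.
  near=> n; have z t : 0 <= t < 1 -> geo t x = 0%N.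
    move=> t01; apply/eqP; rewrite -leqn0 leqNgt geo_gt//.
    by rewrite ltNge x0.
  by rewrite !z.
have : \forall n \near \oo, (geo (q_ n) x <= geo q x)%N.
  have : q ^+ (geo q x).+1 < x.
    rewrite lt_neqAle eq_sym; apply/andP; split; first exact/eqP.
    have := ltnn (geo q x); rewrite geo_gt// x0/= => /negbT.
    by rewrite -leNgt.
  move=> /(cvgr_lt _ (q_X (geo q x).+1)); apply: filterS => n qn.
  rewrite leqNgt geo_gt// x0/= -leNgt; exact: ltW.
case E : (geo q x) => [|k].
  by apply: filterS => n; rewrite leqn0 => /eqP.
have : \forall n \near \oo, (k.+1 <= geo (q_ n) x)%N.
  have : x < q ^+ k.+1 by have := leqnn k.+1; rewrite -{2}E geo_gt// x0.
  move=> /(cvgr_gt _ (q_X k.+1)); apply: filterS => n qn.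
  by rewrite geo_gt// x0.
by apply: filterS2 => n le ge; apply/eqP; rewrite eqn_leq le ge.
Unshelve. all: by end_near.
Qed.

End geometric_quantile.

Section uniform_variable.
Context d (Omega : measurableType d) (R : realType) (P : probability Omega R).
Variable U : Omega -> R.
Hypothesis mU : measurable_fun setT U.
Hypothesis U_law : forall A : set R, measurable A -> P (U @^-1` A) =
  lebesgue_measure ((A : set (measurableTypeR R)) `&` `[0, 1[%classic).

Lemma uniform_lt a : 0 <= a <= 1 -> P [set w | U w < a] = a%:E.
Proof.
move=> /andP[a0 a1].
rewrite (_ : [set w | _] = U @^-1` `]-oo, a[%classic); last first.
  by apply/seteqP; split=> w /=; rewrite in_itv.
rewrite U_law// (_ : _ `&` _ = `[0, a[%classic); last first.
  apply/seteqP; split=> x /=; rewrite !in_itv/=.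
    by move=> [xa /andP[-> _]].
  by move=> /andP[x0 xa]; rewrite x0 xa (lt_le_trans xa).
rewrite lebesgue_measure_itv/= lte_fin; case: ltP => [_|a0'].
  by rewrite -EFinB subr0.
by congr EFin; apply/eqP; rewrite eq_le a0 a0'.
Qed.

Lemma uniform_gt0_lt a : 0 <= a <= 1 -> P [set w | 0 < U w < a] = a%:E.
Proof.
move=> /andP[a0 a1].
rewrite (_ : [set w | _] = U @^-1` `]0, a[%classic); last first.
  by apply/seteqP; split=> w /=; rewrite in_itv.
rewrite U_law// (_ : _ `&` _ = `]0, a[%classic); last first.
  apply/seteqP; split=> x /=; rewrite !in_itv/=; first by move=> [].
  move=> /andP[x0 xa]; rewrite x0 xa; split=> //.
  by rewrite ltW// (lt_le_trans xa).
rewrite lebesgue_measure_itv/= lte_fin; case: ltP => [_|a0'].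
  by rewrite -EFinB subr0.
by congr EFin; apply/eqP; rewrite eq_le a0 a0'.
Qed.

Lemma uniform_null c : P [set w | U w = c] = 0%E.
Proof.
rewrite (_ : [set w | _] = U @^-1` [set c])// U_law//.
apply/eqP; rewrite eq_le measure_ge0 andbT.
rewrite -(lebesgue_measure_set1 c); apply: le_measure; rewrite ?inE//.
exact: measurableI.
Qed.

Definition below (a : R) (w : Omega) : bool := U w < a.

Lemma measurable_below a : measurable [set w | U w < a].
Proof.
rewrite (_ : [set w | _] = U @^-1` `]-oo, a[%classic); last first.
  by apply/seteqP; split=> w /=; rewrite in_itv.
by rewrite -[X in measurable X]setTI; exact: mU.
Qed.

Lemma discrete_rv_below a : discrete_rv (below a).
Proof.
apply: discrete_rv_countable; first exact: countableP.
case; first exact: measurable_below.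
rewrite (_ : [set w | _] = ~` [set w | U w < a]).
  exact/measurableC/measurable_below.
by apply/seteqP; split=> w /=; rewrite /below; case: (U w < a).
Qed.

Lemma below_pmf a b : 0 <= a <= 1 ->
  P [set w | below a w = b] = bernoulli_mass a b.
Proof.
move=> a01; case: b; first exact: uniform_lt.
rewrite (_ : [set w | _] = ~` [set w | U w < a]).
  rewrite probability_setC; last exact: measurable_below.
  by rewrite uniform_lt.
by apply/seteqP; split=> w /=; rewrite /below; case: (U w < a).
Qed.

Variable q : R.
Hypothesis q01 : 0 <= q < 1.

Let qX01 k : 0 <= q ^+ k <= 1.
Proof. by have /andP[q0 q1] := q01; rewrite exprn_ge0//= exprn_ile1// ltW. Qed.

Lemma measurable_geo_gt k : measurable [set w | (k < geo q (U w))%N].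
Proof.
rewrite (_ : [set w | _] = U @^-1` `]0, q ^+ k.+1[%classic); last first.
  by apply/seteqP; split=> w /=; rewrite geo_gt// in_itv.
by rewrite -[X in measurable X]setTI; exact: mU.
Qed.

Lemma geo_tail k : P [set w | (k < geo q (U w))%N] = (q ^+ k.+1)%:E.
Proof.
by under eq_set do rewrite geo_gt//; rewrite uniform_gt0_lt.
Qed.

Let geo_succ k : [set w | geo q (U w) = k.+1] =
  [set w | (k < geo q (U w))%N] `\` [set w | (k.+1 < geo q (U w))%N].
Proof.
apply/seteqP; split=> w /=; first by move=> ->; split; rewrite ?ltnn.
by move=> [a /negP]; rewrite -leqNgt => b; apply/eqP; rewrite eqn_leq a b.
Qed.

Let geo_zero : [set w | geo q (U w) = 0%N] = ~` [set w | (0 < geo q (U w))%N].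
Proof. by apply/seteqP; split=> w /=; case: (geo q (U w)). Qed.

Lemma discrete_rv_geo : discrete_rv (fun w => geo q (U w)).
Proof.
apply: discrete_rv_countable; first exact: countableP.
case=> [|k]; first by rewrite geo_zero; exact/measurableC/measurable_geo_gt.
by rewrite geo_succ; apply: measurableD; exact: measurable_geo_gt.
Qed.

Lemma geo_pmf k : P [set w | geo q (U w) = k] = ((1 - q) * q ^+ k)%:E.
Proof.
case: k => [|k].
  rewrite geo_zero probability_setC; last exact: measurable_geo_gt.
  by rewrite geo_tail expr1 expr0 mulr1.
rewrite geo_succ measureD; [|exact: measurable_geo_gt|exact: measurable_geo_gt|].
  rewrite setIidr; last by move=> w /=; exact: ltnW.
  transitivity ((q ^+ k.+1)%:E - (q ^+ k.+2)%:E)%E.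
    by congr (_ - _)%E; exact: geo_tail.
  by rewrite -EFinB [q ^+ k.+2]exprS; congr EFin; ring.
by rewrite -ge0_fin_numE// fin_num_measure//; exact: measurable_geo_gt.
Qed.

Lemma sum_indic_gt (n : nat) (f : nat -> R) : (forall k, 0 <= f k) ->
  (\sum_(k <oo) (f k * (k < n)%:R)%:E = (\sum_(k < n) f k)%:E)%E.
Proof.
move=> f0; apply/cvg_lim => //; apply: cvg_near_cst.
exists n => // N /= nN; rewrite sumEFin; congr EFin.
rewrite (big_cat_nat (n := n))//= -(big_mkord xpredT f).
rewrite [X in _ + X]big_nat_cond [X in _ + X]big1 ?addr0.
  apply: eq_big_nat => k /andP[_ kn]; by rewrite kn mulr1.
by move=> k /andP[/andP[nk _] _]; rewrite ltnNge nk mulr0.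
Qed.

(** Layer cake formula: [f k] is counted when the variable exceeds [k]. *)
Lemma integral_geo_layers (f : nat -> R) : (forall k, 0 <= f k) ->
  (\int[P]_w (\sum_(k < geo q (U w)) f k)%:E =
   \sum_(k <oo) (f k * q ^+ k.+1)%:E)%E.
Proof.
move=> f0.
under eq_integral do rewrite -sum_indic_gt//.
rewrite integral_nneseries//; last 2 first.
- move=> k; apply/measurable_EFinP.
  exact: (discrete_rv_measurable (fun n => f k * (k < n)%:R : R) discrete_rv_geo).
- by move=> k w _; rewrite lee_fin mulr_ge0.
apply: eq_eseriesr => k _.
transitivity (\int[P]_w ((f k)%:E *
    (\1_[set w | (k < geo q (U w))%N] w)%:E))%E.
  apply: eq_integral => w _; rewrite -EFinM indicE; congr (EFin (_ * _%:R)); congr nat_of_bool.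
  by apply/idP/idP; rewrite inE.
rewrite ge0_integralZl//; last 2 first.
- exact/measurable_EFinP/measurable_indic/measurable_geo_gt.
- by rewrite lee_fin.
rewrite integral_indic ?setIT; [|by []|exact: measurable_geo_gt].
by rewrite EFinM; congr (_ * _)%E; exact: geo_tail.
Qed.

Lemma integral_geo : (\int[P]_w (geo q (U w))%:R%:E = (q / (1 - q))%:E)%E.
Proof.
have /andP[q0 q1] := q01.
transitivity (\int[P]_w (\sum_(k < geo q (U w)) (1 : R))%:E)%E.
  by apply: eq_integral => w _; rewrite sumr_const card_ord.
rewrite (integral_geo_layers (f := fun=> 1))//.
apply/cvg_lim => //.
rewrite (_ : (fun n => _) = EFin \o series (geometric q q)).
  apply/cvg_EFin; first exact: nearW.
  by apply: cvg_geometric_series; rewrite ger0_norm.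
apply/funext => n; rewrite /= sumEFin /series/=; congr EFin.
by apply: eq_bigr => k _; rewrite mul1r exprS.
Qed.

(** With [y] the eighth root of [q], Bernoulli's inequality for [(1 / y) ^ k] bounds
    [k y ^ k]; four factors [y ^ k] pay for [k ^ 4] and the other four remain. *)
Lemma pow4_geometric : exists C s, [/\ 0 <= C, 0 <= s < 1 &
  forall k, k.+1%:R ^+ 4 * q ^+ k.+1 <= C * s ^+ k.+1].
Proof.
have /andP[q0 q1] := q01; have [qz|qn] := eqVneq q 0.
  exists 0, 0; rewrite lexx ltr01; split=> // k.
  by rewrite qz expr0n/= !mulr0.
have {qn} q0 : 0 < q by rewrite lt_neqAle eq_sym qn.
pose y := Num.sqrt (Num.sqrt (Num.sqrt q)).
have y8 : q = y ^+ 4 * y ^+ 4.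
  rewrite -exprD (_ : 4 + 4 = 2 * (2 * 2))%N// !exprM.
  by rewrite !sqr_sqrtr// ?sqrtr_ge0// ltW.
have y0 : 0 < y by rewrite !sqrtr_gt0.
have y1 : y < 1.
  rewrite ltNge; apply/negP => y1; have : 1 <= y ^+ 8 by exact: exprn_ege1.
  by rewrite (_ : 8 = 4 + 4)%N// exprD -y8 leNgt q1.
pose e := y^-1 - 1.
have e0 : 0 < e by rewrite subr_gt0 invf_gt1.
exists (e^-1 ^+ 4), (y ^+ 4).
have y4 : 0 <= y ^+ 4 < 1 by rewrite exprn_ge0 1?ltW//= exprn_ilt1// ltW.
split=> // [|k]; first by rewrite exprn_ge0// invr_ge0 ltW.
have ky : k.+1%:R * y ^+ k.+1 <= e^-1.
  have yk : 0 < y ^+ k.+1 by rewrite exprn_gt0.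
  rewrite -ler_pdivlMr// [_ / y ^+ _]mulrC ler_pdivlMr// -exprVn.
  have -> : y^-1 = 1 + e by rewrite /e addrC subrK.
  elim: k {yk} => [|k IH]; first by rewrite mul1r expr1 lerDr.
  rewrite exprS -natr1 mulrDl mul1r.
  have : 1 <= (1 + e) ^+ k.+1 by rewrite exprn_ege1// lerDl ltW.
  by move: IH; set z := (1 + e) ^+ k.+1 => IH z1; nra.
have : (k.+1%:R * y ^+ k.+1) ^+ 4 <= e^-1 ^+ 4.
  by rewrite lerXn2r// nnegrE ?invr_ge0 ?mulr_ge0 ?exprn_ge0// ltW.
rewrite exprMn => /(ler_wpM2r (_ : 0 <= (y ^+ 4) ^+ k.+1)).
rewrite exprn_ge0; last by case/andP: y4.
move=> /(_ isT); apply: le_trans.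
by rewrite {1}y8 exprMn mulrA (exprAC y k.+1 4).
Qed.

Lemma integrable_geo_pow4 :
  P.-integrable setT (fun w => ((geo q (U w))%:R ^+ 4)%:E).
Proof.
apply/integrableP; split.
  apply/measurable_EFinP.
  exact: (discrete_rv_measurable (fun n => n%:R ^+ 4 : R) discrete_rv_geo).
have [C [s [C0 /andP[s0 s1] Cs]]] := pow4_geometric.
apply: (@le_lt_trans _ _ (\int[P]_w
    (\sum_(k < geo q (U w)) k.+1%:R ^+ 4)%:E)%E).
  apply: ge0_le_integral => //.
  - apply/measurable_EFinP/measurableT_comp => //.
    exact: (discrete_rv_measurable (fun n => n%:R ^+ 4 : R) discrete_rv_geo).
  - apply/measurable_EFinP.
    exact: (discrete_rv_measurable
      (fun n => \sum_(k < n) k.+1%:R ^+ 4 : R) discrete_rv_geo).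
  move=> w _; rewrite /= normrX normr_nat lee_fin.
  case: (geo _ _) => [|n]; first by rewrite expr0n/= big_ord0.
  by rewrite big_ord_recr/= lerDr sumr_ge0// => k _; rewrite exprn_ge0.
rewrite (integral_geo_layers (f := fun k => k.+1%:R ^+ 4)); last first.
  by move=> k; rewrite exprn_ge0.
apply: (@le_lt_trans _ _ (C * s * (1 - s)^-1)%:E); last exact: ltry.
apply: lime_le.
  apply: is_cvg_nneseries => n _ _; rewrite lee_fin mulr_ge0 ?exprn_ge0//.
  by have /andP[] := q01.
apply: nearW => n; rewrite sumEFin lee_fin.
apply: (@le_trans _ _ (\sum_(0 <= k < n) (C * s) * s ^+ k)).
  by apply: ler_sum => k _; rewrite (le_trans (Cs k))// exprS mulrA.
rewrite -/(series (geometric (C * s) s) n).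
have := @cvg_geometric_series R (C * s) s.
rewrite ger0_norm// => /(_ s1) gs.
rewrite -(cvg_lim (@Rhausdorff R) gs); apply: nondecreasing_cvgn_le.
  apply/nondecreasing_seqP => k; rewrite /series/= big_nat_recr//= lerDl.
  by rewrite mulr_ge0 ?exprn_ge0// mulr_ge0.
by apply: cvgP gs.
Qed.

End uniform_variable.

(** * The stationary law of the gaps *)

Section sites.
Variable R : realType.
Local Notation Omega := (seqs nat bool).
Local Notation coin := (coin R).

Definition even_uniform (w : Omega) : R := binval R (even_bits w).
Definition odd_uniform (w : Omega) : R := binval R (odd_bits w).

Lemma measurable_even_uniform : measurable_fun setT even_uniform.
Proof. by apply: measurableT_comp => //; exact: measurable_binval. Qed.

Lemma measurable_odd_uniform : measurable_fun setT odd_uniform.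
Proof. by apply: measurableT_comp => //; exact: measurable_binval. Qed.

Let m_binval (A : set R) : measurable A -> measurable (binval R @^-1` A).
Proof.
by move=> mA; rewrite -[X in measurable X]setTI; exact: measurable_binval.
Qed.

Lemma even_uniform_law (A : set R) : measurable A -> coin (even_uniform @^-1` A) =
  lebesgue_measure ((A : set (measurableTypeR R)) `&` `[0, 1[%classic).
Proof.
move=> mA; rewrite -(coin_binval mA).
exact: (split_fst (coin_splits R) (m_binval mA)).
Qed.

Lemma odd_uniform_law (A : set R) : measurable A -> coin (odd_uniform @^-1` A) =
  lebesgue_measure ((A : set (measurableTypeR R)) `&` `[0, 1[%classic).
Proof.
move=> mA; rewrite -(coin_binval mA).
exact: (split_snd (coin_splits R) (m_binval mA)).
Qed.

(** The quantiles of a geometric and of a Bernoulli law, at two independent uniform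
    variables; the same variables serve for all parameters. *)
Definition site (q a : R) (w : Omega) : nat * bool :=
  (geo q (even_uniform w), below odd_uniform a w).
Definition attempt (p : R) (w : Omega) : bool := below (binval R) p w.

Definition site_mass (q a : R) (s : nat * bool) : \bar R :=
  (((1 - q) * q ^+ s.1)%:E * bernoulli_mass a s.2)%E.

Section parameters.
Variables q a p : R.
Hypothesis q01 : 0 <= q < 1.
Hypothesis a01 : 0 <= a <= 1.
Hypothesis p01 : 0 <= p <= 1.

Lemma discrete_rv_site : discrete_rv (site q a).
Proof.
apply: discrete_rv_pair; try exact: countableP.
- exact: (discrete_rv_geo measurable_even_uniform q01).
- exact: (discrete_rv_below measurable_odd_uniform).
Qed.

Lemma discrete_rv_attempt : discrete_rv (attempt p).
Proof. exact: (discrete_rv_below (@measurable_binval R)). Qed.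

(** The even and the odd bits are independent. *)
Lemma coin_pair (S S' : Type) (X : Omega -> S) (Y : Omega -> S') s s' :
  discrete_rv X -> discrete_rv Y ->
  coin [set w | (X (even_bits w), Y (odd_bits w)) = (s, s')] =
  (coin [set w | X w = s] * coin [set w | Y w = s'])%E.
Proof.
move=> mX mY; rewrite -(coin_splits R (mX [set s]) (mY [set s'])).
by congr (coin _); apply/seteqP; split=> w /=; case=> -> ->.
Qed.

Let d_geo : discrete_rv (fun w => geo q (binval R w)).
Proof. exact: (discrete_rv_geo (@measurable_binval R) q01). Qed.

Lemma site_pmf s : coin [set w | site q a w = s] = site_mass q a s.
Proof.
case: s => k b.
rewrite (coin_pair k b d_geo (discrete_rv_below (@measurable_binval R) a)).
rewrite (geo_pmf (@measurable_binval R) (@coin_binval R) q01).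
by rewrite (below_pmf (@measurable_binval R) (@coin_binval R)).
Qed.

Lemma attempt_pmf b : coin [set w | attempt p w = b] = bernoulli_mass p b.
Proof. exact: (below_pmf (@measurable_binval R) (@coin_binval R)). Qed.

Definition gap_law : probability (seqs int (nat * bool)%type) R :=
  iid_law coin even_bits odd_bits discrete_rv_site.

Definition noise_law : probability (seqs int bool) R :=
  iid_law coin even_bits odd_bits discrete_rv_attempt.

Lemma gap_law_iid : is_iid (site_mass q a) gap_law.
Proof.
apply: eq_is_iid (is_iid_law (coin_splits R) discrete_rv_site) => s.
exact: site_pmf.
Qed.

Lemma noise_law_iid : is_iid (bernoulli_mass p) noise_law.
Proof.
apply: eq_is_iid (is_iid_law (coin_splits R) discrete_rv_attempt) => s.
exact: attempt_pmf.
Qed.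

Definition geo_law : probability (seqs int nat) R :=
  iid_law coin even_bits odd_bits d_geo.

Lemma geo_law_iid : is_iid (fun k => ((1 - q) * q ^+ k)%:E) geo_law.
Proof.
apply: eq_is_iid (is_iid_law (coin_splits R) d_geo) => k.
exact: (geo_pmf (@measurable_binval R) (@coin_binval R) q01).
Qed.

End parameters.

(** The second components move one site to the left: the departures from the site
    [i + 1] are the arrivals at the site [i]. *)
Definition stagger (z : seqs int (nat * bool)%type) : seqs int (nat * bool)%type :=
  fun i => ((z i).1, (z (i + 1)).2).

Lemma measurable_stagger : measurable_fun setT stagger.
Proof.
apply: measurable_seqs => i [k b].
have mi (j : int) : discrete_rv (fun z : seqs int (nat * bool)%type => z j).
  by apply: discrete_rv_coord; exact: countableP.
have -> : [set z | stagger z i = (k, b)] =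
    (fun z => z i) @^-1` [set s | s.1 = k] `&`
    (fun z => z (i + 1)) @^-1` [set s | s.2 = b].
  by apply/seteqP; split=> z; rewrite /stagger/=; case=> -> ->.
by apply: measurableI; exact: mi.
Qed.

(** The two parts of the gaps form independent sequences [m1] and [m2]; only the
    second one is translated, and its law is invariant by translation. *)
Lemma iid_stagger (Q1 : nat -> \bar R) (Q2 : bool -> \bar R)
    (Gamma : probability (seqs int (nat * bool)%type) R)
    (m1 : probability (seqs int nat) R) (m2 : probability (seqs int bool) R) :
  is_iid (fun s => (Q1 s.1 * Q2 s.2)%E) Gamma ->
  is_iid Q1 m1 -> is_iid Q2 m2 ->
  forall A, measurable A -> Gamma (stagger @^-1` A) = Gamma A.
Proof.
move=> GQ mQ1 mQ2 A mA.
have GE B : measurable B -> Gamma B = (m1 \x m2)%E (@zips nat bool @^-1` B).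
  move=> mB; apply: (iid_unique GQ
    (m2 := distribution (m1 \x m2)%E (@zips nat bool))) => //.
  exact: is_iid_zips.
have mzA : measurable (@zips nat bool @^-1` A) by exact: measurable_funPTI.
rewrite (GE A mA) (GE (stagger @^-1` A)); last first.
  by rewrite -[X in measurable X]setTI; exact: measurable_stagger.
apply: eq_integral => f _ /=.
rewrite -(is_iid_shift 1 mQ2 (measurable_xsection f mzA)).
by congr (m2 _); apply/seteqP; split=> g; rewrite /xsection/= !inE.
Qed.

(** Both laws are realized on the space of coin tosses, where the assertion is an
    identity of random sequences. *)
Lemma iid_map (S S' : pointedType) (X : Omega -> S) (h : S -> S')
    (Q : S -> \bar R) (Q' : S' -> \bar R)
    (m : probability (seqs int S) R) (m' : probability (seqs int S') R) :
  countable [set: S] -> discrete_rv X ->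
  (forall s, coin [set w | X w = s] = Q s) ->
  (forall s, coin [set w | h (X w) = s] = Q' s) ->
  is_iid Q m -> is_iid Q' m' ->
  forall A, measurable A -> m [set f : seqs int S | A ((h \o f) : seqs int S')] = m' A.
Proof.
move=> cS mX XQ hXQ' mQ mQ' A mA.
have mhX : discrete_rv (h \o X) by exact: discrete_rv_comp.
have mh : measurable_fun setT (fun f : seqs int S => h \o f : seqs int S').
  by apply: measurable_seqs => i s; exact: (discrete_rv_coord i cS [set x | h x = s]).
have mhA : measurable [set f : seqs int S | A ((h \o f) : seqs int S')].
  by rewrite -[X in measurable X]setTI; exact: mh.
rewrite (iid_unique mQ (m2 := iid_law coin even_bits odd_bits mX) _ mhA); last first.
  exact: eq_is_iid XQ (is_iid_law (coin_splits R) mX).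
rewrite (iid_unique mQ' (m2 := iid_law coin even_bits odd_bits mhX) _ mA)//.
exact: eq_is_iid hXQ' (is_iid_law (coin_splits R) mhX).
Qed.

Lemma coin_two (S : Type) (X : Omega -> S) s t : discrete_rv X -> s <> t ->
  coin [set w | X w = s \/ X w = t] =
  (coin [set w | X w = s] + coin [set w | X w = t])%E.
Proof.
move=> mX st; rewrite -measureU; [by []|exact: (mX [set s])|exact: (mX [set t])|].
by apply/seteqP; split=> // w /= [-> ].
Qed.

Section stationarity.
Variables q a p : R.
Hypothesis q01 : 0 <= q < 1.
Hypothesis a01 : 0 <= a <= 1.
Hypothesis p01 : 0 <= p <= 1.
(** In a stationary state the arrivals at a site have the law of the departures
    from it: it says that a departure has probability [a]. *)
Hypothesis balance : p * (1 - a) * q = (1 - p) * a.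

Let X (w : Omega) : (nat * bool) * bool :=
  (site q a (even_bits w), attempt p (odd_bits w)).

Let mX : discrete_rv X.
Proof.
apply: discrete_rv_pair; try exact: countableP.
- exact: (@discrete_rv_mfun _ _ (nat * bool)%type _ _ even_bits (site q a)
    measurable_even_bits (discrete_rv_site a q01)).
- exact: (@discrete_rv_mfun _ _ bool _ _ odd_bits (attempt p)
    measurable_odd_bits (discrete_rv_attempt p)).
Qed.

Let X_pmf s : coin [set w | X w = s] =
  (site_mass q a s.1 * bernoulli_mass p s.2)%E.
Proof.
case: s => s c.
rewrite (coin_pair s c (discrete_rv_site a q01) (discrete_rv_attempt p)).
by rewrite site_pmf// attempt_pmf.
Qed.

(** One step at one site: the customers who stay, and whether one departs. *)
Definition site_step (t : (nat * bool) * bool) : nat * bool :=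
  let d := t.2 && (0 < occupancy t.1)%N in ((occupancy t.1 - d)%N, d).

Let site_step_true k t : site_step t = (k, true) <->
  t = ((k.+1, false), true) \/ t = ((k, true), true).
Proof.
split=> [|[->|->]]; rewrite /site_step/occupancy/=; last 2 first.
- by rewrite addn0 subn1.
- by rewrite addn1 subn1.
case: t => [[n []] []] //=; rewrite ?addn1 ?addn0/=.
  by rewrite subn1/= => -[->]; right.
by case: n => [|n]//=; rewrite subn1/= => -[->]; left.
Qed.

Let site_step_false0 t : site_step t = (0%N, false) <->
  t = ((0%N, false), true) \/ t = ((0%N, false), false).
Proof.
split=> [|[->|->]]//; rewrite /site_step/occupancy/=.
case: t => [[n []] []] //=; rewrite ?addn1 ?addn0/= ?subn0//.
  by case: n => [|n]//= _; left.
by move=> [->]; right.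
Qed.

Let site_step_falseS k t : site_step t = (k.+1, false) <->
  t = ((k.+1, false), false) \/ t = ((k, true), false).
Proof.
split=> [|[->|->]]; rewrite /site_step/occupancy/= ?addn1 ?addn0 ?subn0//.
case: t => [[n []] []] //=; rewrite ?addn1 ?addn0/= ?subn0//.
- by move=> [->]; right.
- by case: n.
- by move=> [->]; left.
Qed.

(** Discrete Burke property. Every outcome has two antecedents; the balance
    equation evaluates the sum of their masses. *)
Lemma site_step_pmf s : coin [set w | site_step (X w) = s] = site_mass q a s.
Proof.
have E (s1 s2 : (nat * bool) * bool) : s1 <> s2 ->
    coin [set w | X w = s1 \/ X w = s2] =
    (site_mass q a s1.1 * bernoulli_mass p s1.2 +
     site_mass q a s2.1 * bernoulli_mass p s2.2)%E.
  by move=> s12; rewrite coin_two// !X_pmf.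
have aq k : (1 - a) * q ^+ k.+1 + a * q ^+ k = q ^+ k * ((1 - a) * q + a).
  by rewrite exprS; ring.
have pa : p * ((1 - a) * q + a) = a by have := balance; lra.
have pa' : (1 - p) * ((1 - a) * q + a) = (1 - a) * q by lra.
case: s => k [].
  rewrite (_ : [set w | _] =
    [set w | X w = ((k.+1, false), true) \/ X w = ((k, true), true)]).
    rewrite E// /site_mass/bernoulli_mass/= -!EFinM -EFinD; congr EFin.
    rewrite -[in RHS]pa; have := aq k; set A := q ^+ k.+1; set B := q ^+ k.
    move=> AB; transitivity ((1 - q) * (p * ((1 - a) * A + a * B))); first by ring.
    by rewrite AB; ring.
  by apply/seteqP; split=> w; [move/(site_step_true _ _).1|move/(site_step_true _ _).2].
case: k => [|k].
  rewrite (_ : [set w | _] =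
    [set w | X w = ((0%N, false), true) \/ X w = ((0%N, false), false)]).
    rewrite E// /site_mass/bernoulli_mass/= -!EFinM -EFinD; congr EFin.
    by ring.
  by apply/seteqP; split=> w; [move/(site_step_false0 _).1|move/(site_step_false0 _).2].
rewrite (_ : [set w | _] =
  [set w | X w = ((k.+1, false), false) \/ X w = ((k, true), false)]).
  rewrite E// /site_mass/bernoulli_mass/= -!EFinM -EFinD; congr EFin.
  have := aq k; set A := q ^+ k.+1; set B := q ^+ k.
  move=> AB; transitivity ((1 - q) * ((1 - p) * ((1 - a) * A + a * B))); first by ring.
  rewrite AB (_ : A = q * B); last by rewrite /A exprS.
  transitivity ((1 - q) * (B * ((1 - p) * ((1 - a) * q + a)))); first by ring.
  by rewrite pa'; ring.
by apply/seteqP; split=> w; [move/(site_step_falseS _ _).1|move/(site_step_falseS _ _).2].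
Qed.

Variable Gamma : probability (seqs int (nat * bool)%type) R.
Variable N : probability (seqs int bool) R.
Hypothesis Gamma_iid : is_iid (site_mass q a) Gamma.
Hypothesis N_iid : is_iid (bernoulli_mass p) N.

(** The map [evolve] is [site_step] at every site followed by [stagger]. *)
Theorem gap_law_stationary A : measurable A ->
  (Gamma \x N)%E (@evolve @^-1` A) = Gamma A.
Proof.
move=> mA.
have mB : measurable (stagger @^-1` A).
  by rewrite -[X in measurable X]setTI; exact: measurable_stagger.
transitivity (Gamma (stagger @^-1` A)); last first.
  exact: (iid_stagger Gamma_iid (geo_law_iid q01) (noise_law_iid a01)).
rewrite -(iid_map (h := site_step) (countableP _) mX X_pmf site_step_pmf
  (m := distribution (Gamma \x N)%E (@zips (nat * bool)%type bool)) _ Gamma_iid mB).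
  by [].
exact: is_iid_zips.
Qed.

End stationarity.

End sites.

(** * The law of large numbers for the gaps *)

Lemma measurable_cvg_set d (T : measurableType d) (R : realType)
    (f : nat -> T -> R) (l : R) : (forall n, measurable_fun setT (f n)) ->
  measurable [set w | f n w @[n --> \oo] --> l].
Proof.
move=> mf.
have -> : [set w | f n w @[n --> \oo] --> l] =
    \bigcap_k \bigcup_N \bigcap_n
      [set w | (N <= n)%N -> `|l - f n w| < k.+1%:R^-1].
  apply/seteqP; split=> [w /cvgrPdist_lt fw k _|w fw].
    have k0 : 0 < k.+1%:R^-1 :> R by rewrite invr_gt0.
    by have [N _ NP] := fw _ k0; exists N => // n _; exact: NP.
  apply/cvgrPdist_lt => e e0; pose k := Num.truncn e^-1.
  have ke : k.+1%:R^-1 < e.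
    by rewrite invf_plt ?posrE// truncnS_gt.
  have [N _ NP] := fw k I; exists N => // n Nn.
  by apply: lt_trans ke; exact: NP.
apply: bigcapT_measurable => k; apply: bigcupT_measurable => N.
apply: bigcapT_measurable => n.
have [Nn|nN] := leqP N n; last first.
  rewrite (_ : [set w | _] = setT)//; apply/seteqP; split=> // w _ /=.

rewrite (_ : [set w | _] = (fun w => `|l - f n w|) @^-1` `]-oo, k.+1%:R^-1[).
  rewrite -[X in measurable X]setTI.
  have mg : measurable_fun setT (fun w => `|l - f n w|).
    by apply: measurableT_comp => //; exact: measurable_funB.
  by apply: mg => //; exact: measurable_itv.
by apply/seteqP; split=> w /=; rewrite in_itv/=; [exact|move=> + _].
Qed.

Section typical_gaps.
Context {R : realType} (v : {posnum R}) (r : {nonneg R}).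
Local Notation gaps := (seqs int (nat * bool)%type).

(** The law of large numbers holds with limit [c] on both sides of the origin. *)
Definition typical (c : R) : set gaps :=
  [set z | pos (spacing v r z) (Posz n) / n%:R @[n --> \oo] --> c] `&`
  [set z | - pos (spacing v r z) (Negz n) / n.+1%:R @[n --> \oo] --> c].

Lemma measurable_typical c : measurable (typical c).
Proof.
apply: measurableI; apply: measurable_cvg_set => n.
  by apply: measurable_funM => //; exact: measurable_pos.
apply: measurable_funM => //; apply: measurableT_comp => //.
exact: measurable_pos.
Qed.

Lemma cvg_ratio_unbounded (u : nat -> R) (c : R) : 0 < c ->
  u n / n.+1%:R @[n --> \oo] --> c -> forall M, exists n, M < u n.
Proof.
move=> c0 /cvgrPdist_lt uc M.
have c2 : 0 < c / 2 by rewrite divr_gt0.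
have [N _ NP] := uc _ c2.
pose n := maxn N (Num.truncn (`|M| / (c / 2))).
exists n; have := NP n (leq_maxl _ _); rewrite /= ltr_distlC => /andP[+ _].
rewrite ltr_pdivlMr// => /(le_lt_trans _); apply.
rewrite (_ : c - c / 2 = c / 2); last by lra.
rewrite (le_trans (ler_norm _))// mulrC -ler_pdivrMr//.
apply: ltW; apply: (lt_le_trans (truncnS_gt _)).
by rewrite ler_nat ltnS leq_maxr.
Qed.

Lemma typical_unbounded c z : 0 < c -> typical c z -> unbounded (spacing v r z).
Proof.
move=> c0 [zP zN]; split=> M.
  have [|n nP] := @cvg_ratio_unbounded (fun n => pos (spacing v r z) (Posz n.+1)) c c0 _ M.
    by move: zP; rewrite /= -(cvg_shiftS (fun n => pos _ (Posz n) / n%:R)).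
  by exists (Posz n.+1).
have [n nP] := @cvg_ratio_unbounded (fun n => - pos (spacing v r z) (Negz n)) c c0 zN (- M).
by exists (Negz n); move: nP; rewrite ltrN2.
Qed.

(** The shift of the index by 2 turns [x_(n - 1)] into ball [n + 1], with a
    positive label, and leaves out the divisions by 0. *)
Lemma typical_density c z x : 0 < c -> typical c z ->
  has_density (renewal v r (z, x)) c^-1.
Proof.
move=> c0 [zP _]; rewrite /has_density -(cvg_shiftn 2) /=.
have cE : c^-1 = (c * 1)^-1 by rewrite mulr1.
rewrite cE.
have E n : (n + 2)%:R /
    (x + pos (spacing v r z) ((n + 2)%:Z - 1) - (x + pos (spacing v r z) 0)) =
    (pos (spacing v r z) (Posz (n + 1)) / (n + 1)%:R *
      (1 - (n + 2)%:R^-1))^-1.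
  rewrite pos0 addr0 (addrC x) addrK (_ : (n + 2)%:Z - 1 = (n + 1)%:Z); last by lia.
  rewrite invfM invfM invrK [in RHS]mulrC.
  rewrite (_ : 1 - (n + 2)%:R^-1 = (n + 1)%:R / (n + 2)%:R); last first.
    rewrite (natrD _ n 2) (natrD _ n 1); field.
    by rewrite -natrD pnatr_eq0 addn2.
  have n1 : (n + 1)%:R != 0 :> R by rewrite addn1 pnatr_eq0.
  by rewrite invf_div mulrCA mulfVK// mulrC.
under eq_fun do rewrite E.
apply: cvgV; first by rewrite mulr1 gt_eqF.
apply: cvgM.
  by rewrite (cvg_shiftn 1 (fun n => pos (spacing v r z) (Posz n) / n%:R)).
rewrite -[X in _ --> X]subr0; apply: cvgB; first exact: cvg_cst.
have := @cvg_harmonic R; rewrite -(cvg_shiftn 1)/=.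
by under [in X in _ -> X]eq_fun do rewrite addn2 -addn1.
Qed.

End typical_gaps.

Section gap_strong_law.
Context {R : realType} (v : {posnum R}) (r : {nonneg R}).
Variables q a : R.
Hypothesis q01 : 0 <= q < 1.
Hypothesis a01 : 0 <= a <= 1.
Local Notation Omega := (seqs nat bool).
Local Notation coin := (coin R).
Local Notation mean := (q / (1 - q) + a).

Let G (w : Omega) : R := (geo q (even_uniform R w))%:R.
Let B (w : Omega) : R := (below (@odd_uniform R) a w)%:R.
Let X (w : Omega) : R := (occupancy (site q a w))%:R - mean.

Let XE w : X w = G w + B w - mean.
Proof. by rewrite /X/G/B /occupancy/= natrD. Qed.

Let mG : measurable_fun setT G.
Proof.
exact: (discrete_rv_measurable (fun n : nat => n%:R : R)
  (discrete_rv_geo (@measurable_even_uniform R) q01)).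
Qed.

Let mB : measurable_fun setT B.
Proof.
exact: (discrete_rv_measurable (fun b : bool => b%:R : R)
  (discrete_rv_below (@measurable_odd_uniform R) a)).
Qed.

Let mX : measurable_fun setT X.
Proof.
rewrite (_ : X = fun w => G w + B w - mean); last by apply/funext => w; exact: XE.
by apply: measurable_funB => //; exact: measurable_funD.
Qed.

Let mean_ge0 : 0 <= mean.
Proof.
have [/andP[q0 q1] /andP[a0 a1]] := (q01, a01).
by rewrite addr_ge0// divr_ge0// subr_ge0 ltW.
Qed.

Let intG4 : coin.-integrable setT (fun w => (G w ^+ 4)%:E).
Proof. exact: (integrable_geo_pow4 (@measurable_even_uniform R) (@even_uniform_law R) q01). Qed.

Let pow4_bound w i : (i <= 4)%N ->
  `|X w ^+ i| <= 8 * ((2 + mean) ^+ 4 + G w ^+ 4).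
Proof.
move=> i4; have G0 : 0 <= G w by [].
have [B0 B1] : 0 <= B w /\ B w <= 1 by rewrite /B; case: below.
have m0 := mean_ge0.
have X1 : 1 + `|X w| <= (2 + mean) + G w.
  rewrite XE; have : `|G w + B w - mean| <= G w + B w + mean.
    by rewrite (le_trans (ler_normB _ _))// (ger0_norm m0) ger0_norm ?addr_ge0.
  by lra.
have i1 : `|X w ^+ i| <= (1 + `|X w|) ^+ 4.
  rewrite normrX; apply: (@le_trans _ _ ((1 + `|X w|) ^+ i)).
    by rewrite lerXn2r ?nnegrE// ?addr_ge0// lerDr.
  by apply: ler_weXn2l => //; rewrite lerDl.
apply: (le_trans i1).
apply: (@le_trans _ _ ((2 + mean + G w) ^+ 4)).
  have X0 : 0 <= 1 + `|X w| by rewrite addr_ge0.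
  by rewrite lerXn2r// nnegrE (le_trans X0).
have sq (s t : R) : (s + t) ^+ 2 <= 2 * (s ^+ 2 + t ^+ 2).
  have := sqr_ge0 (s - t); rewrite !expr2; lra.
set s := 2 + mean; set t := G w.
rewrite !(exprM _ 2 2).
apply: (@le_trans _ _ ((2 * (s ^+ 2 + t ^+ 2)) ^+ 2)).
  by rewrite lerXn2r ?nnegrE ?sqr_ge0// mulr_ge0// addr_ge0// sqr_ge0.
by rewrite exprMn; have := sq (s ^+ 2) (t ^+ 2); lra.
Qed.

Let int_X i : (i <= 4)%N -> coin.-integrable setT (fun w => (X w ^+ i)%:E).
Proof.
move=> i4.
apply: (@le_integrable _ _ _ coin setT measurableT _
  (fun w => (8%:E * (((2 + mean) ^+ 4)%:E + (G w ^+ 4)%:E))%E)).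
- by apply/measurable_EFinP; exact: measurable_funX.
- move=> w _; rewrite -EFinD -EFinM !abse_EFin lee_fin.
  by rewrite (le_trans (pow4_bound w i4))// ler_norm.
- apply: integrableZl => //; apply: integrableD => //.
  exact: (@finite_measure_integrable_cst _ _ _ coin setT).
Qed.

Let int_pow1 : coin.-integrable setT (EFin \o G).
Proof.
apply: (@le_integrable _ _ _ coin setT measurableT _
  (fun w => (1%:E + (G w ^+ 4)%:E)%E)).
- exact/measurable_EFinP.
- move=> w _; rewrite -EFinD !abse_EFin lee_fin /G -natrX nat1r !normr_nat ler_nat.
  by case: (geo _ _) => // n; rewrite ltnW// ltnS -[X in (X <= _)%N]expn1 leq_pexp2l.
- apply: integrableD => //.
  exact: (@finite_measure_integrable_cst _ _ _ coin setT).
Qed.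

Let int_B : coin.-integrable setT (EFin \o B).
Proof.
apply: (@le_integrable _ _ _ coin setT measurableT _ (fun w => 1%:E)).
- exact/measurable_EFinP.
- by move=> w _; rewrite !abse_EFin lee_fin /B; case: below; rewrite ?normr0 normr1.
- exact: (@finite_measure_integrable_cst _ _ _ coin setT).
Qed.

Lemma integral_occupancy :
  (\int[coin]_w (occupancy (site q a w))%:R%:E = mean%:E)%E.
Proof.
transitivity (\int[coin]_w ((G w)%:E + (B w)%:E))%E.
  by apply: eq_integral => w _; rewrite -EFinD /G/B /occupancy/= natrD.
rewrite (integralD measurableT int_pow1 int_B) EFinD; congr (_ + _)%E.
  exact: (integral_geo (@measurable_even_uniform R) (@even_uniform_law R) q01).
rewrite -(uniform_lt (@odd_uniform_law R) a01).
have := @integral_indic _ _ _ coin setT measurableT _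
  (measurable_below (@measurable_odd_uniform R) a).
rewrite setIT => <-.
apply: eq_integral => w _; rewrite /= /B /below indicE; congr ((nat_of_bool _)%:R%:E).
by apply/idP/idP; rewrite inE.
Qed.

Let mean_X : (\int[coin]_w (X w)%:E)%E = 0%E.
Proof.
rewrite (_ : (\int[coin]_w _)%E =
    (\int[coin]_w ((occupancy (site q a w))%:R%:E - mean%:E))%E)//.
rewrite integralB//.
- rewrite integral_occupancy integral_cst//= probability_setT mule1.
  by rewrite subee.
- rewrite (_ : (fun w => _) = (fun w => ((G w)%:E + (B w)%:E)%E)).
    exact: integrableD.
  by apply/funext => w; rewrite -EFinD /G/B/occupancy/= natrD.
- exact: (@finite_measure_integrable_cst _ _ _ coin setT).
Qed.

(* The gaps to the right of ball 0 use the components of even rank: split off the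
   even bits, drop one component, and start again. The gaps to the left are the
   same variables at [odd_bits w]. *)
Let odd_odd (w : Omega) : Omega := odd_bits (odd_bits w).

Let measurable_odd_odd : measurable_fun setT odd_odd.
Proof. by apply: measurableT_comp. Qed.

HB.instance Definition _ :=
  isMeasurableFun.Build _ _ _ _ odd_odd measurable_odd_odd.

Let odd_odd_splits : splits coin even_bits odd_odd.
Proof.
move=> A A' mA mA'.
have mo : measurable (odd_bits @^-1` A' : set Omega) by exact: measurable_funPTI.
rewrite -(split_snd (coin_splits R) mA'); exact: (coin_splits R mA mo).
Qed.

Let walkE n w : walk even_bits odd_odd X n w =
  \sum_(0 <= j < n) X (component even_bits odd_bits j.*2 w).
Proof.
elim: n w => [|n IH] w; first by rewrite big_geq.
rewrite big_nat_recl//= IH; congr (_ + _); apply: eq_bigr => j _.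
by rewrite /component /odd_odd -!iterSr.
Qed.

Let c := 2 * r%:num + v%:num * mean.
Let z_ (w : Omega) : seqs int (nat * bool)%type :=
  iid_seq even_bits odd_bits (site q a) w.

Let spacingE w i : spacing v r (z_ w) i =
  c + v%:num * X (component even_bits odd_bits (int_rank i) w).
Proof. by rewrite /spacing /z_ /iid_seq /c /X; ring. Qed.

Let avg (w : Omega) n :
  (\sum_(0 <= j < n.+1) (c + v%:num * X (component even_bits odd_bits j.*2 w)))
    / n.+1%:R =
  c + v%:num * (walk even_bits odd_odd X n.+1 w / n.+1%:R).
Proof.
rewrite walkE big_split/= -mulr_sumr sumr_const_nat subn0 mulrDl mulrA.
by rewrite -(mulr_natr c) mulfK// pnatr_eq0.
Qed.

Let cvg_avg (w : Omega) : walk even_bits odd_odd X n w / n%:R @[n --> \oo] --> 0 ->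
  (\sum_(0 <= j < n.+1) (c + v%:num * X (component even_bits odd_bits j.*2 w)))
    / n.+1%:R @[n --> \oo] --> c.
Proof.
rewrite -(cvg_shiftS (fun n => walk even_bits odd_odd X n w / n%:R)) => wP.
under eq_fun do rewrite avg.
rewrite (_ : nbhs c = nbhs (c + v%:num * 0)); last by rewrite mulr0 addr0.
by apply: cvgD; [exact: cvg_cst|apply: cvgM => //; exact: cvg_cst].
Qed.

(** The strong law applies to the centred gaps on both sides. *)
Lemma gap_law_typical : gap_law a q01 (typical v r c) = 1%E.
Proof.
have mt := @measurable_typical _ v r c.
rewrite iid_lawE.
pose L := [set w | walk even_bits odd_odd X n w / n%:R @[n --> \oo] --> 0].
have mL : measurable L.
  apply: measurable_cvg_set => n; apply: measurable_funM => //.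
  exact: (measurable_walk odd_odd_splits int_X).
have L1 : coin L = 1%E.
  rewrite -[L]setCK probability_setC; last exact: measurableC.
  rewrite [X in (_ - X)%E](_ : _ = 0%E) ?sube0//.
  apply: measure_negligible; first exact: measurableC.
  exact: (strong_law odd_odd_splits int_X mean_X).
have mL' : measurable (odd_bits @^-1` L : set Omega) by exact: measurable_funPTI.
have L'1 : coin (odd_bits @^-1` L) = 1%E by rewrite (split_snd (coin_splits R) mL).
have L0 : coin (~` L) = 0%E by rewrite (probability_setC coin mL) L1 subee.
have L'0 : coin (~` (odd_bits @^-1` L)) = 0%E.
  by rewrite (probability_setC coin mL') L'1 subee.
have sub : L `&` odd_bits @^-1` L `<=`
    iid_seq even_bits odd_bits (site q a) @^-1` typical v r c.
  move=> w [Lw L'w]; split=> /=.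
    rewrite -(cvg_shiftS (fun n => pos _ (Posz n) / n%:R)).
    have := cvg_avg Lw; apply: cvg_trans; apply: near_eq_cvg; apply: nearW => n /=.
    by congr (_ / _); apply: eq_bigr => j _; rewrite spacingE.
  have := cvg_avg L'w; apply: cvg_trans; apply: near_eq_cvg; apply: nearW => n /=.
  rewrite opprK; congr (_ / _); apply: eq_bigr => j _.
  by rewrite spacingE /component -iterSr.
have mz : measurable (iid_seq even_bits odd_bits (site q a) @^-1` typical v r c).
  rewrite -[X in measurable X]setTI.
  by apply: measurable_iid_seq => //; exact: discrete_rv_site.
apply/eqP; rewrite eq_le; apply/andP; split.
  exact: probability_le1.
rewrite -[X in (X <= _)%E](_ : coin (L `&` odd_bits @^-1` L) = 1%E).
  apply: le_measure; rewrite ?inE//; exact: measurableI.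
rewrite -[_ `&` _]setCK setCI probability_setC; last first.
  by apply: measurableU; exact: measurableC.
rewrite [X in (_ - X)%E](_ : _ = 0%E) ?sube0//.
apply: null_set_setU; [exact: measurableC|exact: measurableC|exact: L0|exact: L'0].
Qed.

End gap_strong_law.

(** * The stationary measure *)

Section product_of_preserving.
Context d1 d2 (Y1 : measurableType d1) (Y2 : measurableType d2) (R : realType).
Variables (m1 : probability Y1 R) (m2 : probability Y2 R).
Variables (t1 : {mfun Y1 >-> Y1}) (t2 : {mfun Y2 >-> Y2}).
Hypothesis t1_preserves : forall A, measurable A -> m1 (t1 @^-1` A) = m1 A.
Hypothesis t2_preserves : forall A, measurable A -> m2 (t2 @^-1` A) = m2 A.

Definition both (y : Y1 * Y2) : Y1 * Y2 := (t1 y.1, t2 y.2).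

Lemma measurable_both : measurable_fun setT both.
Proof. by apply: measurable_fun_pair; exact: measurableT_comp. Qed.

Lemma both_preserves A : measurable A ->
  (m1 \x m2)%E (both @^-1` A) = (m1 \x m2)%E A.
Proof.
move=> mA; rewrite /product_measure1 /=.
transitivity (\int[m1]_y m2 (xsection A (t1 y)))%E.
  apply: eq_integral => y _ /=.
  rewrite -(t2_preserves (measurable_xsection (t1 y) mA)).
  by congr (m2 _); apply/seteqP; split=> x /=; rewrite /xsection/= !inE.
transitivity (\int[pushforward m1 t1]_y m2 (xsection A y))%E.
  rewrite ge0_integral_pushforward//.
  exact: measurable_fun_xsection.
by apply: eq_measure_integral => B mB _; exact: t1_preserves.
Qed.

End product_of_preserving.

Lemma exchange_sections d1 d2 (Y1 : measurableType d1) (Y2 : measurableType d2)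
    (R : realType) (m1 : {sigma_finite_measure set Y1 -> \bar R})
    (m2 : {sigma_finite_measure set Y2 -> \bar R}) (E : set (Y1 * Y2)) :
  measurable E ->
  (\int[m1]_x m2 (xsection E x) = \int[m2]_y m1 (ysection E y))%E.
Proof.
move=> mE; have := indic_fubini_tonelli m1 m2 mE.
by rewrite indic_fubini_tonelli_FE// indic_fubini_tonelli_GE.
Qed.

(** Tonelli; the noise [m3] is integrated first on the left, while on the right it
    is grouped with the gaps [m1], since the step acts on both. *)
Lemma tonelli3 d1 d2 d3 (Y1 : measurableType d1) (Y2 : measurableType d2)
    (Y3 : measurableType d3) (R : realType) (m1 : probability Y1 R)
    (m2 : {sigma_finite_measure set Y2 -> \bar R}) (m3 : probability Y3 R)
    (D : set ((Y1 * Y3) * Y2)) : measurable D ->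
  (\int[m1 \x m2]_y m3 [set w | D ((y.1, w), y.2)])%E =
  ((m1 \x m3) \x m2)%E D.
Proof.
move=> mD.
have mperm : measurable_fun setT (fun t : (Y1 * Y2) * Y3 => ((t.1.1, t.2), t.1.2)).
  apply: measurable_fun_pair; last exact: measurableT_comp.
  by apply: measurable_fun_pair => //; exact: measurableT_comp.
have mD' : measurable [set t : (Y1 * Y2) * Y3 | D ((t.1.1, t.2), t.1.2)].
  by rewrite -[X in measurable X]setTI; exact: mperm.
have msec := measurable_fun_xsection m3 mD'.
transitivity (\int[m1 \x m2]_y
    (m3 \o xsection [set t | D ((t.1.1, t.2), t.1.2)]) y)%E.
  apply: eq_integral => y _; rewrite /=; congr (m3 _).
  by apply/seteqP; split=> w; rewrite /xsection/= inE.
rewrite fubini_tonelli1//.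
transitivity (\int[m1 \x m3]_y m2 (xsection D y))%E; last by [].
rewrite fubini_tonelli1//; last exact: measurable_fun_xsection.
apply: eq_integral => z _; rewrite /fubini_F.
have mDz : measurable [set t : Y3 * Y2 | D ((z, t.1), t.2)].
  rewrite -[X in measurable X]setTI.
  have : measurable_fun setT (fun t : Y3 * Y2 => ((z, t.1), t.2)).
    by apply: measurable_fun_pair => //; apply: measurable_fun_pair.
  by move=> mg; exact: mg.
have := exchange_sections m3 m2 mDz => E.
transitivity (\int[m2]_x m3 (ysection [set t : Y3 * Y2 | D ((z, t.1), t.2)] x))%E.
  by apply: eq_integral => x _; rewrite /=; congr (m3 _).
by rewrite -E; apply: eq_integral => w _; congr (m2 _).
Qed.

Lemma integral_scaled_restriction d (T : measurableType d) (R : realType)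
    (m : {measure set T -> \bar R}) (D : set T) (mD : measurable D)
    (k : {nonneg R}) (f : T -> \bar R) :
  measurable_fun setT f -> (forall x, 0 <= f x)%E ->
  (\int[mscale k (mrestr m mD)]_x f x = k%:num%:E * \int[m]_(x in D) f x)%E.
Proof.
move=> mf f0; rewrite ge0_integral_mscale//; congr (_ * _)%E.
rewrite -(setUv D) ge0_integral_setU//=; last 3 first.
- exact: measurableC.
- by rewrite setUv.
- by apply/disj_setPS => x [].
rewrite [X in (_ + X)%E]null_set_integral ?adde0; last 3 first.
- exact: measurableC.
- exact: measurable_funTS.
- by rewrite /= /mrestr setICl measure0.
by apply: eq_measure_integral => A mA AD; rewrite /= /mrestr setIidl.
Qed.

Section palm.
Context {R : realType} (v : {posnum R}) (r : {nonneg R}).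
Local Notation gaps := (seqs int (nat * bool)%type).
Local Notation leb := (@lebesgue_measure R).
Local Notation renewal := (renewal v r).

(** Ball 1 is the first ball that is not on the left of the origin. *)
Definition straddles (y : config r) : Prop := y 0 < 0 <= y 1.

Lemma measurable_straddles : measurable [set y | straddles y].
Proof.
rewrite (_ : [set y | _] = (fun y : config r => y 0 : R) @^-1` `]-oo, 0[ `&`
  (fun y : config r => y 1 : R) @^-1` `[0, +oo[); last first.
  by apply/seteqP; split=> y; rewrite /straddles/= !in_itv/= andbT;
    [move/andP|move=> [-> ->]].
by apply: measurableI; rewrite -[X in measurable X]setTI;
  apply: measurable_center => //; exact: measurable_itv.
Qed.

Definition palm_window : set (gaps * measurableTypeR R) :=
  [set zx | straddles (renewal zx)].

Lemma measurable_palm_window : measurable palm_window.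
Proof.
rewrite -[X in measurable X]setTI; apply: measurable_renewal => //.
exact: measurable_straddles.
Qed.

Lemma renewal0 zx : renewal zx 0 = zx.2.
Proof. by have := pos0 (spacing v r zx.1) => /= ->; rewrite addr0. Qed.

Lemma renewal1 zx : renewal zx 1 = zx.2 + spacing v r zx.1 0.
Proof.
have := posS (spacing v r zx.1) 0; rewrite pos0 !add0r => E.
by rewrite -[LHS]/(zx.2 + pos (spacing v r zx.1) 1) E.
Qed.

Lemma palm_windowE zx :
  palm_window zx = (- spacing v r zx.1 0 <= zx.2 < 0) :> Prop.
Proof.
rewrite /palm_window /straddles /mkset renewal0 renewal1.
apply/propext; split=> /andP[A B]; apply/andP; split=> //.
  by rewrite -subr_ge0 opprK.
by rewrite -[spacing _ _ _ _]opprK subr_ge0.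
Qed.

Variables (Gamma : probability gaps R) (c : R).
Hypothesis c_gt0 : 0 < c.
Hypothesis mean_spacing : (\int[Gamma]_z (spacing v r z 0)%:E = c%:E)%E.

(** For given gaps, ball 0 ranges over an interval on the left of the origin, of
    the length of the gap that follows it. *)
Lemma palm_window_mass : (Gamma \x leb)%E palm_window = c%:E.
Proof.
rewrite -mean_spacing; apply: eq_integral => z _ /=.
rewrite (_ : xsection _ _ = `[- spacing v r z 0, 0[%classic); last first.
  apply/seteqP; split=> x; rewrite /xsection/= inE palm_windowE/= in_itv//.
rewrite lebesgue_measure_itv/= lte_fin oppr_lt0.
have := spacing_ge0 v r z 0; rewrite le_eqVlt => /predU1P[<-|->].
  by rewrite ltxx.
by rewrite -EFinB sub0r opprK.
Qed.

Let c_inv_ge0 : 0 <= c^-1. Proof. by rewrite invr_ge0 ltW. Qed.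

(** The inverse Palm construction: in the independent gaps, the one that contains
    the origin is weighted by its length. *)
Definition palm :=
  mscale (NngNum c_inv_ge0) (mrestr (Gamma \x leb)%E measurable_palm_window).

Definition indistinct (zx : gaps * measurableTypeR R) : uconfig r :=
  \pi_(uconfig r) (renewal zx).

Lemma measurable_indistinct : measurable_fun setT indistinct.
Proof.
apply: measurableT_comp; first exact: measurable_pi.
exact: measurable_renewal.
Qed.

HB.instance Definition _ :=
  isMeasurableFun.Build _ _ _ _ indistinct measurable_indistinct.

HB.instance Definition _ := Measure.on palm.

Lemma palmE A :
  palm A = (c^-1%:E * (Gamma \x leb)%E (A `&` palm_window))%E.
Proof. by []. Qed.

Let palm_setT : palm setT = 1%E.
Proof. by rewrite palmE setTI palm_window_mass -EFinM mulVf// gt_eqF. Qed.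

HB.instance Definition _ := Measure_isProbability.Build _ _ _ palm palm_setT.

Definition stationary : probability (uconfig r) R :=
  distribution palm indistinct.

Lemma stationaryE B : stationary B = (c^-1%:E *
  (Gamma \x leb)%E (indistinct @^-1` B `&` palm_window))%E.
Proof. by []. Qed.

Lemma integral_stationary (f : uconfig r -> \bar R) : measurable_fun setT f ->
  (forall x, 0 <= f x)%E ->
  (\int[stationary]_q f q = c^-1%:E * \int[(Gamma \x leb)]_(zx in palm_window)
     f (indistinct zx))%E.
Proof.
move=> mf f0; have mfi : measurable_fun setT (f \o indistinct) by exact: measurableT_comp.
rewrite ge0_integral_distribution//.
exact: (integral_scaled_restriction (Gamma \x leb)%E measurable_palm_window
  (NngNum c_inv_ge0) mfi (fun x => f0 (indistinct x))).
Qed.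

End palm.

Section invariance.
Context {R : realType} (v : {posnum R}) (r : {nonneg R}).
Local Notation gaps := (seqs int (nat * bool)%type).
Local Notation leb := (@lebesgue_measure R).
Local Notation noise := (seqs int bool).

Variables q a p c : R.
Hypothesis q01 : 0 <= q < 1.
Hypothesis a01 : 0 <= a <= 1.
Hypothesis p01 : 0 <= p <= 1.
Hypothesis balance : p * (1 - a) * q = (1 - p) * a.
Variables (Gamma : probability gaps R) (Pi : probability noise R).
Hypothesis Gamma_iid : is_iid (site_mass q a) Gamma.
Hypothesis Pi_iid : is_iid (bernoulli_mass p) Pi.
Hypothesis c_gt0 : 0 < c.
Hypothesis Gamma_typical : Gamma (typical v r c) = 1%E.

Local Notation labelled := ((gaps * noise) * measurableTypeR R)%type.
Local Notation M := ((Gamma \x Pi) \x leb)%E.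

(** Gaps, noise and position seen from ball [k]. *)
Let tau (k : int) : labelled -> labelled :=
  skew_map (both (shift_seq k) (shift_seq k))
    (fun zw : gaps * noise => pos (spacing v r zw.1) k).

(** The step: new gaps, and the move of ball 0. *)
Let sigma : labelled -> gaps * measurableTypeR R :=
  skew_map evolve (fun zw : gaps * noise => v%:num * (departs zw 0)%:R).

Let before (y : labelled) : config r := renewal v r (y.1.1, y.2).
Let after (y : labelled) : config r := renewal v r (sigma y).

Let after_step y : after y = step v (before y) (jumpers y.1.2).
Proof. by rewrite /before step_renewal; case: y => [[]]. Qed.

Let before_tau k y : before (tau k y) = relabelled k (before y).
Proof. by rewrite /before -renewal_shift. Qed.

Let after_tau k y : after (tau k y) = relabelled k (after y).
Proof. by rewrite !after_step before_tau -step_relabelled. Qed.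

Let m_pos k : measurable_fun setT (fun zw : gaps * noise => pos (spacing v r zw.1) k).
Proof. exact: measurableT_comp (measurable_pos v r k) measurable_fst. Qed.

Let m_departs : measurable_fun setT
  (fun zw : gaps * noise => v%:num * (departs zw 0)%:R : R).
Proof.
exact: (discrete_rv_measurable (fun b : bool => v%:num * b%:R : R)
  (discrete_rv_departs 0)).
Qed.

Let measurable_tau k : measurable_fun setT (tau k).
Proof. by apply: measurable_skew => //; exact: measurable_both. Qed.

Let measurable_sigma : measurable_fun setT sigma.
Proof. by apply: measurable_skew => //; exact: measurable_evolve. Qed.

Let measurable_before : measurable_fun setT before.
Proof.
apply: measurableT_comp; first exact: measurable_renewal.
apply: measurable_fun_pair.
  exact: measurableT_comp.
exact: (@measurable_snd _ _ (gaps * noise)%type (measurableTypeR R)).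
Qed.

Let measurable_after : measurable_fun setT after.
Proof. by apply: measurableT_comp => //; exact: measurable_renewal. Qed.

Let tauN k y : tau k (tau (- k) y) = y.
Proof.
case: y => [[z w] x]; rewrite /tau /skew_map /both /=; congr ((_, _), _).
- by apply/funext => i; rewrite /shift_seq addrK.
- by apply/funext => i; rewrite /shift_seq addrK.
rewrite (_ : pos (spacing v r (shift_seq (- k) z)) k =
    pos (fun j => spacing v r z (j - k)) k)//.
by rewrite pos_shift subrr pos0 sub0r addrK.
Qed.

Let tau_preserves k A : measurable A -> M (tau k @^-1` A) = M A.
Proof.
apply: skew_preserves => //; first exact: measurable_both.
move=> B mB; apply: both_preserves => // C mC.
  exact: (is_iid_shift k Gamma_iid mC).
exact: (is_iid_shift k Pi_iid mC).
Qed.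

Let sigma_law A : measurable A -> M (sigma @^-1` A) = (Gamma \x leb)%E A.
Proof.
apply: skew_preserves => //; first exact: measurable_evolve.
by move=> B mB; exact: (gap_law_stationary q01 a01 p01 balance Gamma_iid Pi_iid).
Qed.

Let N : set labelled := [set y | ~ typical v r c y.1.1].

Let mN : measurable N.
Proof.
rewrite (_ : N = (fun y : labelled => y.1.1) @^-1` ~` typical v r c)//.
rewrite -[X in measurable X]setTI.
have mf : measurable_fun setT (fun y : labelled => y.1.1).
  exact: measurableT_comp.
by apply: mf => //; apply: measurableC; exact: measurable_typical.
Qed.

Let N_null : M N = 0%E.
Proof.
have mT := measurable_typical v r c.
have T0 : Gamma (~` typical v r c) = 0%E.
  by rewrite probability_setC// Gamma_typical subee.
have -> : N = (~` typical v r c `*` setT) `*` setT.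
  by apply/seteqP; split=> y /=; [|move=> [[]]].
have mC : measurable (~` typical v r c) by exact: measurableC.
have C0 : (Gamma \x Pi)%E (~` typical v r c `*` setT) = 0%E.
  transitivity (Gamma (~` typical v r c) * Pi setT)%E.
    exact: product_measure1E.
  by rewrite T0 mul0e.
rewrite product_measure1E//; last exact: measurableX.
by rewrite -[X in (X * _)%E]/((Gamma \x Pi)%E _) C0 mul0e.
Qed.

Let renewal_once (y : config r) l x : (forall i, y i = x + pos l i) ->
  (forall i, 0 <= l i) -> unbounded l ->
  exists k, forall j, straddles (relabelled j y) <-> j = k.
Proof.
move=> yE l0 ul; have [k kP] := crosses_once x l0 ul; exists k => j.
by rewrite -kP /straddles /= !yE add0r (addrC 1).
Qed.

Let once y : ~ N y ->
  meets_once tau (before @^-1` straddles (r := r)) y /\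
  meets_once tau (after @^-1` straddles (r := r)) y.
Proof.
move=> /contrapT /(typical_unbounded c_gt0) uy; split.
  have [|k kP] := @renewal_once (before y) _ y.2 (fun i => erefl) _ uy.
    exact: spacing_ge0.
  by exists k => j; rewrite -kP /= before_tau.
have [||k kP] := @renewal_once (after y) _ _ (fun i => erefl).
- exact: spacing_ge0.
- exact: unbounded_evolve.
by exists k => j; rewrite -kP /= after_tau.
Qed.

(** The window can be imposed after the step instead of before it; then the step
    maps the measure to the product measure again. *)
Lemma palm_exchange (B : set (uconfig r)) : measurable B ->
  M [set y | straddles (before y) /\ B (\pi_(uconfig r) (after y))] =
  (Gamma \x leb)%E (indistinct v r @^-1` B `&` palm_window v r).
Proof.
move=> mB.
have mS := @measurable_straddles R r.
have mB' : measurable [set y : labelled | B (\pi_(uconfig r) (after y))].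
  rewrite -[X in measurable X]setTI.
  have mf : measurable_fun setT (fun y => \pi_(uconfig r) (after y)).
    by apply: measurableT_comp => //; exact: measurable_pi.
  exact: mf.
rewrite (_ : [set y | _ /\ _] = before @^-1` straddles (r := r) `&`
  [set y : labelled | B (\pi_(uconfig r) (after y))])//.
rewrite (@fundamental_domain_exchange _ _ _ M tau N _
  (after @^-1` straddles (r := r)))//.
- rewrite -sigma_law.
    by rewrite setIC.
  apply: measurableI; last exact: measurable_palm_window.
  by rewrite -[X in measurable X]setTI; exact: measurable_indistinct.
- by rewrite -[X in measurable X]setTI; exact: measurable_before.
- by rewrite -[X in measurable X]setTI; exact: measurable_after.
- by move=> k; apply/seteqP; split=> y /=; rewrite after_tau pi_relabelled.
Qed.

Hypothesis mean_spacing : (\int[Gamma]_z (spacing v r z 0)%:E = c%:E)%E.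

(** The integral of the kernel is the measure of gaps, noise and position for which
    the window holds before the step: exchange the windows. *)
Theorem stationary_invariant :
  invariant_measure v p (stationary c_gt0 mean_spacing).
Proof.
pose K : R.-pker config r ~> config r := @step_kernel R v r Pi.
have K_relabelled := @step_kernel_relabelled R v r Pi p Pi_iid.
have [Q KQ] := exists_quotient_kernel (K := K) K_relabelled.
exists K, Q; split => //; first exact: step_kernel_transition.
move=> B mB; rewrite integral_stationary//; last first.
  exact: (measurable_kernel Q B mB).
rewrite stationaryE -palm_exchange//; congr (_ * _)%E.
have mD : measurable
    [set y | straddles (before y) /\ B (\pi_(uconfig r) (after y))].
  apply: measurableI.
    rewrite -[X in measurable X]setTI.
    by apply: measurable_before => //; exact: measurable_straddles.
  rewrite -[X in measurable X]setTI.
  have mf : measurable_fun setT (fun y => \pi_(uconfig r) (after y)).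
    by apply: measurableT_comp => //; exact: measurable_pi.
  exact: mf.
rewrite -tonelli3// [LHS]integral_mkcond; apply: eq_integral => -[z x] _.
rewrite patchE; case: ifPn => [/set_mem zx|/negP zx].
  rewrite KQ// step_kernelE.
  congr (Pi _); apply/seteqP; split=> w /=.
    by rewrite after_step.
  by rewrite after_step => -[].
rewrite (_ : [set w | _] = set0) ?measure0//.
apply/seteqP; split=> w //= -[+ _] => zx'; apply: zx; exact: mem_set.
Qed.

End invariance.

(** * Atoms and density *)

Section properties.
Context {R : realType} (v : {posnum R}) (r : {nonneg R}).
Local Notation gaps := (seqs int (nat * bool)%type).
Local Notation leb := (@lebesgue_measure R).
Variables (Gamma : probability gaps R) (c : R).
Hypothesis c_gt0 : 0 < c.
Hypothesis mean_spacing : (\int[Gamma]_z (spacing v r z 0)%:E = c%:E)%E.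
Local Notation mu := (stationary c_gt0 mean_spacing).

(** A configuration in the class of [y] has its ball 0 at one of the countably
    many balls of [y]. *)
Lemma stationary_nonatomic : nonatomic mu.
Proof.
move=> y; rewrite stationaryE; apply/eqP; rewrite mule_eq0; apply/orP; right.
apply/eqP; rewrite /product_measure1; apply: integral0_eq => z _ /=.
apply: countable_lebesgue_measure0.
apply: (@sub_countable _ _ _ (range (fun i : int => (repr y : config r) i : R))).
  apply: subset_card_le => x; rewrite /xsection/= inE => -[/= yE _].
  have /pi_eqP[k kE] : \pi_(uconfig r) (repr y) = \pi_(uconfig r) (renewal v r (z, x)).
    by rewrite reprK -yE.
  exists k => //; have : renewal v r (z, x) 0 = relabelled k (repr y) 0 by rewrite kE.
  by rewrite renewal0/= add0r.
by apply: (sub_countable (card_image_le _ _)); exact: countableP.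
Qed.

(** Inverted, so that the events are limits of linear functions of the balls. *)
Lemma has_densityE (x : config r) (rho : R) : rho != 0 ->
  has_density x rho <->
  (x (n%:Z - 1) - x 0) / n%:R @[n --> \oo] --> rho^-1.
Proof.
move=> rho0; split=> [dx|dx].
  under eq_fun do rewrite -invf_div.
  exact: cvgV.
rewrite -[rho]invrK /has_density; under eq_fun do rewrite -invf_div.
by apply: cvgV => //; rewrite invr_neq0.
Qed.

Lemma measurable_has_density (rho : R) : rho != 0 ->
  measurable [set x : config r | has_density x rho].
Proof.
move=> rho0; rewrite (_ : [set x : config r | _] =
    [set x : config r | (x (n%:Z - 1) - x 0) / n%:R @[n --> \oo] --> rho^-1]).
  apply: measurable_cvg_set => n; apply: measurable_funM => //.
  by apply: measurable_funB; exact: measurable_center.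
by apply/seteqP; split=> x /(has_densityE _ rho0).
Qed.

Lemma density_setE (rho : R) : \pi_(uconfig r) @^-1` density_set r rho =
  \bigcup_k relabelled (int_unrank k) @^-1` [set x : config r | has_density x rho].
Proof.
apply/seteqP; split=> x /=.
  move=> [y dy /esym/pi_eqP[k kE]]; exists (int_rank k) => //=.
  by rewrite int_rankK -kE.
by move=> [k _ dx]; exists (relabelled (int_unrank k) x) => //; exact: pi_relabelled.
Qed.

Lemma measurable_density_set (rho : R) : rho != 0 ->
  measurable (density_set r rho).
Proof.
move=> rho0; apply/measurable_preimage_pi; rewrite density_setE.
apply: bigcupT_measurable => k; rewrite -[X in measurable X]setTI.
by apply: measurable_relabelled => //; exact: measurable_has_density.
Qed.

Hypothesis Gamma_typical : Gamma (typical v r c) = 1%E.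

(** Typical gaps have full measure and give the density. *)
Lemma stationary_density : mu (density_set r c^-1) = 1%E.
Proof.
have mD : measurable (density_set r c^-1).
  by apply: measurable_density_set; rewrite invr_neq0// gt_eqF.
have mT := measurable_typical v r c.
rewrite -[density_set _ _]setCK probability_setC; last exact: measurableC.
rewrite [X in (_ - X)%E](_ : _ = 0%E) ?sube0//.
rewrite stationaryE; apply/eqP; rewrite mule_eq0; apply/orP; right.
rewrite eq_le measure_ge0 andbT.
have T0 : Gamma (~` typical v r c) = 0%E.
  by rewrite (probability_setC Gamma mT) Gamma_typical subee.
have N0 : (Gamma \x leb)%E (~` typical v r c `*` setT) = 0%E.
  transitivity (Gamma (~` typical v r c) * leb setT)%E; last by rewrite T0 mul0e.
  by apply: product_measure1E => //; exact: measurableC.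
rewrite -N0; apply: le_measure; rewrite ?inE.
- apply: measurableI; last exact: measurable_palm_window.
  rewrite -[X in measurable X]setTI.
  by apply: measurable_indistinct => //; exact: measurableC.
- by apply: measurableX => //; exact: measurableC.
move=> [z x] [/= nd _]; split=> //= tz; apply: nd.
by exists (renewal v r (z, x)) => //; exact: typical_density.
Qed.

End properties.

(** * Continuity in the jump probability *)

Section coupling.
Context {R : realType} (v : {posnum R}) (r : {nonneg R}).
Local Notation Omega := (seqs nat bool).
Local Notation coin := (coin R).
Local Notation gaps := (seqs int (nat * bool)%type).
Local Notation leb := (@lebesgue_measure R).
Local Notation component := (component even_bits odd_bits).

Lemma component_law k (A : set Omega) : measurable A ->
  coin (component k @^-1` A) = coin A.
Proof.
move=> mA; rewrite -[RHS](split_fst (coin_splits R) mA).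
have iter_law n (B : set Omega) : measurable B ->
    coin (iter n odd_bits @^-1` B) = coin B.
  elim: n B => [|n IH] B mB //.
  rewrite -[RHS](split_snd (coin_splits R) mB) -[RHS]IH//.
  exact: measurable_funPTI.
have mB : measurable (even_bits @^-1` A : set Omega) by exact: measurable_funPTI.
exact: (iter_law k _ mB).
Qed.

(** The gaps for all parameters at once, from the same coin tosses. *)
Definition coupled_gaps (q a : R) (w : Omega) : gaps :=
  iid_seq even_bits odd_bits (site q a) w.

Lemma measurable_coupled_gaps q a : 0 <= q < 1 ->
  measurable_fun setT (coupled_gaps q a).
Proof. by move=> q01; apply: measurable_iid_seq; exact: discrete_rv_site. Qed.

Lemma integral_constant d (T : measurableType d) (P : probability T R) (x : R) :
  (\int[P]_w x%:E = x%:E)%E.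
Proof. by have := expectation_cst P x; rewrite unlock. Qed.

Lemma mean_spacing_gap_law q a (q01 : 0 <= q < 1) (a01 : 0 <= a <= 1) :
  (\int[gap_law a q01]_z (spacing v r z 0)%:E =
   (2 * r%:num + v%:num * (q / (1 - q) + a))%:E)%E.
Proof.
rewrite [LHS](ge0_integral_distribution); last 2 first.
- apply/measurable_EFinP; exact: (measurable_spacing v r 0).
- by move=> z; rewrite lee_fin spacing_ge0.
rewrite (_ : (\int[_]_x _)%E = (\int[coin]_w
    ((2 * r%:num)%:E + v%:num%:E * (occupancy (site q a (even_bits w)))%:R%:E))%E)//.
pose occ w : \bar R := (occupancy (site q a w))%:R%:E.
have mocc : measurable_fun setT occ.
  apply/measurable_EFinP.
  exact: (discrete_rv_measurable (fun s => (occupancy s)%:R : R)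
    (discrete_rv_site a q01)).
have mocc' : measurable_fun setT (occ \o even_bits) by exact: measurableT_comp.
rewrite ge0_integralD//; last exact: measurable_funeM.
have even_occ : (\int[coin]_w (occ \o even_bits) w = (q / (1 - q) + a)%:E)%E.
  rewrite -(integral_occupancy q01 a01).
  transitivity (\int[distribution coin even_bits]_w occ w)%E.
    by apply/esym/ge0_integral_distribution => // w; rewrite /occ lee_fin.
  by apply: eq_measure_integral => A mA _; exact: (split_fst (coin_splits R) mA).
rewrite integral_constant ge0_integralZl// -/(occ \o even_bits).
by rewrite [X in (_ + _ * X)%E]even_occ.
Qed.

(** The translation is trivial; the form of [skew_map] gives the law of the
    pair. *)
Definition couple (q a : R) :
    Omega * measurableTypeR R -> gaps * measurableTypeR R :=
  skew_map (coupled_gaps q a) (fun=> 0).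

Lemma measurable_couple q a : 0 <= q < 1 -> measurable_fun setT (couple q a).
Proof. by move=> q01; apply: measurable_skew => //; exact: measurable_coupled_gaps. Qed.

Lemma couple_law q a (q01 : 0 <= q < 1) A : measurable A ->
  (coin \x leb)%E (couple q a @^-1` A) = (gap_law a q01 \x leb)%E A.
Proof. by apply: skew_preserves => //; exact: measurable_coupled_gaps. Qed.

Section integrand.
Variable f : uconfig r -> R.
Hypothesis cf : continuous f.

Definition integrand : gaps * measurableTypeR R -> \bar R :=
  (fun zx => (f (indistinct v r zx))%:E) \_ (palm_window v r).

Lemma measurable_integrand : measurable_fun setT integrand.
Proof.
apply: (measurable_restrictT _ (measurable_palm_window v r)).1.
apply: measurable_funTS; apply/measurable_EFinP.
apply: measurableT_comp; last exact: measurable_indistinct.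
exact: continuous_measurable_uconfig.
Qed.

Lemma integral_couple q a (q01 : 0 <= q < 1) (c : R) (c_gt0 : 0 < c)
    (mean_spacing : (\int[gap_law a q01]_z (spacing v r z 0)%:E = c%:E)%E) :
  (forall x, 0 <= f x) ->
  (\int[stationary c_gt0 mean_spacing]_x (f x)%:E =
   c^-1%:E * \int[(coin \x leb)]_y integrand (couple q a y))%E.
Proof.
move=> f0; rewrite integral_stationary//; last first.
  apply/measurable_EFinP; exact: continuous_measurable_uconfig.
congr (_ * _)%E; rewrite integral_mkcond.
have mc := measurable_couple a q01.
transitivity (\int[pushforward (coin \x leb) (couple q a)]_zx integrand zx)%E.
  by apply: eq_measure_integral => A mA _; exact/esym/(couple_law a q01 mA).
rewrite ge0_integral_pushforward//; first exact: measurable_integrand.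
by move=> zx _; rewrite /integrand patchE; case: ifP; rewrite // lee_fin.
Qed.

End integrand.

(** Some uniform variable lies at a jump of a quantile function. *)
Definition irregular (q a : R) : set Omega :=
  \bigcup_k (\bigcup_j [set w | even_uniform R (component k w) = q ^+ j.+1] `|`
    [set w | odd_uniform R (component k w) = a]).

Lemma negligible_irregular q a : coin.-negligible (irregular q a).
Proof.
have null k (U : Omega -> R) (mU : measurable_fun setT U)
    (U_law : forall A : set R, measurable A -> coin (U @^-1` A) =
      leb ((A : set (measurableTypeR R)) `&` `[0, 1[%classic)) x :
    coin.-negligible [set w | U (component k w) = x].
  have mUx : measurable [set w | U w = x].
    rewrite -[X in measurable X]setTI; exact: (mU _ [set x]).
  exists (component k @^-1` [set w | U w = x]); split => //.
    rewrite -[X in measurable X]setTI; exact: measurable_component.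
  by rewrite component_law// (uniform_null U_law).
apply: negligible_bigcup => k; apply: negligibleU.
  apply: negligible_bigcup => j.
  exact: (null k (even_uniform R) (@measurable_even_uniform R) (@even_uniform_law R)).
exact: (null k (odd_uniform R) (@measurable_odd_uniform R) (@odd_uniform_law R)).
Qed.

Section convergence.
Variables (q_ a_ : nat -> R) (q a qbar : R).
Hypothesis q_01 : forall n, 0 <= q_ n <= qbar.
Hypothesis q01 : 0 <= q <= qbar.
Hypothesis qbar_lt1 : qbar < 1.
Hypothesis a_le1 : forall n, a_ n <= 1.
Hypothesis cvg_q : q_ n @[n --> \oo] --> q.
Hypothesis cvg_a : a_ n @[n --> \oo] --> a.

Let q_lt1 n : 0 <= q_ n < 1.
Proof. by have /andP[-> /le_lt_trans->] := q_01 n. Qed.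

Let q_lt : 0 <= q < 1.
Proof. by have /andP[-> /le_lt_trans->] := q01. Qed.

Let qbar01 : 0 <= qbar < 1.
Proof. by rewrite qbar_lt1 andbT; have /andP[/le_trans] := q01; apply. Qed.

(** Off the jumps, the quantiles are eventually constant. *)
Lemma coupled_gaps_cvg w i : ~ irregular q a w ->
  \forall n \near \oo, coupled_gaps (q_ n) (a_ n) w i = coupled_gaps q a w i.
Proof.
move=> reg; set w' := component (int_rank i) w.
have aw j : even_uniform R w' <> q ^+ j.+1.
  by move=> e; apply: reg; exists (int_rank i) => //; left; exists j.
have bw : odd_uniform R w' != a.
  by apply/eqP => e; apply: reg; exists (int_rank i) => //; right.
have geoE := geo_cvg q_lt1 q_lt cvg_q aw.
have belowE : \forall n \near \oo, below (odd_uniform R) (a_ n) w' = below (odd_uniform R) a w'.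
  rewrite /below; move: bw; rewrite neq_lt => /orP[ba|ab].
    rewrite ba; near=> n; near: n; exact: (cvgr_gt _ cvg_a).
  rewrite (ltNge (odd_uniform R w') a) (ltW ab); near=> n; apply/negbTE.
  rewrite -leNgt ltW//; near: n; exact: (cvgr_lt _ cvg_a).
near=> n; rewrite /coupled_gaps /iid_seq /site; congr (_, _); near: n => //.
Unshelve. all: by end_near. Qed.

Lemma coupled_pos_cvg w i : ~ irregular q a w ->
  \forall n \near \oo, pos (spacing v r (coupled_gaps (q_ n) (a_ n) w)) i =
    pos (spacing v r (coupled_gaps q a w)) i.
Proof.
move=> reg; have gE j := coupled_gaps_cvg j reg.
elim/int_step_ind: i => [|i IH|i IH].
- by near=> n; rewrite !pos0.
- near=> n; rewrite !posS /spacing; congr (_ + (_ + _ * (occupancy _)%:R)).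
    by near: n.
  by near: n; exact: gE.
near=> n; apply: (addIr (spacing v r (coupled_gaps q a w) i)).
by rewrite -[RHS]posS -(near IH n)// posS /spacing (near (gE i) n).
Unshelve. all: by end_near. Qed.

Variables (f : uconfig r -> R) (C : R).
Hypothesis cf : continuous f.
Hypothesis f_ge0 : forall x, 0 <= f x.
Hypothesis f_le : forall x, f x <= C.

Lemma integrand_cvg y : ~ irregular q a y.1 ->
  integrand f (couple (q_ n) (a_ n) y) @[n --> \oo] --> integrand f (couple q a y).
Proof.
move=> reg.
have wE : \forall n \near \oo,
    (couple (q_ n) (a_ n) y \in palm_window v r) = (couple q a y \in palm_window v r).
  have g0 := coupled_gaps_cvg 0 reg.
  near=> n; apply/idP/idP; rewrite !inE !palm_windowE/= /spacing.
    by rewrite (near g0 n).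
  by rewrite (near g0 n).
rewrite /integrand.
case: (boolP (couple q a y \in palm_window v r)) => yW; last first.
  apply: cvg_near_cst; near=> n; rewrite !patchE (near wE n)//.
  by rewrite (negbTE yW).
rewrite (_ : (_ \_ _) (couple q a y) = (f (indistinct v r (couple q a y)))%:E); last first.
  by rewrite patchE yW.
have fE : (f (indistinct v r (couple (q_ n) (a_ n) y)))%:E @[n --> \oo] -->
    (f (indistinct v r (couple q a y)))%:E.
  apply: cvg_EFin; first by near=> n.
  apply: (cvg_comp (fun n => renewal v r (couple (q_ n) (a_ n) y))
    (f \o \pi_(uconfig r))); last first.
    by apply: continuous_comp; [exact: pi_continuous|exact: cf].
  apply: cvg_config => i; apply: cvg_near_cst; near=> n => /=.
  by rewrite (near (coupled_pos_cvg i reg) n).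
apply: cvg_trans fE; apply: near_eq_cvg; near=> n.
by rewrite patchE (near wE n)// yW.
Unshelve. all: by end_near. Qed.

Let W := couple qbar 1 @^-1` palm_window v r.

Let window_mono n y :
  palm_window v r (couple (q_ n) (a_ n) y) -> W y.
Proof.
rewrite /W /= !palm_windowE => /andP[yl ->]; rewrite andbT.
apply: le_trans yl; rewrite lerN2 lerD2l ler_wpM2l// ler_nat leq_add//.
  exact: (geo_mono _ (q_01 n) qbar_lt1).
rewrite /= /below; case: (ltP (odd_uniform _ _) (a_ n)) => // ba.
by rewrite (lt_le_trans ba (a_le1 n)).
Qed.

(** Dominated convergence. The quantiles increase with the parameters, hence all the
    windows lie in the window of the gaps with parameters [qbar] and 1, which
    has finite mass. *)
Theorem integral_coupling_cvg :
  (\int[(coin \x leb)]_y integrand f (couple (q_ n) (a_ n) y) @[n --> \oo] -->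
   \int[(coin \x leb)]_y integrand f (couple q a y))%E.
Proof.
have C0 : 0 <= C by apply: le_trans (f_le point).
have mW : measurable W.
  rewrite -[X in measurable X]setTI.
  by apply: measurable_couple => //; exact: measurable_palm_window.
have one01 : 0 <= (1 : R) <= 1.
  by rewrite ler01 lexx.
have W_fin : ((coin \x leb)%E W =
    (2 * r%:num + v%:num * (qbar / (1 - qbar) + 1))%:E)%E.
  rewrite -(palm_window_mass (mean_spacing_gap_law qbar01 one01)).
  exact: (couple_law 1 qbar01 (measurable_palm_window v r)).
have [||||| _ _ cvg_int] := @dominated_convergence _ _ R (coin \x leb)%E setT measurableT
  (fun n y => integrand f (couple (q_ n) (a_ n) y))
  (fun y => integrand f (couple q a y))
  (fun y => C%:E * (\1_W y)%:E)%E.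
- move=> n; apply: measurableT_comp; first exact: measurable_integrand.
  exact: measurable_couple.
- apply: measurableT_comp; first exact: measurable_integrand.
  exact: measurable_couple.
- have [N [mN N0 irrN]] := negligible_irregular q a.
  exists (N `*` setT); split.
  + exact: measurableX.
  + transitivity (coin N * leb setT)%E; first exact: product_measure1E.
    by rewrite N0 mul0e.
  + move=> y /= ny; split=> //; apply: irrN; apply: contrapT => reg.
    by apply: ny => _; exact: integrand_cvg.
- apply: integrableZl => //; apply/integrableP; split.
    exact/measurable_EFinP/measurable_indic.
  rewrite (eq_integral (fun y => (\1_W y)%:E)); last first.
    by move=> y _; rewrite gee0_abs.
  by rewrite integral_indic// setIT [X in (X < _)%E]W_fin ltry.
- apply: nearW => y n _; rewrite /integrand patchE; case: ifPn => [|_].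
    rewrite inE => /window_mono Wy; rewrite indicE mem_set// mule1.
    by rewrite gee0_abs lee_fin.
  by rewrite -[point]/(0%E) abse0 mule_ge0 ?lee_fin.
exact: cvg_int.
Qed.

End convergence.

End coupling.

(** * The parameters of the stationary gaps *)

Section parameters.
Variables (R : realType) (m : R).
Hypothesis m_ge0 : 0 <= m.

Definition discriminant_root (p : R) : R := Num.sqrt ((m + 1) ^+ 2 - 4 * (m * p)).
Local Notation S := discriminant_root.

(** The parameter [a], the mean [g] of the geometric part and its ratio. With
    [a + g = m] and [q = g / (1 + g)] the balance equation reads
    [a (m + 1 - a) = m p]; the smaller root gives [0 <= a <= 1] and [0 <= g]. *)
Definition jumped (p : R) : R := ((m + 1) - S p) / 2.
Definition geo_mean (p : R) : R := ((m - 1) + S p) / 2.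
Definition geo_ratio (p : R) : R := geo_mean p / (1 + geo_mean p).

Lemma discriminant_root_continuous : continuous S.
Proof.
move=> p; apply: (continuous_comp (f := fun p => (m + 1) ^+ 2 - 4 * (m * p))).
  apply: cvgB; first exact: cvg_cst.
  by apply: cvgM; [exact: cvg_cst|apply: cvgM; [exact: cvg_cst|exact: cvg_id]].
exact: sqrt_continuous.
Qed.

Lemma jumped_continuous : continuous jumped.
Proof.
move=> p; apply: cvgM; last exact: cvg_cst.
by apply: cvgB; [exact: cvg_cst|exact: discriminant_root_continuous].
Qed.

Lemma geo_mean_continuous : continuous geo_mean.
Proof.
move=> p; apply: cvgM; last exact: cvg_cst.
by apply: cvgD; [exact: cvg_cst|exact: discriminant_root_continuous].
Qed.

Lemma geo_ratio_continuous p : 1 + geo_mean p != 0 -> {for p, continuous geo_ratio}.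
Proof.
move=> g1; have cg := @geo_mean_continuous p.
by apply: cvgM => //; apply: cvgV => //; apply: cvgD => //; exact: cvg_cst.
Qed.

Variable p : R.
Hypothesis p01 : 0 <= p <= 1.

Lemma discriminant_rootX : S p ^+ 2 = (m + 1) ^+ 2 - 4 * (m * p).
Proof.
rewrite sqr_sqrtr//; have /andP[p0 p1] := p01.
have := sqr_ge0 (m - 1); have : 0 <= m * (1 - p) by rewrite mulr_ge0// subr_ge0.
by rewrite !expr2; lra.
Qed.

Lemma discriminant_root_le : S p <= m + 1.
Proof.
have /andP[p0 p1] := p01; have mp : 0 <= m * p by rewrite mulr_ge0.
have m1 : 0 <= m + 1 by rewrite addr_ge0.
rewrite -(@ler_pXn2r _ 2)// ?nnegrE ?sqrtr_ge0//.
by rewrite discriminant_rootX; lra.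
Qed.

Lemma discriminant_root_ge : `|m - 1| <= S p.
Proof.
have /andP[p0 p1] := p01; have mp : 0 <= m * (1 - p) by rewrite mulr_ge0// subr_ge0.
rewrite -(@ler_pXn2r _ 2)// ?nnegrE ?sqrtr_ge0//.
by rewrite discriminant_rootX real_normK ?num_real// !expr2; lra.
Qed.

Lemma geo_mean_ge0 : 0 <= geo_mean p.
Proof. by have := discriminant_root_ge; rewrite ler_norml /geo_mean; lra. Qed.

Lemma jumped01 : 0 <= jumped p <= 1.
Proof.
have := discriminant_root_ge; rewrite ler_norml /jumped.
by have := discriminant_root_le; lra.
Qed.

Lemma jumped_geo_mean : geo_mean p + jumped p = m.
Proof. by rewrite /geo_mean /jumped; lra. Qed.

Lemma geo_ratio01 : 0 <= geo_ratio p < 1.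
Proof.
have g0 := geo_mean_ge0; rewrite divr_ge0//=; last by lra.
by rewrite ltr_pdivrMr; lra.
Qed.

Lemma geo_ratio_le : geo_ratio p <= m / (1 + m).
Proof.
have g0 := geo_mean_ge0; have gm : geo_mean p <= m.
  by have := jumped_geo_mean; have := jumped01; lra.
rewrite ler_pdivlMr; last by have := m_ge0; lra.
rewrite mulrAC ler_pdivrMr; last by lra.
by rewrite !mulrDr !mulr1; nra.
Qed.

Lemma geo_ratio_mean : geo_ratio p / (1 - geo_ratio p) = geo_mean p.
Proof.
have g0 := geo_mean_ge0; rewrite /geo_ratio; field.
by apply/andP; split; apply/eqP; lra.
Qed.

Lemma parameters_balance :
  p * (1 - jumped p) * geo_ratio p = (1 - p) * jumped p.
Proof.
have g0 := geo_mean_ge0; have g1 : 1 + geo_mean p != 0 by apply/eqP; lra.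
apply: (mulIf g1); rewrite /geo_ratio mulrA mulfVK//.
have aE : jumped p = m - geo_mean p by have := jumped_geo_mean; lra.
have : geo_mean p ^+ 2 = (m - 1) * geo_mean p + m * (1 - p).
  have := discriminant_rootX.
  have -> : S p = 2 * geo_mean p - (m - 1) by rewrite /geo_mean; lra.
  by rewrite !expr2; lra.
rewrite aE expr2 => gE.
have -> : p * (1 - (m - geo_mean p)) * geo_mean p =
  p * ((1 - m) * geo_mean p + geo_mean p * geo_mean p) by ring.
have -> : (1 - p) * (m - geo_mean p) * (1 + geo_mean p) =
  (1 - p) * (m + (m - 1) * geo_mean p - geo_mean p * geo_mean p) by ring.
by rewrite gE; ring.
Qed.

End parameters.

(** Adding a constant makes a bounded function nonnegative, and left limits can be
    tested on sequences. *)
Lemma weakly_cvg_at_left (R : realType) (r : {nonneg R})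
    (mu : R -> probability (uconfig r) R) (p : R) :
  (forall (f : uconfig r -> R) (C : R) (u : nat -> R), continuous f ->
     (forall x, 0 <= f x) -> (forall x, f x <= C) ->
     (forall n, u n < p) -> u n @[n --> \oo] --> p ->
     (\int[mu (u n)]_x (f x)%:E @[n --> \oo] --> \int[mu p]_x (f x)%:E)%E) ->
  weakly_cvg p^'- mu (mu p).
Proof.
move=> H f cf bf.
have [C fC] : exists C, forall x, `|f x| <= C.
  have [M [_ MP]] := bf; exists (M + 1) => x.
  by apply: (MP (M + 1)) => //; rewrite ltrDl.
have int_f (P : probability (uconfig r) R) : P.-integrable setT (EFin \o f).
  apply: measurable_bounded_integrable => //.
  - by apply: (le_lt_trans (probability_le1 P measurableT)); exact: ltry.
  - exact: continuous_measurable_uconfig.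
have int_C (P : probability (uconfig r) R) :
    P.-integrable setT (EFin \o cst C).
  exact: finite_measure_integrable_cst.
have fE (P : probability (uconfig r) R) :
    (\int[P]_x (f x)%:E = \int[P]_x (f x + C)%:E - C%:E)%E.
  under [in RHS]eq_integral do rewrite EFinD.
  rewrite (integralD measurableT (int_f P) (int_C P)) integral_constant addeK//.
have L_fin := integrable_fin_num measurableT (int_f (mu p)).
rewrite -[X in _ --> X](fineK L_fin); apply/cvge_at_leftP => u [up cu].
rewrite (fineK L_fin) fE; under eq_fun do rewrite fE.
apply: cvgeD; last exact: cvg_cst.
  by rewrite fin_num_adde_defl.
apply: (H (fun x => f x + C) (C + C)) => //.
- by move=> x; apply: (cvgD (cf x)); exact: cvg_cst.
- by move=> x; rewrite -lerBlDr sub0r; have := fC x; rewrite ler_norml => /andP[].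
- by move=> x; rewrite lerD2r (le_trans (ler_norm _)).
Qed.

Theorem theorem1 (R : realType) (v : {posnum R}) (r : {nonneg R}) (rho : R)
    (rho_gt0 : 0 < rho)
    (rho_le : 0 < r%:num -> rho <= 1 / (2 * r%:num)) :
  exists mu : R -> probability (uconfig r) R,
    (forall p : R, 0 < p <= 1 ->
       [/\ nonatomic (mu p),
           invariant_measure v p (mu p) &
           mu p (density_set r rho) = 1%E]) /\
    weakly_cvg (1^'-) mu (mu 1).
Proof.
(* The mean number of customers per site at density [rho]. *)
pose m := (rho^-1 - 2 * r%:num) / v%:num.
have v_gt0 : 0 < v%:num by [].
have m_ge0 : 0 <= m.
  rewrite divr_ge0// subr_ge0.
  have [->|r_neq0] := eqVneq r%:num 0; first by rewrite mulr0 invr_ge0 ltW.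
  have r_gt0 : 0 < r%:num by rewrite lt0r r_neq0/=.
  rewrite -[X in X <= _]invrK lef_pV2 ?posrE ?invr_gt0 ?mulr_gt0//.
  by rewrite -[X in _ <= X]mul1r; exact: rho_le.
have cE p : 0 <= p <= 1 -> 2 * r%:num + v%:num *
    (geo_ratio m p / (1 - geo_ratio m p) + jumped m p) = rho^-1.
  move=> p01; rewrite geo_ratio_mean// jumped_geo_mean /m mulrCA divff ?gt_eqF//.
  by rewrite mulr1 addrC subrK.
have c_gt0 : 0 < rho^-1 by rewrite invr_gt0.
pose I (f : uconfig r -> R) p := (\int[(coin R \x lebesgue_measure)]_y
  integrand v f (couple (geo_ratio m p) (jumped m p) y))%E.
have ex p : exists mu : probability (uconfig r) R, 0 < p <= 1 ->
    [/\ nonatomic mu, invariant_measure v p mu, mu (density_set r rho) = 1%E &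
      forall f : uconfig r -> R, continuous f -> (forall x, 0 <= f x) ->
        (\int[mu]_x (f x)%:E = rho%:E * I f p)%E].
  have [p01|] := boolP (0 < p <= 1); last by exists (dirac point).
  have p01' : 0 <= p <= 1 by have /andP[/ltW -> ->] := p01.
  have q01 := geo_ratio01 m_ge0 p01'; have a01 := jumped01 m_ge0 p01'.
  have mean := mean_spacing_gap_law v r q01 a01; rewrite (cE p p01') in mean.
  have typ := gap_law_typical v r q01 a01; rewrite (cE p p01') in typ.
  exists (stationary c_gt0 mean) => _; split.
  - exact: stationary_nonatomic.
  - exact: (stationary_invariant q01 a01 p01' (parameters_balance m_ge0 p01')
      (gap_law_iid q01 a01) (noise_law_iid p01') c_gt0 typ).
  - by have := stationary_density c_gt0 mean typ; rewrite invrK.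
  - by move=> f cf f0; rewrite integral_couple// invrK.
have [mu muP] := choice ex; exists mu; split=> [p /muP[]//|].
apply: weakly_cvg_at_left => f C u cf f0 fC u1 cu.
(* The first terms of [u] may be negative. *)
have [N _ uN] : \forall n \near \oo, 0 < u n by exact: (cvgr_gt _ cu).
have u01 n : 0 < u (n + N)%N <= 1.
  by rewrite (ltW (u1 _)) uN//= leq_addl.
have u01' n : 0 <= u (n + N)%N <= 1 by have /andP[/ltW-> ->] := u01 n.
have one01 : 0 < (1 : R) <= 1 by rewrite ltr01 lexx.
have one01' : 0 <= (1 : R) <= 1 by rewrite ler01 lexx.
have cuN : u (n + N)%N @[n --> \oo] --> (1 : R) by rewrite cvg_shiftn.
rewrite -(cvg_shiftn N).
have [_ _ _ ->//] := muP 1 one01.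
under eq_fun => n do have [_ _ _ ->//] := muP _ (u01 n).
apply: cvgeZl => //.
have qbar_lt1 : m / (1 + m) < 1 by rewrite ltr_pdivrMr; lra.
have ratio01 p : 0 <= p <= 1 -> 0 <= geo_ratio m p <= m / (1 + m).
  by move=> p01; have /andP[-> _] := geo_ratio01 m_ge0 p01; exact: geo_ratio_le.
apply: (integral_coupling_cvg (fun n => ratio01 _ (u01' n)) (ratio01 _ one01')
  qbar_lt1 _ _ _ cf f0 fC).
- by move=> n; have /andP[] := jumped01 m_ge0 (u01' n).
- apply: cvg_comp cuN _; apply: geo_ratio_continuous.
  by rewrite gt_eqF//; have := geo_mean_ge0 m_ge0 one01'; lra.
- by apply: cvg_comp cuN _; exact: jumped_continuous.
Qed.
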